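(* Let $f$ be a loopless $(k,n)$-bounded affine permutation and let $\theta\in\mathbb R^n$ be generic (i.e. $\theta_p\not\equiv\theta_q \pmod \pi$ for all $p\ne q$) and $f$-admissible. For $r\in[n]$ let $I_r=\{f(p)\bmod n:\ p\in\mathbb Z,\ p<r\le f(p)\}$, $J_r=I_r\setminus\{r\}$, and $\epsilon_r=(-1)^{\#\{p\in[n]:\ \bar f(p)\le p<r\}}$. Define $\gamma:\mathbb R\to\mathbb R^n$ by $\gamma_r(t)=\epsilon_r\prod_{p\in J_r}\sin(t-\theta_p)$. Then the linear span $\mathrm{Span}_{\mathbb R}\{\gamma(t):t\in\mathbb R\}$ has dimension $k$, and $\mathrm{Meas}(f,\theta)$ equals (the complexification of) this span as a point of $\mathrm{Gr}_{\ge0}(k,n)$.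
   Context: Notation: $[n]=\{1,\dots,n\}$. $\mathrm{Gr}(k,n)$ is the Grassmannian of $k$-dimensional subspaces of $\mathbb C^n$; a point is the row span of a full-rank $k\times n$ matrix, and its Plücker coordinates $(\Delta_I)_{I\in\binom{[n]}{k}}$ (the maximal minors) are defined up to a common nonzero scalar. $\mathrm{Gr}_{\ge0}(k,n)$ is the set of points whose Plücker coordinates can be chosen all real and $\ge0$. Bounded affine permutations: a $(k,n)$-bounded affine permutation is a bijection $f:\mathbb Z\to\mathbb Z$ with $f(j+n)=f(j)+n$ and $j\le f(j)\le j+n$ for all $j$, and $\sum_{j=1}^n(f(j)-j)=kn$. $f$ is loopless if $f(p)>p$ for all $p$. $\bar f\in S_n$ is defined by $\bar f(p)\equiv f(p)\pmod n$. The length $\ell(f)$ is the number of pairs $(s,t)\in[n]\times\mathbb Z$ with $s<t$ and $f(s)>f(t)$. Reduced graphs: a planar bipartite graph $G$ embedded in a disk, vertices colored black/white with edges joining different colors, with boundary vertices $b_1,\dots,b_n$ on the boundary circle in clockwise order, all black of degree 1 (all other vertices interior); we assume $G$ has an almost perfect matching (a set of edges using every interior vertex exactly once and some subset of boundary vertices), every connected component contains a boundary vertex, and every interior vertex of degree 1 is adjacent to a boundary vertex. A strand is a path turning maximally right at black vertices and maximally left at white vertices. If the strand starting at $b_p$ ends at $b_{p'}$, $f_G(p)$ is the integer in $\{p+1,\dots,p+n\}$ congruent to $p'$ mod $n$, extended by $f_G(p+n)=f_G(p)+n$; all almost perfect matchings use the same number $k$ of boundary vertices and $f_G$ is a loopless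 $(k,n)$-bounded affine permutation. $G$ is reduced if it has exactly $k(n-k)+1-\ell(f_G)$ faces; $\mathcal G_{\rm red}(f)$ denotes the (nonempty, for loopless $f$) set of reduced graphs with $f_G=f$. An edge $e$ is labeled by $\{p,q\}$ if the two strands through $e$ end at $b_p$ and $b_q$. For $\mathrm{wt}:E(G)\to\mathbb C$, $\Delta_I(G,\mathrm{wt})=\sum_{A}\prod_{e\in A}\mathrm{wt}(e)$, the sum over almost perfect matchings $A$ whose set of used boundary indices equals $I$; when these are not all zero, $\mathrm{Meas}(G,\mathrm{wt})\in\mathrm{Gr}(k,n)$ is the point with Plücker coordinates $(\Delta_I(G,\mathrm{wt}))_I$. Strand diagram and admissibility: place $b_1,\dots,b_n$ clockwise on a circle, and points $p^-$ just before and $p^+$ just after $b_p$ in clockwise order. For loopless $f$, the reduced strand diagram $D_f$ consists of the straight arrows $S_p:s^+\to p^-$, $p\in[n]$, where $s=\bar f^{-1}(p)$. Distinct $p,q\in[n]$ form an $f$-crossing if $S_p$ and $S_q$ intersect. $\theta\in\mathbb R^n$ is $f$-admissible if $\theta_p<\theta_q<\theta_p+\pi$ whenever $1\le p<q\le n$ form an $f$-crossing. Critical weights: for $G\in\mathcal G_{\rm red}(f)$, $\mathrm{wt}_\theta(e)=\sin(\theta_q-\theta_p)$ if $e$ is labeled by $\{p,q\}$, $p<q$, and $e$ is not incident to a boundary vertex, and $\mathrm{wt}_\theta(e)=1$ if $e$ is incident to a boundary vertex. For $f$-admissible $\theta$, $\mathrm{Meas}(G,\mathrm{wt}_\theta)$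 is defined, lies in $\mathrm{Gr}_{\ge0}(k,n)$, and does not depend on $G\in\mathcal G_{\rm red}(f)$; it is denoted $\mathrm{Meas}(f,\theta)$. *)

(* Defs.v *)
From HB Require Import structures.
From mathcomp Require Import all_boot all_order all_algebra all_fingroup.
From mathcomp Require Import boolp classical_sets reals trigo.
Set Implicit Arguments. Unset Strict Implicit. Unset Printing Implicit Defensive.
Import Order.TTheory GRing.Theory Num.Theory.
Local Open Scope ring_scope.

(* Conventions: [n] = {1,..,n} is represented by 'I_n, the ordinal i standing
   for the integer i+1.  theta : 'I_n -> R, theta i = theta_{i+1}. *)

Section BAP.
Variables (k n : nat) (f : int -> int).

Definition bounded_affine_perm : Prop :=
  [/\ bijective f,
      (forall j : int, f (j + n%:Z) = f j + n%:Z),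
      (forall j : int, j <= f j <= j + n%:Z)
    & \sum_(j < n) (f (j.+1)%:Z - (j.+1)%:Z) = (k * n)%:Z].

Definition loopless : Prop := forall p : int, p < f p.

Definition length_is (m : nat) : Prop :=
  exists l : seq (int * int), [/\ uniq l, size l = m &
    forall s t : int, (s, t) \in l <-> [/\ 1 <= s <= n%:Z, s < t & f t < f s]].

(* bar f, 0-based: fbar0 i = (f(i+1) mod n) - 1, as an element of {0..n-1} *)
Definition fbar0 (i : 'I_n) : nat := absz ((f (i.+1)%:Z - 1) %% n%:Z)%Z.

(* Points on the circle, clockwise at increasing positions mod 3n:
   p^- at 3p, b_p at 3p+1, p^+ at 3p+2  (p 0-based). *)
Definition in_arc (a b x : nat) : bool :=
  let d u := ((u + 3 * n - a) %% (3 * n))%N in (0 < d x)%N && (d x < d b)%N.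
(* two chords with pairwise distinct endpoints a-b and c-d intersect iff
   their endpoints interleave on the circle *)
Definition chords_cross (a b c d : nat) : bool := in_arc a b c != in_arc a b d.

(* S_p is the chord from s^+ to p^- where bar f(s) = p. *)
Definition fcrossing (p q : 'I_n) : bool :=
  (p != q) && [exists s : 'I_n, [exists s' : 'I_n,
     [&& fbar0 s == p, fbar0 s' == q &
         chords_cross (3 * s + 2) (3 * p) (3 * s' + 2) (3 * q)]]].

Definition admissible {R : realType} (theta : 'I_n -> R) : Prop :=
  forall p q : 'I_n, (p < q)%N -> fcrossing p q ->
    theta p < theta q < theta p + pi.

Definition generic {R : realType} (theta : 'I_n -> R) : Prop :=
  forall p q : 'I_n, p != q -> ~ exists z : int, theta p - theta q = z%:~R * pi.

Definition Jset (r : 'I_n) : {set 'I_n} :=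
  [set i : 'I_n | `[< exists p : int,
       p < (r.+1)%:Z <= f p /\ (f p = (i.+1)%:Z %[mod n%:Z])%Z >] && (i != r)].

Definition eps {R : realType} (r : 'I_n) : R :=
  (-1) ^+ #|[set p : 'I_n | (fbar0 p <= p)%N && (p < r)%N]|.

Definition gamma {R : realType} (theta : 'I_n -> R) (t : R) : 'rV[R]_n :=
  \row_(r < n) (eps r * \prod_(p in Jset r) sin (t - theta p)).

Definition in_span_gamma {R : realType} (theta : 'I_n -> R) (v : 'rV[R]_n) : Prop :=
  exists (m : nat) (ts cs : 'I_m -> R), v = \sum_(j < m) cs j *: gamma theta (ts j).

End BAP.

(* Planar bipartite graphs in a disk, encoded by a rotation system.        *)
(* Black vertices gB, white vertices gW, edges gE (each edge joins eb e to *)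
(* ew e), boundary vertices bnd i = b_{i+1} (black).  rotB (resp. rotW)    *)
(* maps an edge to the next edge CLOCKWISE around its black (resp. white)  *)
(* endpoint.                                                               *)
Record pgraph (n : nat) := PGraph {
  gB : finType; gW : finType; gE : finType;
  eb : gE -> gB; ew : gE -> gW; bnd : 'I_n -> gB;
  rotB : {perm gE}; rotW : {perm gE} }.
Arguments gB {n} p.
Arguments gW {n} p.
Arguments gE {n} p.
Arguments eb {n} p _.
Arguments ew {n} p _.
Arguments bnd {n} p _.
Arguments rotB {n} p.
Arguments rotW {n} p.

Section Graph.
Variables (n : nat) (G : pgraph n).

Definition isBndB (b : gB G) : bool := b \in codom (bnd G).

Definition adj : rel (gB G + gW G) := fun u v =>
  [exists e, ((u == inl (eb G e)) && (v == inr (ew G e)))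
          || ((v == inl (eb G e)) && (u == inr (ew G e)))].

(* Augmented map: G together with the boundary circle b_1 -> b_2 -> ... -> b_n.
   Darts: half-edges (e,true) at eb e, (e,false) at ew e; (i,true) at b_{i+1}
   pointing to b_{i+2}, (i,false) at b_{i+1} pointing to b_i. *)
Definition half := (gE G * bool)%type.
Definition adart := (half + ('I_n * bool))%type.

Definition aalpha (d : adart) : adart :=
  match d with
  | inl (e, b) => inl (e, ~~ b)
  | inr (i, true) => inr (ordS i, false)
  | inr (i, false) => inr (ord_pred i, true)
  end.

(* clockwise rotation; at b_i (on the clockwise circle, the disk on its
   inner side) the clockwise order is: next boundary, G-edge, previous boundary *)
Definition asigma (d : adart) : adart :=
  match d with
  | inl (e, false) => inl (rotW G e, false)
  | inl (e, true) => match [pick i | bnd G i == eb G e] with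
                     | Some i => inr (i, false)
                     | None => inl (rotB G e, true) end
  | inr (i, true) => match [pick e | eb G e == bnd G i] with
                     | Some e => inl (e, true)
                     | None => inr (i, false) end
  | inr (i, false) => inr (i, true)
  end.

Definition norbits (T : finType) (g : T -> T) : nat :=
  #|[set [set y | fconnect g x y] | x : T]|.

Definition nfacesAug : nat := norbits (asigma \o aalpha).

(* genus 0 (Euler's formula) for the (connected) augmented map *)
Definition planar : Prop :=
  (#|{: gB G}| + #|{: gW G}| + nfacesAug = #|{: gE G}| + n + 2)%N.

(* faces of G inside the disk = faces of the augmented map minus the outer one *)
Definition nfaces : nat := (nfacesAug - 1)%N.

Definition isAPM (A : {set gE G}) : bool :=
  [forall b : gB G, if isBndB b then (#|[set e in A | eb G e == b]| <= 1)%N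
                    else #|[set e in A | eb G e == b]| == 1%N]
  && [forall w : gW G, #|[set e in A | ew G e == w]| == 1%N].

Definition usedB (A : {set gE G}) : {set 'I_n} :=
  [set i | [exists e in A, eb G e == bnd G i]].

Definition disk_graph : Prop :=
  injective (bnd G) /\
      (forall e, eb G (rotB G e) = eb G e) /\
      (forall e e', eb G e = eb G e' -> fconnect (rotB G) e e') /\
      (forall e, ew G (rotW G e) = ew G e) /\
      (forall e e', ew G e = ew G e' -> fconnect (rotW G) e e') /\
      (forall i, #|[set e | eb G e == bnd G i]| = 1%N) /\
      (* an interior vertex of degree 1 is adjacent to a boundary vertex:
         for black vertices (whose neighbours are white, hence interior) this
         means there is none; for white ones the unique neighbour is boundary *)
      (forall b, ~~ isBndB b -> #|[set e | eb G e == b]| != 1%N) /\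
      (forall w e, #|[set e' | ew G e' == w]| = 1%N -> ew G e = w -> isBndB (eb G e)) /\
      (forall v, exists i, connect adj v (inl (bnd G i))) /\
    planar.

Definition has_APM : Prop := exists A, isAPM A.

(* Strands: a half-edge (e,true) is traversed from black to white, (e,false)
   from white to black.  At a white vertex the strand turns maximally left
   (next edge clockwise), at a black vertex maximally right (next edge
   counterclockwise). *)
Definition strandT (h : half) : half :=
  if h.2 then (rotW G h.1, false) else (((rotB G)^-1)%g h.1, true).

Definition bndHalf (h : half) : bool := h.2 && isBndB (eb G h.1).

Definition strandEnd (h : half) : option 'I_n :=
  let m := find (fun j => bndHalf (iter j.+1 strandT h)) (iota 0 #|{: half}|) in
  let h' := iter m.+1 strandT h in
  if bndHalf h' then [pick i | bnd G i == eb G h'.1] else None.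

Definition strand_perm_is (f : int -> int) : Prop :=
  forall (i : 'I_n) (e : gE G), eb G e = bnd G i ->
    exists j : 'I_n, strandEnd (e, true) = Some j /\
      f (i.+1)%:Z = (i.+1)%:Z + 1 + ((j%:Z - i%:Z - 1) %% n%:Z)%Z.

Definition reduced_for (k : nat) (f : int -> int) : Prop :=
  [/\ disk_graph, has_APM, strand_perm_is f &
      exists m, length_is n f m /\
        (nfaces%:Z = k%:Z * (n%:Z - k%:Z) + 1 - m%:Z)].

Section Weights.
Variables (R : realType) (theta : 'I_n -> R).

Definition wt_theta (e : gE G) : R :=
  if isBndB (eb G e) then 1 else
  match strandEnd (e, true), strandEnd (e, false) with
  | Some p, Some q => if (p < q)%N then sin (theta q - theta p)
                      else sin (theta p - theta q)
  | _, _ => 0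
  end.

Definition Delta (I : {set 'I_n}) : R :=
  \sum_(A : {set gE G} | isAPM A && (usedB A == I)) \prod_(e in A) wt_theta e.

End Weights.
End Graph.

(* Main.v *)
(** Each strand label [x] has an integer height function on the vertices of the
    reduced graph that drops by one from the black to the white end of every edge
    labelled by [x]; at the white neighbour of the boundary vertex [b_r] it is the
    indicator of [x \in J_r].  Counting signed crossings shows that reducedness
    forces every interior vertex to carry exactly one descent (an edge whose two
    strands end in decreasing order), and planarity turns the descents into
    Kasteleyn signs.  With these signs, the products over [x] of
    [sin (t - theta x)] raised to the heights are annihilated by the weighted
    adjacency matrix at each interior black vertex, by the addition formula
    [sin (b - a) = cos (t - b) sin (t - a) - cos (t - a) sin (t - b)].
    As heights may be negative, [sin (t - theta x)] is first deformed to the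
    linear polynomial [cos (t - theta x) X + sin (t - theta x)], specialised to
    [X = 0] at the end.  Kasteleyn's theorem then says that [gamma t] wedges to
    zero with the boundary measurements, i.e. lies in the subspace they define.
    The [k] points [gamma (theta x)], for [x] a value [sig a <= a] of the strand
    permutation [sig], give a triangular minor and hence a basis; the descent
    matching is the only one with its boundary, so the measurements do not all
    vanish. *)
Require Import Defs.
From HB Require Import structures.
From mathcomp Require Import boolp classical_sets reals trigo.
From mathcomp Require Import all_boot all_order all_algebra all_fingroup.
From mathcomp Require Import zify ring lra.
Set Implicit Arguments. Unset Strict Implicit. Unset Printing Implicit Defensive.
Import Order.TTheory GRing.Theory Num.Theory.
Local Open Scope ring_scope.

(** * Combinatorial maps *)

(** The topology of the disk enters only through Euler's formula. Over a field, connectivity and a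
    rank count turn it into exactness: closed cochains have potentials, whence the heights, and, for
    the dual map, cycles modulo 2 bound sets of faces, which replaces the Jordan curve theorem. Why
    descents give Kasteleyn signs: at an interior vertex with a single descent the cyclic distances
    from [p] to [q] over its edges add up to [n]. The two edges at a corner thus use at most [n],
    which, up to a boundary correction, bounds the descents around a face by one less than half its
    length; Euler's formula shows that all these bounds are attained. Adding them over the faces
    enclosed by an alternating cycle, together with Euler's formula modulo 2 for that region, gives
    the sign of exchanging two matchings. A set [J] of size [k + 1] has one boundary vertex more
    than a matching uses. A virtual white vertex absorbs it; a cycle through the virtual vertex is
    closed up along the boundary circle, and the boundary correction on this arc is the origin of
    the signs [eps]. *)

Lemma porbit_step (T : finType) (s : {perm T}) x : porbit s (s x) = porbit s x.
Proof. by have := porbit_perm s 1 x; rewrite expg1. Qed.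

Lemma mem_porbit_step (T : finType) (s : {perm T}) x y :
  (s y \in porbit s x) = (y \in porbit s x).
Proof. by rewrite -!eq_porbit_mem porbit_step. Qed.

Lemma porbits_partition (T : finType) (s : {perm T}) : partition (porbits s) [set: T].
Proof.
apply/and3P; split.
- rewrite /cover eqEsubset subsetT /=; apply/subsetP=> x _.
  by apply/bigcupP; exists (porbit s x); rewrite ?imset_f ?porbit_id.
- apply/trivIsetP => _ _ /imsetP[x _ ->] /imsetP[y _ ->].
  rewrite eq_porbit_mem => nxy; apply/pred0P=> z /=; apply/negP.
  case/andP=> zx zy; move: nxy; rewrite -eq_porbit_mem.
  by move: zx zy; rewrite -!eq_porbit_mem => /eqP<- /eqP->; rewrite eqxx.
- by apply/negP=> /imsetP[x _ /setP/(_ x)]; rewrite inE porbit_id.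
Qed.

Lemma porbits_partition_on (T : finType) (s : {perm T}) (S : {set T}) :
  (forall x, x \in S -> s x \in S) -> partition (porbit s @: S) S.
Proof.
move=> sS; apply/and3P; split.
- apply/eqP/setP=> x; apply/bigcupP/idP => [[_ /imsetP[y yS ->]]|xS].
    case/porbitP=> m ->; elim: m => [|m IH]; first by rewrite expg0 perm1.
    by rewrite expgSr permM sS.
  by exists (porbit s x); rewrite ?imset_f ?porbit_id.
- have /and3P[_ tr _] := porbits_partition s; apply: trivIsetS tr.
  by apply/subsetP=> _ /imsetP[x _ ->]; apply: imset_f.
- by apply/negP=> /imsetP[x _ /setP/(_ x)]; rewrite inE porbit_id.
Qed.

Lemma sum_porbits (V : nmodType) (T : finType) (s : {perm T}) (F : T -> V) :
  \sum_(X in porbits s) \sum_(x in X) F x = \sum_x F x.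
Proof.
rewrite -(set_partition_big _ (porbits_partition s)) /=.
by apply: eq_bigl => x; rewrite inE.
Qed.

Lemma sum_porbit_perm (V : nmodType) (T : finType) (s : {perm T}) (F : T -> V) X :
  X \in porbits s -> \sum_(x in X) F (s x) = \sum_(x in X) F x.
Proof.
case/imsetP=> x _ ->; rewrite [RHS](reindex_inj (@perm_inj _ s)) /=.
by apply: eq_bigl => y; rewrite mem_porbit_step.
Qed.

(** * Exactness for a connected map of genus zero *)

Section MapExact.
Variables (K : fieldType) (D : finType).

Definition orbit_mx (s : {perm D}) : 'M[K]_(#|porbits s|, #|D|) :=
  \matrix_(i, j) (enum_val j \in (enum_val i : {set D}))%:R.

Lemma porbit_in_porbits (s : {perm D}) (d : D) : porbit s d \in porbits s.
Proof. exact: imset_f. Qed.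

Definition orbit_idx (s : {perm D}) (d : D) : 'I_#|porbits s| :=
  enum_rank_in (porbit_in_porbits s d) (porbit s d).

Lemma orbit_idxK (s : {perm D}) d : enum_val (orbit_idx s d) = porbit s d.
Proof. by rewrite enum_rankK_in // porbit_in_porbits. Qed.

Lemma mem_enum_val_porbits (s : {perm D}) d (i : 'I_#|porbits s|) :
  (d \in (enum_val i : {set D})) = (i == orbit_idx s d).
Proof.
have /imsetP[y _ iE] := enum_valP i; rewrite -(inj_eq enum_val_inj) orbit_idxK iE.
by rewrite eq_porbit_mem porbit_sym.
Qed.

Lemma orbit_idx_surj (s : {perm D}) (i : 'I_#|porbits s|) :
  exists d, i = orbit_idx s d.
Proof.
have /imsetP[y _ iE] := enum_valP i; exists y.
by apply/eqP; rewrite -mem_enum_val_porbits iE porbit_id.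
Qed.

Lemma orbit_idx_perm (s : {perm D}) d : orbit_idx s (s d) = orbit_idx s d.
Proof.
by apply: enum_val_inj; rewrite !orbit_idxK porbit_step.
Qed.

Lemma mul_orbit_mx (s : {perm D}) (x : 'rV[K]_#|porbits s|) (j : 'I_#|D|) :
  (x *m orbit_mx s) 0 j = x 0 (orbit_idx s (enum_val j)).
Proof.
rewrite mxE (bigD1 (orbit_idx s (enum_val j))) //= mxE mem_enum_val_porbits eqxx.
rewrite mulr1 big1 ?addr0 // => i ni.
by rewrite mxE mem_enum_val_porbits (negbTE ni) mulr0.
Qed.

Definition dart_row (w : D -> K) : 'rV[K]_#|D| := \row_j w (enum_val j).

Lemma dart_row_mul_tr (s : {perm D}) (w : D -> K) i :
  (dart_row w *m (orbit_mx s)^T) 0 i = \sum_(d in (enum_val i : {set D})) w d.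
Proof.
rewrite mxE (reindex_onto (@enum_rank D) (@enum_val D predT)) /=; last first.
  by move=> j _; rewrite enum_valK.
rewrite [RHS]big_mkcond /=; apply: eq_big => d; first by rewrite enum_rankK eqxx.
by rewrite !mxE enum_rankK; case: ifP => _ _; rewrite ?mulr1 ?mulr0.
Qed.

Variables (al s : {perm D}) (d0 : D).
Hypothesis conn : forall A : {set D}, d0 \in A ->
  (forall x, x \in A -> al x \in A /\ s x \in A) -> A = [set: D].
Hypothesis alK : involutive al.
Hypothesis al_neq : forall x, al x != x.

Lemma conn_const (T : eqType) (f : D -> T) :
  (forall x, f (al x) = f x) -> (forall x, f (s x) = f x) -> forall x, f x = f d0.
Proof.
move=> fa fs x; have := @conn [set y | f y == f d0].
rewrite inE eqxx => /(_ isT) H.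
have : x \in [set y | f y == f d0].
  by rewrite H ?inE // => y; rewrite !inE fa fs.
by rewrite inE => /eqP.
Qed.

Lemma porbit_al x : porbit al x = [set x; al x].
Proof.
apply/setP=> y; rewrite !inE; apply/porbitP/orP => [[i ->]|[/eqP->|/eqP->]].
- elim: i => [|i [/eqP IH|/eqP IH]]; first by rewrite expg0 perm1 eqxx; left.
    by right; rewrite expgSr permM IH.
  by left; rewrite expgSr permM IH alK.
- by exists 0%N; rewrite expg0 perm1.
- by exists 1%N; rewrite expg1.
Qed.

Lemma card_porbits_al : #|D| = (#|porbits al| * 2)%N.
Proof.
rewrite -cardsT; apply: (card_uniform_partition _ (porbits_partition al)) => _ /imsetP[x _ ->].
by rewrite porbit_al cards2 eq_sym al_neq.
Qed.

Let phi := (al * s)%g.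

(** A dimension count. Coboundaries [B] lie in the cocycles [Z]. By connectivity only constants have
    zero coboundary, so [B] has rank at least the number of vertices minus one; by connectivity
    again the edge and face equations defining [Z] satisfy at most one relation. Euler's formula
    makes the two bounds meet. *)
Lemma map_exact (w : D -> K) :
  (#|porbits s| + #|porbits phi| = #|porbits al| + 2)%N ->
  (forall x, w x + w (al x) = 0) ->
  (forall x, \sum_(y in porbit phi x) w y = 0) ->
  exists u : D -> K, (forall x, u (s x) = u x) /\ (forall x, w x = u (al x) - u x).
Proof.
move=> euler wal wphi.
pose Z := kermx (row_mx (orbit_mx al)^T (orbit_mx phi)^T).
pose B : 'M[K]_(#|porbits s|, #|D|) := \matrix_(i, j)
   ((al (enum_val j) \in (enum_val i : {set D}))%:R
      - (enum_val j \in (enum_val i : {set D}))%:R).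
have inZ v : (forall x, v x + v (al x) = 0) ->
   (forall x, \sum_(y in porbit phi x) v y = 0) -> (dart_row v <= Z)%MS.
  move=> va vp; apply/sub_kermxP; rewrite mul_mx_row -[0]row_mx0.
  congr row_mx; apply/rowP=> i; rewrite dart_row_mul_tr mxE;
    have [d ->] := orbit_idx_surj i; rewrite orbit_idxK //.
  by rewrite porbit_al big_setU1 ?inE ?big_set1 //= eq_sym al_neq.
have mulB x j : (x *m B) 0 j =
    x 0 (orbit_idx s (al (enum_val j))) - x 0 (orbit_idx s (enum_val j)).
  have E d : \sum_i x 0 i * (d \in (enum_val i : {set D}))%:R = x 0 (orbit_idx s d).
    rewrite (bigD1 (orbit_idx s d)) //= mem_enum_val_porbits eqxx mulr1 big1 ?addr0 //.
    by move=> i ni; rewrite mem_enum_val_porbits (negbTE ni) mulr0.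
  rewrite mxE -[in RHS]E -[in X in _ - X]E -sumrB; apply: eq_bigr => i _.
  by rewrite mxE mulrBr.
have BZ : (B <= Z)%MS.
  apply/row_subP => i.
  have -> : row i B = dart_row (fun d => (al d \in (enum_val i : {set D}))%:R
      - (d \in (enum_val i : {set D}))%:R).
    by apply/rowP=> j; rewrite !mxE.
  have [e ->] := orbit_idx_surj i; rewrite orbit_idxK.
  apply: inZ => x; first by rewrite alK addrA subrK subrr.
  rewrite sumrB; apply/eqP; rewrite subr_eq0; apply/eqP.
  rewrite [RHS](reindex_inj (@perm_inj _ phi)) /=; apply: eq_big => d.
    by rewrite mem_porbit_step.
  by rewrite /phi permM mem_porbit_step.
have rkB : (#|porbits s| <= (\rank B).+1)%N.
  have : (kermx B <= (const_mx 1 : 'rV[K]_#|porbits s|))%MS.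
    apply/rV_subP => x /sub_kermxP xB; apply/sub_rVP.
    exists (x 0 (orbit_idx s d0)); apply/rowP=> i; rewrite !mxE mulr1.
    have [d ->] := orbit_idx_surj i.
    apply: (conn_const (f := fun d => x 0 (orbit_idx s d))) => y.
      move/rowP/(_ (enum_rank y)): xB.
      by rewrite mulB mxE enum_rankK => /eqP; rewrite subr_eq0 => /eqP.
    by rewrite orbit_idx_perm.
  move/mxrankS => H; have := leq_trans H (rank_leq_row _).
  by rewrite mxrank_ker leq_subLR addn1.
have rkZ : (\rank Z <= #|porbits al| * 2 - (#|porbits al| + #|porbits phi| - 1))%N.
  rewrite mxrank_ker -card_porbits_al; apply: leq_sub2l.
  rewrite -[\rank _]mxrank_tr tr_row_mx !trmxK.
  set M := col_mx _ _.
  (* The one relation: the sum over all edge orbits and the sum over all face orbits are both the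
     sum over all darts. *)
  pose c : 'rV[K]_(#|porbits al| + #|porbits phi|) := row_mx (const_mx 1) (const_mx (-1)).
  have : (kermx M <= c)%MS.
    apply/rV_subP => x /sub_kermxP xM; apply/sub_rVP.
    move: xM; rewrite -[x]hsubmxK mul_row_col.
    move: (lsubmx x) (rsubmx x) => y z xM.
    have yz d : y 0 (orbit_idx al d) = - z 0 (orbit_idx phi d).
      move/rowP/(_ (enum_rank d)): xM; rewrite [LHS]mxE [RHS]mxE !mul_orbit_mx enum_rankK.
      by move/eqP; rewrite addr_eq0 => /eqP.
    have cst d : y 0 (orbit_idx al d) = y 0 (orbit_idx al d0).
      apply: (conn_const (f := fun d => y 0 (orbit_idx al d))) => e.
        by rewrite orbit_idx_perm.
      have -> : s e = phi (al e) by rewrite /phi permM alK.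
      by rewrite yz orbit_idx_perm -yz orbit_idx_perm.
    exists (y 0 (orbit_idx al d0)); rewrite /c scale_row_mx; congr row_mx.
      by apply/rowP=> i; have [d ->] := orbit_idx_surj i; rewrite !mxE mulr1 cst.
    apply/rowP=> i; have [d ->] := orbit_idx_surj i; rewrite !mxE.
    by rewrite -(cst d) yz mulrN mulr1 opprK.
  move/mxrankS => H; have := leq_trans H (rank_leq_row _).
  by rewrite mxrank_ker; lia.
have : (dart_row w <= B)%MS.
  apply: submx_trans (inZ w wal wphi) _.
  rewrite -(geq_leqif (mxrank_leqif_sup BZ)).
  apply: leq_trans rkZ _; rewrite -ltnS; apply: leq_trans rkB.
  have s_gt0 : (0 < #|porbits s|)%N.
    by rewrite card_gt0; apply/set0Pn; exists (porbit s d0); apply: porbit_in_porbits.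
  lia.
case/submxP => x xE; exists (fun d => x 0 (orbit_idx s d)); split=> d.
  by rewrite orbit_idx_perm.
by move/rowP/(_ (enum_rank d)): xE; rewrite mulB mxE enum_rankK.
Qed.

End MapExact.

Lemma sum_porbit_telescope (V : zmodType) (T : finType) (s : {perm T}) (c : T -> V) x :
  \sum_(y in porbit s x) (c (s y) - c y) = 0.
Proof.
rewrite sumrB; apply/eqP; rewrite subr_eq0; apply/eqP.
rewrite [RHS](reindex_inj (@perm_inj _ s)) /=; apply: eq_bigl => d.
by rewrite mem_porbit_step.
Qed.

Lemma porbit_fconnect (T : finType) (s : {perm T}) x : porbit s x = [set y | fconnect s x y].
Proof.
apply/setP=> y; rewrite inE; apply/porbitP/idP => [[i ->]|].
  by rewrite permX fconnect_iter.
by move/iter_findex=> <-; exists (findex s x y); rewrite permX.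
Qed.

Lemma ordS_ind (n : nat) (P : 'I_n -> Prop) (i0 : 'I_n) :
  P i0 -> (forall i, P i -> P (ordS i)) -> forall j, P j.
Proof.
move=> P0 PS j.
have H m : P (iter m (@ordS n) i0) by elim: m => [|m IH] //=; apply: PS.
have V m : nat_of_ord (iter m (@ordS n) i0) = ((i0 + m) %% n)%N.
  elim: m => [|m IH] /=; first by rewrite addn0 modn_small.
  by rewrite IH -addn1 modnDml addn1 addnS.
have -> : j = iter (j + n - i0) (@ordS n) i0.
  apply: val_inj; rewrite /= V subnKC; last by have := ltn_ord i0; lia.
  by rewrite modnDr modn_small.
exact: H.
Qed.

(** * The map formed by the graph and the boundary circle *)

Section AugMap.
Variables (n : nat) (G : pgraph n).
Hypothesis hG : disk_graph G.

Let bnd_inj : injective (bnd G). Proof. by case: hG. Qed.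
Let ebB e : eb G (rotB G e) = eb G e. Proof. by case: hG => _ []. Qed.
Let ebP e e' : eb G e = eb G e' -> fconnect (rotB G) e e'.
Proof. by case: hG => _ [_ [+ _]]; apply. Qed.
Let ewW e : ew G (rotW G e) = ew G e. Proof. by case: hG => _ [_ [_ []]]. Qed.
Let ewP e e' : ew G e = ew G e' -> fconnect (rotW G) e e'.
Proof. by case: hG => _ [_ [_ [_ [+ _]]]]; apply. Qed.
Let bnd1 i : #|[set e | eb G e == bnd G i]| = 1%N.
Proof. by case: hG => _ [_ [_ [_ [_ []]]]]. Qed.
Let vconn v : exists i, connect (@adj n G) v (inl (bnd G i)).
Proof. by case: hG => _ [_ [_ [_ [_ [_ [_ [_ []]]]]]]]. Qed.
Let hplanar : planar G. Proof. by case: hG => _ [_ [_ [_ [_ [_ [_ [_ []]]]]]]]. Qed.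

Lemma bedge_ex i : exists e, eb G e == bnd G i.
Proof.
have /eqP/cards1P[e eE] := bnd1 i; exists e.
by have := set11 e; rewrite -eE inE.
Qed.

Definition bedge i : gE G := xchoose (bedge_ex i).

Lemma eb_bedge i : eb G (bedge i) = bnd G i.
Proof. exact: (eqP (xchooseP (bedge_ex i))). Qed.

Lemma bedge_uniq i e : eb G e = bnd G i -> e = bedge i.
Proof.
move=> ei; have /eqP/cards1P[e' eE] := bnd1 i.
have : e \in [set e | eb G e == bnd G i] by rewrite inE ei.
have : bedge i \in [set e | eb G e == bnd G i] by rewrite inE eb_bedge.
by rewrite eE !inE => /eqP -> /eqP ->.
Qed.

Lemma bedge_inj : injective bedge.
Proof. by move=> i j ij; apply: bnd_inj; rewrite -!eb_bedge ij. Qed.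

Lemma asigma_bnd i e : eb G e = bnd G i -> asigma (inl (e, true) : adart G) = inr (i, false).
Proof.
move=> ei /=; case: pickP => [j /eqP ji|/(_ i)]; last by rewrite ei eqxx.
by congr (inr (_, _)); apply: bnd_inj; rewrite ji.
Qed.

Lemma asigma_int e : ~~ isBndB (eb G e) -> asigma (inl (e, true) : adart G) = inl (rotB G e, true).
Proof.
move=> ni /=; case: pickP => // j /eqP ji.
by move: ni; rewrite /isBndB -ji codom_f.
Qed.

Lemma asigma_arc i : asigma (inr (i, true) : adart G) = inl (bedge i, true).
Proof.
rewrite /=; case: pickP => [e /eqP ei|/(_ (bedge i))]; last by rewrite eb_bedge eqxx.
by rewrite (bedge_uniq ei).
Qed.

Lemma isBndBP b : reflect (exists i, b = bnd G i) (isBndB b).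
Proof. exact: codomP. Qed.

Definition vx (d : adart G) : gB G + gW G :=
  match d with
  | inl (e, true) => inl (eb G e)
  | inl (e, false) => inr (ew G e)
  | inr (i, _) => inl (bnd G i)
  end.

Lemma vx_asigma d : vx (asigma d) = vx d.
Proof.
case: d => [[e []]|[i []]].
- case: (isBndBP (eb G e)) => [[i ei]|ni]; first by rewrite (asigma_bnd ei) /= ei.
  by rewrite asigma_int ?(introN (isBndBP _)) //= ebB.
- by rewrite /= ewW.
- by rewrite asigma_arc /= eb_bedge.
- by [].
Qed.

Lemma vx_fconnect d d' : vx d = vx d' -> fconnect (@asigma n G) d d'.
Proof.
have arcs i : [/\ fconnect (@asigma n G) (inr (i, false)) (inr (i, true)),
   fconnect (@asigma n G) (inr (i, true)) (inl (bedge i, true)) &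
   fconnect (@asigma n G) (inl (bedge i, true)) (inr (i, false))].
  split; first by apply/connect1/eqP.
    by apply/connect1/eqP; apply: asigma_arc.
  by apply/connect1/eqP; apply: asigma_bnd (eb_bedge i).
have to i x : vx x = inl (bnd G i) ->
   fconnect (@asigma n G) x (inr (i, false)) /\ fconnect (@asigma n G) (inr (i, false)) x.
  have [a1 a2 a3] := arcs i.
  case: x => [[e []]|[j []]] //= [] => [/bedge_uniq ->|/bnd_inj->|/bnd_inj->] //.
    by split=> //; apply: connect_trans a1 a2.
  by split=> //; apply: connect_trans a2 a3.
case vd' : (vx d') => [b|w] vd; last first.
  case: d vd => [[e []]|[i []]] //= [we].
  case: d' vd' => [[e' []]|[i []]] //= [we'].
  have := ewP (etrans we (esym we')) => /iter_findex <-.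
  elim: (findex _ _ _) => [|m IH] //=.
  by apply: connect_trans IH _; apply: connect1 => /=.
case: (isBndBP b) => [[i bi]|ni].
  rewrite bi in vd vd'; have [h1 _] := to _ _ vd; have [_ h2] := to _ _ vd'.
  exact: connect_trans h1 h2.
case: d vd => [[e []]|[i []]] //= [be]; last 2 first.
- by case: ni; exists i.
- by case: ni; exists i.
case: d' vd' => [[e' []]|[i []]] //= [be']; last 2 first.
- by case: ni; exists i.
- by case: ni; exists i.
have := ebP (etrans be (esym be')) => /iter_findex <-.
elim: (findex _ _ _) => [|m IH] //=.
apply: connect_trans IH _; apply/connect1/eqP; apply: asigma_int.
have -> : eb G (iter m (rotB G) e) = eb G e by elim: m => //= m <-.
by rewrite be; apply/isBndBP.
Qed.

(** The rotation is given by cases and choices, so it is not visibly a permutation. A dart is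
    reachable from its own image, both lying at one vertex; hence the rotation is surjective, and
    injective by finiteness. *)
Lemma asigma_inj : injective (@asigma n G).
Proof.
pose f := @asigma n G; pose g d := iter (findex f (f d) d) f d.
have gK : cancel g f.
  move=> d; rewrite /g -iterS iterSr; apply: iter_findex.
  by apply: vx_fconnect; rewrite vx_asigma.
exact: bij_inj (bij_can_bij (injF_bij (can_inj gK)) gK).
Qed.

Lemma aalphaK : involutive (@aalpha n G).
Proof.
case=> [[e b]|[i []]] /=; first by rewrite negbK.
  by rewrite ordSK.
by rewrite ord_predK.
Qed.

Lemma aalpha_neq d : aalpha d != d :> adart G.
Proof. by case: d => [[e []]|[i []]] /=; apply/eqP => -[]. Qed.

Definition sg : {perm adart G} := perm asigma_inj.
Definition al : {perm adart G} := perm (inv_inj aalphaK).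
Definition phi : {perm adart G} := (al * sg)%g.

Lemma sgE d : sg d = asigma d. Proof. exact: permE. Qed.
Lemma alE d : al d = aalpha d. Proof. exact: permE. Qed.
Lemma phiE d : phi d = asigma (aalpha d). Proof. by rewrite permM sgE alE. Qed.

Lemma alK : involutive al.
Proof. by move=> d; rewrite !alE aalphaK. Qed.

Lemma al_neq d : al d != d.
Proof. by rewrite alE aalpha_neq. Qed.

Lemma porbit_sg d : porbit sg d = [set y | vx y == vx d].
Proof.
rewrite porbit_fconnect; apply/setP=> y; rewrite !inE; apply/idP/eqP => [|vy].
  move/iter_findex=> <-; elim: (findex _ _ _) => [|m IH] //=.
  by rewrite sgE vx_asigma.
rewrite (eq_connect (e' := frel (@asigma n G))).
  by apply: vx_fconnect.
by move=> a b /=; rewrite sgE.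
Qed.

Lemma vx_sg d : vx (sg d) = vx d.
Proof. by rewrite sgE vx_asigma. Qed.

Lemma vx_surj v : exists d, vx d = v.
Proof.
case: v => [b|w].
  case: (isBndBP b) => [[i ->]|nb]; first by exists (inr (i, true)).
  have [i] := vconn (inl b).
  case/connectP=> -[|v p] /=; first by move=> _ [bi]; case: nb; exists i.
  case/andP=> /existsP[e /orP[]/andP[/eqP bv /eqP ve]] _ _; last by [].
  by exists (inl (e, true)); rewrite /= -bv.
have [i] := vconn (inr w).
case/connectP=> -[|v p] //=.
case/andP=> /existsP[e /orP[]/andP[/eqP bv /eqP ve]] _ _; first by [].
by exists (inl (e, false)); rewrite /= -ve.
Qed.

Lemma adj_sym : symmetric (@adj n G).
Proof. by move=> u v; apply/existsP/existsP => -[e]; rewrite orbC => H; exists e. Qed.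

(** The graph itself may be disconnected. Each component reaches the boundary, and the boundary
    circle, followed by induction along [ordS], joins the components. *)
Lemma map_connected d0 (A : {set adart G}) : d0 \in A ->
  (forall x, x \in A -> al x \in A /\ sg x \in A) -> A = [set: adart G].
Proof.
move=> d0A Acl.
have orbA d d' : d \in A -> vx d' = vx d -> d' \in A.
  move=> dA vd; have /porbitP[m ->] : d' \in porbit sg d by rewrite porbit_sg inE vd.
  elim: m => [|m IH]; first by rewrite expg0 perm1.
  by rewrite expgSr permM; apply: (Acl _ IH).2.
have adjA u v : adj u v -> (forall d, vx d = u -> d \in A) -> forall d, vx d = v -> d \in A.
  case/existsP=> e /orP[]/andP[/eqP uE /eqP vE] uA d vd.
    have := (Acl _ (uA (inl (e, true)) (esym uE))).1; rewrite alE /= => H.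
    by apply: orbA H _; rewrite vd vE.
  have := (Acl _ (uA (inl (e, false)) (esym vE))).1; rewrite alE /= => H.
  by apply: orbA H _; rewrite vd uE.
have conA u v : connect (@adj n G) u v -> (forall d, vx d = u -> d \in A) -> forall d, vx d = v -> d \in A.
  case/connectP=> p; elim: p u => [|w p IH] u /=; first by move=> _ ->.
  by case/andP=> uw wp vE uA; apply: IH wp vE _; apply: adjA uw uA.
have [i0 ci0] := vconn (vx d0).
have bA : forall j d, vx d = inl (bnd G j) -> d \in A.
  apply: (@ordS_ind n (fun j => forall d, vx d = inl (bnd G j) -> d \in A) i0).
    by apply: conA ci0 _ => d vd; apply: orbA d0A _.
  move=> i iA d vd; have := (Acl _ (iA (inr (i, true)) erefl)).1.
  by rewrite alE /= => H; apply: orbA H _; rewrite vd.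
apply/setP=> d; rewrite inE; have [i] := vconn (vx d).
rewrite (sym_connect_sym adj_sym) => ci; exact: (conA _ _ ci (bA i)).
Qed.

Lemma card_porbits_sg : #|porbits sg| = (#|{: gB G}| + #|{: gW G}|)%N.
Proof.
have -> : porbits sg = [set [set d | vx d == v] | v : gB G + gW G].
  apply/setP=> X; apply/imsetP/imsetP => [[d _ ->]|[v _ ->]].
    by exists (vx d); rewrite ?porbit_sg.
  by have [d vd] := vx_surj v; exists d; rewrite // porbit_sg vd.
rewrite card_imset; first by rewrite -[RHS]card_sum; apply: eq_card.
move=> v v' /setP vv; have [d vd] := vx_surj v.
by have := vv d; rewrite !inE vd eqxx => /esym/eqP.
Qed.

Lemma card_porbits_phi : #|porbits phi| = nfacesAug G.
Proof.
rewrite /nfacesAug /norbits; congr #|pred_of_set _|.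
apply: eq_imset => d; rewrite porbit_fconnect; apply/setP=> y; rewrite !inE.
by apply: eq_connect => a b /=; rewrite phiE.
Qed.

Lemma card_adart : #|{: adart G}| = ((#|{: gE G}| + n) * 2)%N.
Proof. by rewrite card_sum !card_prod card_bool card_ord mulnDl. Qed.

Lemma card_porbits_aalpha : #|porbits al| = (#|{: gE G}| + n)%N.
Proof.
have := card_porbits_al alK al_neq; rewrite card_adart => /eqP.
by rewrite eqn_pmul2r // => /eqP.
Qed.

Lemma euler : (#|porbits sg| + #|porbits phi| = #|porbits al| + 2)%N.
Proof.
rewrite card_porbits_aalpha card_porbits_sg card_porbits_phi.
exact: hplanar.
Qed.

(** Vanishing of the first cohomology of the disk: a cochain closed around every face is the
    difference of a vertex potential. *)
Lemma planar_exact (K : fieldType) (w : adart G -> K) :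
  (forall x, w x + w (al x) = 0) ->
  (forall x, \sum_(y in porbit phi x) w y = 0) ->
  exists u : gB G + gW G -> K, forall d, w d = u (vx (al d)) - u (vx d).
Proof.
move=> wal wphi; case: (pickP (@predT (adart G))) => [d0 _|no]; last first.
  by exists (fun=> 0) => d; have := no d.
have [u [us wu]] := map_exact (map_connected (d0 := d0)) alK al_neq euler wal wphi.
have uv d d' : vx d = vx d' -> u d = u d'.
  move=> dd; have /porbitP[m ->] : d' \in porbit sg d by rewrite porbit_sg inE dd.
  by elim: m => [|m IH]; rewrite ?expg0 ?perm1 // expgSr permM us.
exists (fun v => if [pick d | vx d == v] is Some d then u d else 0) => d.
have E d' : (if [pick e | vx e == vx d'] is Some e then u e else 0) = u d'.
  by case: pickP => [e /eqP/uv //|/(_ d')]; rewrite eqxx.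
by rewrite !E wu.
Qed.

(** Exactness for the dual map, in which vertices and faces change places: as [al] is an involution,
    [al * phi = sg]. Over ['F_2] this says that every cycle is the boundary of a set of faces. *)
Lemma planar_coexact (K : fieldType) (w : adart G -> K) :
  (forall x, w x + w (al x) = 0) ->
  (forall x, \sum_(y | vx y == vx x) w y = 0) ->
  exists r : adart G -> K, (forall d, r (phi d) = r d) /\
     forall d, w d = r (al d) - r d.
Proof.
move=> wal wsg; case: (pickP (@predT (adart G))) => [d0 _|no]; last first.
  by exists (fun=> 0); split=> d; have := no d.
have alphi : (al * phi = sg)%g.
  by apply/permP=> d; rewrite !permM alK.
have conn (A : {set adart G}) : d0 \in A ->
    (forall x, x \in A -> al x \in A /\ phi x \in A) -> A = [set: adart G].
  move=> dA Acl; apply: map_connected dA _ => x xA; split; first exact: (Acl _ xA).1.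
  have := (Acl _ (Acl _ xA).1).2.
  by rewrite permM alK.
apply: (map_exact conn alK al_neq _ wal); first by rewrite alphi addnC euler.
move=> x; rewrite alphi porbit_sg -[RHS](wsg x); apply: eq_bigl => y.
by rewrite inE.
Qed.

Lemma n_gt0 : (0 < n)%N.
Proof.
case: (posnP n) => // n0; move: hplanar; rewrite /planar.
have no (v : gB G + gW G) : False.
  by have [i _] := vconn v; have := ltn_ord i; move: (nat_of_ord i) => m; rewrite n0.
have -> : #|{: gB G}| = 0%N by apply: eq_card0 => b; case: (no (inl b)).
have -> : #|{: gW G}| = 0%N by apply: eq_card0 => b; case: (no (inr b)).
rewrite -card_porbits_phi.
have -> : #|porbits phi| = 0%N; last by lia.
by apply: eq_card0 => X; apply/negP => /imsetP[d _ _]; case: (no (vx d)).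
Qed.

End AugMap.

(** * Strands and heights *)

Section Hitting.
Variables (T : finType) (f : T -> T) (P : pred T).

Definition hitting (h : T) : option T :=
  let m := find (fun j => P (iter j.+1 f h)) (iota 0 #|T|) in
  let h' := iter m.+1 f h in if P h' then Some h' else None.

Variant hitting_spec h : option T -> Prop :=
  | Hit m of P (iter m.+1 f h) & (forall j, (j < m)%N -> ~~ P (iter j.+1 f h)) :
      hitting_spec h (Some (iter m.+1 f h))
  | NoHit of (forall j, ~~ P (iter j.+1 f h)) : hitting_spec h None.

Hypothesis f_inj : injective f.

(** Since [f] is injective, the orbit of [h] is a cycle through [h]; a hit later than one period has
    an earlier copy, so the search over [#|T|] steps misses nothing. *)
Lemma hittingP h : hitting_spec h (hitting h).
Proof.
pose a j := P (iter j.+1 f h).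
have small m : a m -> (forall j, (j < m)%N -> ~~ a j) -> (m < #|T|)%N.
  move=> am mm; rewrite ltnNge; apply/negP=> le.
  have om : (fingraph.order f h <= m)%N by apply: leq_trans le; apply: max_card.
  have := mm (m - fingraph.order f h)%N; rewrite /a.
  have -> : (m - fingraph.order f h < m)%N by have := fingraph.order_gt0 f h; lia.
  move/(_ isT)/negP; apply; move: am; rewrite /a -{1}(subnK om) -addSn iterD.
  by rewrite fingraph.iter_order.
rewrite /hitting -/a; case: ifP => [Ph|/negbT nPh].
  apply: Hit => // j jm.
  case: (boolP (has a (iota 0 #|T|))) => [ha|nha].
    move: ha; rewrite has_find size_iota => fl.
    have := before_find 0%N jm; rewrite nth_iota ?add0n; last exact: ltn_trans jm fl.
    by rewrite /a => ->.
  apply/negP=> aj.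
  have ex : exists j, a j by exists j.
  case: (ex_minnP ex) => m am mm; case/negP: nha; apply/hasP; exists m => //.
  rewrite mem_iota add0n /=; apply: (small _ am) => i im.
  by apply/negP=> ai; have := mm _ ai; rewrite leqNgt im.
apply: NoHit => j; apply/negP=> aj.
have ex : exists j, a j by exists j.
case: (ex_minnP ex) => m am mm; case/negP: nPh.
have mT : (m < #|T|)%N.
  by apply: (small _ am) => i im; apply/negP=> ai; have := mm _ ai; rewrite leqNgt im.
have ha : has a (iota 0 #|T|) by apply/hasP; exists m; rewrite ?mem_iota.
have := nth_find 0%N ha; move: ha; rewrite has_find size_iota => fl.
by rewrite nth_iota // add0n.
Qed.

Lemma hitting_step h : hitting h = if P (f h) then Some (f h) else hitting (f h).
Proof.
case: (hittingP h) => [m Pm mm|no].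
  case: m Pm mm => [|m] Pm mm; first by rewrite /= in Pm; rewrite /= Pm.
  rewrite (negbTE (mm 0%N _)) //.
  case: (hittingP (f h)) => [m' Pm' mm'|no]; last by have := no m; rewrite -iterSr Pm.
  have [lt|gt|-> //] := ltngtP m m'; last by rewrite iterSr.
    by have := mm' _ lt; rewrite -iterSr Pm.
  by have := mm m'.+1; rewrite ltnS => /(_ gt); rewrite iterSr Pm'.
rewrite (negbTE (no 0%N)); case: (hittingP (f h)) => // m' Pm' _.
by have := no m'.+1; rewrite iterSr Pm'.
Qed.
End Hitting.

Section Labels.
Variables (n : nat) (G : pgraph n).
Hypothesis hG : disk_graph G.

Lemma strandT_inj : injective (@strandT n G).
Proof.
move=> [e b] [e' b']; rewrite /strandT; case: b; case: b' => //= -[].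
  by move/perm_inj->.
by move/perm_inj->.
Qed.

Lemma strandEndE (h : Defs.half G) : strandEnd h =
  obind (fun h' : Defs.half G => [pick i | bnd G i == eb G h'.1]) (hitting (@strandT n G) (@bndHalf n G) h).
Proof. by rewrite /strandEnd /hitting; case: ifP. Qed.

Lemma strandEnd_white (e : gE G) : strandEnd (e, true) = strandEnd (rotW G e, false).
Proof. by rewrite !strandEndE (hitting_step _ strandT_inj). Qed.

Lemma strandEnd_black (e : gE G) : ~~ isBndB (eb G e) ->
  strandEnd (rotB G e, false) = strandEnd (e, true).
Proof.
move=> ne; rewrite !strandEndE [LHS](congr1 _ (hitting_step _ strandT_inj _)).
by rewrite /strandT /= permK /bndHalf /= (negbTE ne).
Qed.

Lemma rotB_bedge i : rotB G (bedge hG i) = bedge hG i.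
Proof.
by apply: bedge_uniq; rewrite (proj1 (proj2 hG)) eb_bedge.
Qed.

Lemma strandEnd_bedge i : strandEnd (bedge hG i, false) = Some i.
Proof.
rewrite strandEndE (hitting_step _ strandT_inj) /strandT /=.
have -> : ((rotB G)^-1)%g (bedge hG i) = bedge hG i.
  by apply: (@perm_inj _ (rotB G)); rewrite permKV rotB_bedge.
rewrite /bndHalf /= eb_bedge /isBndB codom_f /=.
case: pickP => [j /eqP|/(_ i)]; last by rewrite eb_bedge eqxx.
by rewrite eb_bedge => /(proj1 hG) ->.
Qed.

(** Closed strands are not excluded a priori; they receive the default [x0]. Any default gives a
    consistent labelling, and this freedom is used later to show that closed strands do not
    occur. *)
Definition lab (x0 : 'I_n) (h : Defs.half G) : 'I_n := odflt x0 (strandEnd h).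

End Labels.

Section Labelling.
Variables (n : nat) (G : pgraph n).
Hypothesis hG : disk_graph G.
Variables (sig : 'I_n -> 'I_n) (p q : gE G -> 'I_n).

(** [p e] labels the strand running along [e] from white to black, [q e] the one from black to
    white, and [sig] sends the start of a strand to its end. The fields are all that is used about
    strands: turning at a vertex makes the labels [q] around it a rotation of the labels [p]. *)
Record labelling : Prop := Labelling {
  sig_inj : injective sig;
  q_white : forall e, q e = p (rotW G e);
  q_black : forall e, ~~ isBndB (eb G e) -> q e = p (rotB G e);
  p_bedge : forall i, p (bedge hG i) = i;
  q_bedge : forall i, q (bedge hG i) = sig i }.

Hypothesis hL : labelling.

Lemma phi_true e : phi hG (inl (e, true)) = inl (rotW G e, false).
Proof. by rewrite phiE. Qed.
Lemma phi_false e : ~~ isBndB (eb G e) -> phi hG (inl (e, false)) = inl (rotB G e, true).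
Proof. by move=> ne; rewrite phiE -[RHS]asigma_int. Qed.
Lemma phi_bedge i : phi hG (inl (bedge hG i, false)) = inr (i, false).
Proof. by rewrite phiE -[RHS](asigma_bnd hG (eb_bedge hG i)). Qed.
Lemma phi_outer i : phi hG (inr (i, true)) = inr (ordS i, true).
Proof. by rewrite phiE. Qed.
Lemma phi_inner i : phi hG (inr (i, false)) = inl (bedge hG (ord_pred i), true).
Proof. by rewrite phiE -[RHS](asigma_arc hG). Qed.

Lemma bedgeP e : isBndB (eb G e) -> exists i, e = bedge hG i.
Proof. by case/isBndBP=> i ei; exists i; apply: bedge_uniq. Qed.

Lemma ordS_cases (i : 'I_n) : (ordS i = i.+1 :> nat /\ (i.+1 < n)%N) \/ (ordS i = 0 :> nat /\ i.+1 = n)%N.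
Proof.
have := ltn_ord i; rewrite leq_eqVlt => /orP[/eqP E|lt].
  by right; rewrite /= E modnn.
by left; rewrite /= modn_small.
Qed.

(** A primitive of [dheight] along [phi], which shows that [dheight] is closed around every face. On
    the outer face it is the partial sum of the boundary increments. *)
Definition corner (x : 'I_n) (d : adart G) : rat :=
  match d with
  | inl (e, true) => (p e == x)%:R
  | inl (e, false) => - (p e == x)%:R
  | inr (i, false) => (sig i == x)%:R
  | inr (i, true) => (\sum_(j < n | (j <= i)%N) (sig j == x)%:R) - (x < i)%N%:R
  end.

Definition dheight (x : 'I_n) (d : adart G) : int :=
  match d with
  | inl (e, true) => - ((p e == x)%:R + (q e == x)%:R)
  | inl (e, false) => (p e == x)%:R + (q e == x)%:R
  | inr (i, true) => (sig (ordS i) == x)%:R - (i == x)%:R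
  | inr (i, false) => (ord_pred i == x)%:R - (sig i == x)%:R
  end.

Lemma dheight_corner x d : (dheight x d)%:~R = corner x (phi hG d) - corner x d.
Proof.
case: d => [[e []]|[i []]].
- rewrite phi_true /= -(q_white hL) rmorphN rmorphD /= !rmorph_nat; ring.
- have [be|ne] := boolP (isBndB (eb G e)).
    have [i ->] := bedgeP be.
    rewrite phi_bedge /= (p_bedge hL) (q_bedge hL) rmorphD /= !rmorph_nat; ring.
  rewrite (phi_false ne) /= -(q_black hL ne) rmorphD /= !rmorph_nat; ring.
- rewrite phi_outer /corner /dheight rmorphB !rmorph_nat.
  have [[iS lt]|[i0 iE]] := ordS_cases i.
    rewrite iS (bigD1 (ordS i)); last by rewrite iS.
    rewrite (eq_bigl (fun j : 'I_n => (j <= i)%N)); last first.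
      move=> j; have -> : (j == ordS i) = (j == i.+1 :> nat); first by rewrite -iS.
      by lia.
    rewrite /=; have -> : (x < i.+1)%N%:R = (i == x)%:R + (x < i)%N%:R :> rat.
      by rewrite -natrD; congr (_%:R); rewrite -val_eqE /=; lia.
    by ring.
  rewrite i0 (big_pred1 (ordS i)); last first.
    move=> j; rewrite [RHS](_ : _ = (j == 0%N :> nat)); last by rewrite -i0.
    by lia.
  (* After a full turn the partial sum runs over all boundary vertices, and bijectivity of [sig]
     makes it equal to one; this closes the cochain around the outer face. *)
  have [g gK] : bijective sig by apply: injF_bij (sig_inj hL).
  move=> Kg; rewrite (bigD1 (g x)) /=; last by have := ltn_ord (g x); lia.
  rewrite Kg eqxx big1; last first.
    move=> j /andP[_ jx]; case: eqP => // jE; case/eqP: jx.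
    by rewrite -jE gK.
  rewrite addr0 /= subr0; have -> : (x < i)%N = ~~ (i == x).
    by rewrite -val_eqE /=; have := ltn_ord x; lia.
  by case: (i == x) => /=; ring.
- by rewrite phi_inner /= (p_bedge hL) rmorphB /= !rmorph_nat.
Qed.

Lemma dheight_anti x d : dheight x d + dheight x (al G d) = 0.
Proof.
rewrite alE; case: d => [[e []]|[i []]] /=; rewrite ?ordSK ?ord_predK; ring.
Qed.

(* The winding of the x-th strand around the vertices; the function exists because the disk has no first cohomology. *)
Lemma height_exists x : exists h : gB G + gW G -> int,
  (forall e, h (inl (eb G e)) - h (inr (ew G e)) = (p e == x)%:R + (q e == x)%:R) /\
  (forall i, h (inl (bnd G (ordS i))) - h (inl (bnd G i)) = (sig (ordS i) == x)%:R - (i == x)%:R).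
Proof.
have [u wu] := planar_exact (hG := hG) (w := fun d => (dheight x d)%:~R : rat)
  (fun d => etrans (esym (rmorphD _ _ _)) (congr1 _ (dheight_anti x d)))
  (fun d => etrans (eq_bigr _ (fun d _ => dheight_corner x d)) (sum_porbit_telescope _ _ _)).
(* Exactness needs a field, so the potential is rational at first. Its differences are integers,
   hence taking floors preserves them. *)
have key d : Num.floor (u (vx (al G d))) - Num.floor (u (vx d)) = dheight x d.
  have -> : u (vx (al G d)) = (dheight x d)%:~R + u (vx d) by rewrite wu subrK.
  by rewrite floorDzr ?intrKfloor ?addrK ?intr_int.
exists (fun v => Num.floor (u v)); split=> [e|i].
  by have := key (inl (e, false)); rewrite alE.
by have := key (inr (i, true)); rewrite alE.
Qed.
End Labelling.

(** * Counting crossings *)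

Lemma sum_antisym (T : finType) (F : T -> T -> int) :
  (forall u v, F u v + F v u = 0) -> \sum_u \sum_v F u v = 0.
Proof.
move=> H; have : \sum_u \sum_v F u v + \sum_u \sum_v F u v = 0; last by lia.
rewrite {2}exchange_big -big_split big1 //= => u _.
by rewrite -big_split big1 //= => v _.
Qed.

Lemma sum_Posz (T : finType) (P : pred T) (F : T -> nat) :
  \sum_(x | P x) (F x)%:Z = (\sum_(x | P x) F x)%N%:Z.
Proof. by rewrite -[RHS]natz natr_sum; apply: eq_bigr => x _; rewrite natz. Qed.

Section PermCount.
Variables (n : nat) (sig : 'I_n -> 'I_n) (sinv : 'I_n -> 'I_n).
Hypotheses (sigK : cancel sig sinv) (sinvK : cancel sinv sig).
Implicit Types a b x y : 'I_n.

Definition wexc a : nat := (sig a <= a)%N.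
(** The lift of [sig] that moves every point strictly up by at most [n], that is, [f] with both
    argument and value shifted by one. *)
Definition alift a : nat := (sig a + n * wexc a)%N.
(** The length of [f]. In an inversion [(s, t)] the index [t] lies in the window of [s] or in the
    next one, because [f] moves no point by more than [n]; the two terms are these two cases. *)
Definition lift_length : int :=
  \sum_(a < n) \sum_(b < n) ((((a < b) && (alift b < alift a))%N + (alift b + n < alift a)%N)%N)%:Z.

Let sig_neq a b : a != b -> sig a != sig b :> nat.
Proof. by apply: contra => /eqP/val_inj/(can_inj sigK)->. Qed.

Lemma sum_ltn_ord (v : nat) : (v <= n)%N -> \sum_(y < n) ((y < v)%N : nat)%:Z = v%:Z.
Proof.
move=> vn; rewrite -(big_mkord predT (fun i : nat => ((i < v)%N : nat)%:Z)).
rewrite (@big_cat_nat _ _ _ v) //= [X in _ + X]big_nat [X in _ + X]big1 ?addr0; last first.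
  by move=> i /andP[vi _]; rewrite ltnNge vi.
rewrite big_nat (eq_bigr (fun=> 1)); last by move=> i /andP[_ ->].
by rewrite -big_nat sumr_const_nat subn0 natz.
Qed.

Lemma sum_ltn_sig (v : nat) : (v <= n)%N -> \sum_(a < n) ((sig a < v)%N : nat)%:Z = v%:Z.
Proof.
move=> vn; rewrite -[RHS](sum_ltn_ord vn) [RHS](reindex sig) //.
by exists sinv => ? _.
Qed.

Lemma sum_geq_ord (v : nat) : (v <= n)%N -> \sum_(y < n) ((v <= y)%N : nat)%:Z = n%:Z - v%:Z.
Proof.
move=> vn; rewrite -(sum_ltn_ord vn) -(sum_ltn_ord (leqnn n)).
rewrite -sumrB; apply: eq_bigr => y _; have := ltn_ord y; lia.
Qed.

Lemma sig_displacement a :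
  \sum_(b < n) ((((a < b) && (sig b < sig a))%N : nat)%:Z - (((b < a) && (sig a < sig b))%N : nat)%:Z)
   = (sig a)%:Z - a%:Z.
Proof.
rewrite -(sum_ltn_sig (ltnW (ltn_ord (sig a)))) -(sum_ltn_ord (ltnW (ltn_ord a))).
rewrite -sumrB; apply: eq_bigr => b _.
have [->|ab] := eqVneq a b; first by lia.
have := sig_neq ab; move: ab; rewrite -val_eqE /=; lia.
Qed.

Let Z := \sum_(a < n) \sum_(b < n) (([&& a < sig a, sig b <= b, a < b & sig b < sig a]%N : nat)%:Z).

(** Write each displacement as a signed count of inversions. If [b < a < sig a < sig b], then [b] is
    an exceedance too, so the inversions between two exceedances cancel and those between an
    exceedance and a weak anti-exceedance remain. *)
Lemma sum_exceedance : \sum_(a < n | (a < sig a)%N) ((sig a)%:Z - a%:Z) = Z.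
Proof.
have swap : \sum_(a < n | (a < sig a)%N) \sum_(b < n | (b < sig b)%N) (((a < b) && (sig b < sig a))%N : nat)%:Z =
   \sum_(a < n | (a < sig a)%N) \sum_(b < n) (((b < a) && (sig a < sig b))%N : nat)%:Z.
  rewrite exchange_big /=; apply: eq_bigr => a aa; rewrite big_mkcond /=.
  by apply: eq_bigr => b _; case: ifP => //; lia.
rewrite (eq_bigr _ (fun a _ => esym (sig_displacement a))).
rewrite (eq_bigr _ (fun a _ => sumrB _ _ _ _)) sumrB -swap -sumrB /Z big_mkcond /=.
apply: eq_bigr => a _; case: ifP => aa; last by rewrite big1 // => b _; rewrite aa.
rewrite [in X in _ - X]big_mkcond /= -sumrB; apply: eq_bigr => b _.
by case: ifP => //; lia.
Qed.

Lemma sum_sig (F : nat -> int) : \sum_(a < n) F (sig a) = \sum_(y < n) F y.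
Proof. by rewrite [RHS](reindex sig) //; exists sinv => ? _. Qed.

Lemma sum_abs_displacement : \sum_(a < n) `|(sig a)%:Z - a%:Z| = Z *+ 2.
Proof.
have z : \sum_(a < n) ((sig a)%:Z - a%:Z) = 0 by rewrite sumrB (sum_sig (fun y : nat => y%:Z)) subrr.
have -> : \sum_(a < n) `|(sig a)%:Z - a%:Z| = \sum_(a < n) ((if (a < sig a)%N then ((sig a)%:Z - a%:Z) else 0) *+ 2 - ((sig a)%:Z - a%:Z)).
  by apply: eq_bigr => a _; case: ifP; lia.
by rewrite sumrB z subr0 sumrMnl -big_mkcond sum_exceedance.
Qed.

Let k := (\sum_(a < n) wexc a)%N.

(** All terms are sums over ordered pairs, and the summand of the difference is antisymmetric in the
    pair; this is checked on the relative orders of [a], [b], [sig a], [sig b]. *)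
Lemma lift_length_inversions :
  k%:Z * (n%:Z - k%:Z) - lift_length + \sum_(a < n) \sum_(b < n) (((a < b) && (sig b < sig a))%N : nat)%:Z = Z *+ 2.
Proof.
have -> : k%:Z * (n%:Z - k%:Z) = \sum_(a < n) \sum_(b < n) ((wexc a)%:Z * (1 - (wexc b)%:Z)).
  have kE : k%:Z = \sum_(a < n) (wexc a)%:Z by rewrite /k -[LHS]natz natr_sum; apply: eq_bigr => a _; rewrite natz.
  have -> : n%:Z - k%:Z = \sum_(a < n) (1 - (wexc a)%:Z).
    by rewrite sumrB -kE sumr_const card_ord natz.
  by rewrite kE mulr_suml; apply: eq_bigr => a _; rewrite mulr_sumr.
apply/eqP; rewrite -subr_eq0 /Z -!sumrMnl /lift_length -!sumrB -big_split -sumrB /=; apply/eqP.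
rewrite (eq_bigr (fun a => \sum_(b < n) ((wexc a)%:Z * (1 - (wexc b)%:Z)
   - (((((a < b) && (alift b < alift a))%N + (alift b + n < alift a)%N)%N)%:Z)
   + (((a < b) && (sig b < sig a))%N : nat)%:Z -
   (([&& a < sig a, sig b <= b, a < b & sig b < sig a]%N : nat)%:Z) *+ 2))); last first.
  by move=> a _; rewrite !sumrB big_split sumrB /= sumrMnl.
apply: sum_antisym => a b.
have [->|ab] := eqVneq a b; first by rewrite /alift /wexc; case: leqP; lia.
have := sig_neq ab; move: ab; rewrite -val_eqE /= /alift /wexc.
have := ltn_ord a; have := ltn_ord b; have := ltn_ord (sig a); have := ltn_ord (sig b).
move: (nat_of_ord a) (nat_of_ord b) (nat_of_ord (sig a)) (nat_of_ord (sig b)).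
clear; move=> a b sa sb h1 h2 h3 h4.
by case: (leqP sa a); case: (leqP sb b); case: (ltngtP a b); case: (ltngtP sa sb); lia.
Qed.

(* The left side is the total signed crossing number of the strand diagram. *)
Lemma crossing_count :
  \sum_(x < n) \sum_(y < n | (y < x)%N) (((sinv y <= sinv x)%N : nat)%:Z - ((y < sinv x)%N : nat)%:Z
     - ((sinv y <= x)%N : nat)%:Z + 1)
  = k%:Z * (n%:Z - k%:Z) - lift_length - \sum_(a < n) ((sig a < a)%N : nat)%:Z.
Proof.
pose inv := \sum_(a < n) \sum_(b < n) (((a < b) && (sig b < sig a))%N : nat)%:Z.
have -> : k%:Z * (n%:Z - k%:Z) - lift_length = Z *+ 2 - inv.
  by rewrite -lift_length_inversions addrK.
rewrite -sum_abs_displacement.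
rewrite (reindex_inj (can_inj sigK)) /=.
pose t a b := ((sig a < sig b)%N : nat)%:Z.
have -> : \sum_(b < n) \sum_(y < n | (y < sig b)%N) (((sinv y <= sinv (sig b))%N : nat)%:Z - ((y < sinv (sig b))%N : nat)%:Z
     - ((sinv y <= sig b)%N : nat)%:Z + 1) =
   \sum_(b < n) \sum_(a < n) (t a b *+ 2) - \sum_(b < n) \sum_(a < n) (((b < a) && (sig a < sig b))%N : nat)%:Z
   - \sum_(b < n) \sum_(a < n) (((sig a < sig b) && (sig a < b))%N : nat)%:Z
   - \sum_(b < n) \sum_(a < n) (((sig a < sig b) && (a <= sig b))%N : nat)%:Z.
  rewrite -!sumrB; apply: eq_bigr => b _; rewrite (reindex_inj (can_inj sigK)) big_mkcond /= -!sumrB.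
  apply: eq_bigr => a _; rewrite !sigK /t; case: ifP; last by lia.
  have [->|ab] := eqVneq a b; first by lia.
  by move: ab; rewrite -val_eqE /=; lia.
have -> : \sum_(b < n) \sum_(a < n) (((b < a) && (sig a < sig b))%N : nat)%:Z = inv by [].
have -> : \sum_(b < n) \sum_(a < n) (((sig a < sig b) && (sig a < b))%N : nat)%:Z = \sum_(b < n) (minn (sig b) b)%:Z.
  apply: eq_bigr => b _; rewrite -(sum_ltn_sig (v := minn (sig b) b)).
    by apply: eq_bigr => a _; rewrite ltn_min.
  by rewrite geq_min; have := ltn_ord b; lia.
have -> : \sum_(b < n) \sum_(a < n) (((sig a < sig b) && (a <= sig b))%N : nat)%:Z = \sum_(a < n) (n%:Z - (maxn (sig a).+1 a)%:Z).
  rewrite exchange_big; apply: eq_bigr => a _.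
  rewrite -(sum_geq_ord (v := maxn (sig a).+1 a)); last first.
    by rewrite geq_max; have := ltn_ord a; have := ltn_ord (sig a); lia.
  rewrite -(sum_sig (fun y : nat => ((maxn (sig a).+1 a <= y)%N : nat)%:Z)).
  by apply: eq_bigr => b _; rewrite geq_max.
have -> : \sum_(b < n) \sum_(a < n) (t a b *+ 2) = \sum_(a < n) (n%:Z - 1).
  rewrite (eq_bigr (fun b => (sig b)%:Z *+ 2)); last first.
    by move=> b _; rewrite sumrMnl /t sum_ltn_sig // ltnW.
  rewrite (sum_sig (fun y : nat => y%:Z *+ 2)) sumrMnl mulr2n {2}(reindex_inj rev_ord_inj) /= -big_split.
  by apply: eq_bigr => i _ /=; have := ltn_ord i; lia.
rewrite [X in X - _ = _]addrAC [LHS]addrAC [RHS]addrAC; congr (_ - _).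
rewrite -!sumrB; apply: eq_bigr => a _.
by case: (ltngtP (sig a) a) => h; rewrite ?minnE ?maxnE; lia.
Qed.
End PermCount.

Section Crossings.
Variables (n : nat) (G : pgraph n).
Hypothesis hG : disk_graph G.
Variables (sig sinv : 'I_n -> 'I_n) (p q : gE G -> 'I_n).
Hypothesis hL : labelling hG sig p q.
Hypotheses (sigK : cancel sig sinv) (sinvK : cancel sinv sig).
Variable h : 'I_n -> gB G + gW G -> int.
Hypothesis hE : forall x e,
  h x (inl (eb G e)) - h x (inr (ew G e)) = (p e == x)%:R + (q e == x)%:R.
Hypothesis hA : forall x i,
  h x (inl (bnd G (ordS i))) - h x (inl (bnd G i)) = (sig (ordS i) == x)%:R - (i == x)%:R.

Lemma sum_white (F : 'I_n -> int) (g : gW G -> int) :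
  \sum_e F (q e) * g (ew G e) = \sum_e F (p e) * g (ew G e).
Proof.
rewrite [RHS](reindex_inj (@perm_inj _ (rotW G))) /=; apply: eq_bigr => e _.
have [_ [_ [_ [-> _]]]] := hG.
by rewrite (q_white hL).
Qed.

Lemma sum_bnd (F : gE G -> int) :
  \sum_(e | isBndB (eb G e)) F e = \sum_i F (bedge hG i).
Proof.
have -> : \sum_i F (bedge hG i) = \sum_(e in [set bedge hG i | i : 'I_n]) F e.
  by rewrite big_imset //= => i j _ _; apply: bedge_inj.
apply: eq_bigl => e; apply/idP/imsetP => [/(bedgeP hG)[i ->]|[i _ ->]]; first by exists i.
by rewrite eb_bedge /isBndB codom_f.
Qed.

(** Summation by parts at the black vertices: the rotation turns [q] into [p] at interior vertices,
    so only the ends of the strands are left. *)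
Lemma sum_black (F : 'I_n -> int) (g : gB G -> int) :
  \sum_e F (q e) * g (eb G e) - \sum_e F (p e) * g (eb G e) =
  \sum_i (F (sig i) - F i) * g (bnd G i).
Proof.
have split_bnd (H : gE G -> int) : \sum_e H e = \sum_i H (bedge hG i) + \sum_(e | ~~ isBndB (eb G e)) H e.
  by rewrite (bigID (fun e => isBndB (eb G e))) sum_bnd.
have int : \sum_(e | ~~ isBndB (eb G e)) F (q e) * g (eb G e) =
   \sum_(e | ~~ isBndB (eb G e)) F (p e) * g (eb G e).
  have ebB : forall e, eb G (rotB G e) = eb G e by case: (hG) => _ [].
  rewrite [RHS](reindex_inj (@perm_inj _ (rotB G))) /=; apply: eq_big => e.
    by rewrite ebB.
  by move=> ne; rewrite ebB (q_black hL).
rewrite !split_bnd int opprD addrACA subrr addr0 -sumrB; apply: eq_bigr => i _.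
by rewrite (p_bedge hL) (q_bedge hL) eb_bedge mulrBl.
Qed.

Lemma height_bnd y (i0 : 'I_n) : i0 = 0%N :> nat -> forall i : 'I_n,
  h y (inl (bnd G i)) = h y (inl (bnd G i0)) - (sig i0 == y)%:R
     + ((sinv y <= i)%N : nat)%:Z - ((y < i)%N : nat)%:Z.
Proof.
move=> i00; apply: (ordS_ind (i0 := i0)).
  rewrite i00 ltn0 subr0 leqn0.
  have -> : (sinv y == 0%N :> nat) = (sig i0 == y).
    apply/eqP/eqP => [s0|<-]; last by rewrite sigK.
    by rewrite -(sinvK y); congr sig; apply: val_inj; rewrite /= s0 i00.
  by rewrite natz subrK.
move=> i IH; have := hA y i; move/eqP; rewrite subr_eq => /eqP ->; rewrite {}IH.
have E : (sig (ordS i) == y) = (sinv y == ordS i) by apply/eqP/eqP=> [<-|<-]; rewrite ?sigK ?sinvK.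
rewrite E -!val_eqE /= -/(nat_of_ord (ordS i)) !natz.
have [[iS lt]|[iS iE]] := ordS_cases i.
  rewrite /= in iS; rewrite iS; move: (h y _) (sig i0 == y) => A B; lia.
rewrite /= in iS; rewrite iS.
have := ltn_ord y; have := ltn_ord (sinv y).
move: (h y _) (sig i0 == y) => A B; lia.
Qed.

(** Along the strand [x] the height of [y] changes exactly at the crossings with [y], by their
    signs. The signed crossings of [x] with [y] therefore telescope to the difference of the height
    of [y] between the start and the end of [x], which is known from the boundary values. *)
Lemma signed_crossings (i0 : 'I_n) : i0 = 0%N :> nat ->
  \sum_e (((p e < q e)%N : nat)%:Z - ((q e < p e)%N : nat)%:Z) =
  (\sum_a wexc sig a)%N%:Z * (n%:Z - (\sum_a wexc sig a)%N%:Z) - lift_length sig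
   - \sum_(a < n) ((sig a < a)%N : nat)%:Z.
Proof.
move=> i00; rewrite -(crossing_count sigK sinvK).
have pair x y : y != x ->
   \sum_e ((q e == x)%:R * (p e == y)%:R - (p e == x)%:R * (q e == y)%:R) =
   ((sinv y <= sinv x)%N : nat)%:Z - ((y < sinv x)%N : nat)%:Z
     - ((sinv y <= x)%N : nat)%:Z + ((y < x)%N : nat)%:Z.
  move=> yx; have := sum_black (fun z => (z == x)%:R) (fun b => h y (inl b)).
  have := sum_white (fun z => (z == x)%:R) (fun b => h y (inr b)).
  move=> hw hb.
  have -> : \sum_e ((q e == x)%:R * (p e == y)%:R - (p e == x)%:R * (q e == y)%:R) =
     \sum_i ((sig i == x)%:R - (i == x)%:R) * h y (inl (bnd G i)).
    rewrite -hb; transitivity (\sum_e ((q e == x)%:R * h y (inl (eb G e)) - (p e == x)%:R * h y (inl (eb G e))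
       - ((q e == x)%:R * h y (inr (ew G e)) - (p e == x)%:R * h y (inr (ew G e))))); last first.
      by rewrite !sumrB hw subrr subr0.
    apply: eq_bigr => e _; have := hE y e.
    move: (h y (inl _)) (h y (inr _)) => A B; move/eqP; rewrite subr_eq => /eqP ->.
    by case: (q e =P x) => [->|_]; case: (p e =P x) => [->|_];
      rewrite /= ?[x == y]eq_sym ?(negbTE yx) ?mulr0n ?mulr1n; ring.
  rewrite (eq_bigr (fun i => (sig i == x)%:R * h y (inl (bnd G i)) - (i == x)%:R * h y (inl (bnd G i)))); last first.
    by move=> i _; rewrite mulrBl.
  rewrite sumrB (bigD1 (sinv x)) //= sinvK eqxx mul1r big1 ?addr0; last first.
    by move=> i ix; case: eqP => [sx|]; [case/eqP: ix; rewrite -sx sigK|rewrite mul0r].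
  rewrite (bigD1 x) //= eqxx mul1r big1 ?addr0; last by move=> i /negbTE->; rewrite mul0r.
  rewrite (height_bnd y i00 x) (height_bnd y i00 (sinv x)).
  move: (h y _) (sig i0 == y) => A B; lia.
transitivity (\sum_(x < n) \sum_(y < n | (y < x)%N) \sum_e ((q e == x)%:R * (p e == y)%:R - (p e == x)%:R * (q e == y)%:R) : int).
  rewrite (eq_bigr (fun x : 'I_n => \sum_e \sum_(y < n | (y < x)%N) ((q e == x)%:R * (p e == y)%:R - (p e == x)%:R * (q e == y)%:R))); last first.
    by move=> x _; rewrite exchange_big.
  rewrite exchange_big; apply: eq_bigr => e _ /=.
  have E (u v : 'I_n) : \sum_(x < n) \sum_(y < n | (y < x)%N) ((u == x)%:R * (v == y)%:R) = ((v < u)%N : nat)%:Z.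
    rewrite (bigD1 u) //= [X in _ + X]big1 ?addr0; last first.
      by move=> x /negbTE xu; rewrite eq_sym xu big1 // => y _; rewrite mul0r.
    rewrite eqxx big_mkcond (bigD1 v) //= big1 ?addr0; last first.
      by move=> y /negbTE vy; rewrite [v == y]eq_sym vy mulr0 if_same.
    by rewrite eqxx mul1r; case: ifP.
  by rewrite (eq_bigr _ (fun x _ => sumrB _ _ _ _)) sumrB !E.
apply: eq_bigr => x _; apply: eq_bigr => y yx; rewrite pair ?yx //.
by rewrite neq_ltn yx.
Qed.

End Crossings.

(** * Bounded affine permutations through their residues *)

Section AffinePerm.
Variables (k n : nat) (f : int -> int) (sig : 'I_n -> 'I_n).
Hypotheses (hf : bounded_affine_perm k n f).
Hypothesis fE : forall i : 'I_n, f (i.+1)%:Z = (alift sig i).+1%:Z.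

Lemma f_inj : injective f. Proof. by case: hf => /bij_inj. Qed.

Lemma f_shift (j m : int) : f (j + m * n%:Z) = f j + m * n%:Z.
Proof.
case: hf => _ sh _ _.
have pos (j' : int) (m' : nat) : f (j' + m'%:Z * n%:Z) = f j' + m'%:Z * n%:Z.
  elim: m' => [|m' IH]; first by rewrite mul0r !addr0.
  have -> : j' + m'.+1%:Z * n%:Z = (j' + m'%:Z * n%:Z) + n%:Z by lia.
  rewrite sh IH; lia.
case: (intP m) => [|m'|m']; first by rewrite mul0r !addr0.
  exact: pos.
have := pos (j + - (m'.+1)%:Z * n%:Z) m'.+1; rewrite mulNr subrK => ->.
lia.
Qed.

Lemma sig_injective : injective sig.
Proof.
move=> i j ij; have := ltn_ord i; have := ltn_ord j.
have inj a b (m : int) : f (a.+1)%:Z = f (b.+1)%:Z + m * n%:Z -> (a.+1)%:Z = (b.+1)%:Z + m * n%:Z.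
  by rewrite -f_shift => /f_inj.
have E : f (i.+1)%:Z = f (j.+1)%:Z + ((wexc sig i)%:Z - (wexc sig j)%:Z) * n%:Z.
  rewrite !fE /alift ij; lia.
move/inj: E => E li lj; apply: val_inj => /=; move: E li lj; rewrite /wexc.
move: (nat_of_ord i) (nat_of_ord j) => a b.
by case: leqP; case: leqP => /=; nia.
Qed.

Let sinv := invF sig_injective.
Let sigK : cancel sig sinv. Proof. exact: invF_f. Qed.
Let sinvK : cancel sinv sig. Proof. exact: f_invF. Qed.

Lemma fbar0E (i : 'I_n) : fbar0 f i = sig i.
Proof.
rewrite /fbar0 fE /alift.
have -> : (sig i + n * wexc sig i).+1%:Z - 1 = (wexc sig i)%:Z * n%:Z + (sig i)%:Z by lia.
by rewrite modzMDl modz_small //=; have := ltn_ord (sig i); lia.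
Qed.

Lemma sum_wexc : (0 < n)%N -> (\sum_a wexc sig a)%N = k.
Proof.
move=> n0; case: hf => _ _ _.
rewrite (eq_bigr (fun j : 'I_n => ((sig j)%:Z - j%:Z) + (wexc sig j)%:Z * n%:Z)); last first.
  by move=> j _; rewrite fE /alift; lia.
rewrite big_split /= sumrB (sum_sig sigK sinvK (fun y => y%:Z)) subrr add0r -mulr_suml.
have -> : \sum_(i < n) (wexc sig i)%:Z = ((\sum_a wexc sig a)%N)%:Z.
  by rewrite -[RHS]natz natr_sum; apply: eq_bigr => a _; rewrite natz.
move=> E; have : ((\sum_a wexc sig a)%N * n = k * n)%N by lia.
by move/eqP; rewrite eqn_pmul2r // => /eqP.
Qed.

Lemma length_lift m : length_is n f m -> lift_length sig = m%:Z.
Proof.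
case=> l [ul <- lP].
have n0 (j : int) : 1 <= j <= n%:Z -> exists i : 'I_n, j = (i.+1)%:Z.
  case: j => // -[|j] // /andP[_ jn]; have jn' : (j < n)%N by lia.
  by exists (Ordinal jn').
pose T := ('I_n * 'I_n * bool)%type.
pose P (t : T) : bool := if t.2 then (alift sig t.1.2 + n < alift sig t.1.1)%N
  else (t.1.1 < t.1.2)%N && (alift sig t.1.2 < alift sig t.1.1)%N.
pose g (t : T) : int * int := ((t.1.1.+1)%:Z, (t.1.2.+1)%:Z + (nat_of_bool t.2)%:Z * n%:Z).
have g_inj : injective g.
  move=> [[a b] c] [[a' b'] c'] [] /= /val_inj -> E.
  have := ltn_ord b; have := ltn_ord b'; move: E.
  case: c; case: c' => /= E h1 h2; try lia; congr (_, _, _); apply: val_inj => /=; lia.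
have lift_ub (a : 'I_n) : (alift sig a <= a + n)%N.
  rewrite /alift /wexc; have := ltn_ord (sig a); case: leqP => /=; lia.
have lift_lb (a : 'I_n) : (a < alift sig a)%N.
  rewrite /alift /wexc; have := ltn_ord a; case: leqP => /=; lia.
have fg (a b : 'I_n) (c : int) : f ((b.+1)%:Z + c * n%:Z) < f (a.+1)%:Z = ((alift sig b)%:Z + c * n%:Z < (alift sig a)%:Z).
  rewrite f_shift !fE; lia.
have pe : perm_eq l (map g (enum P)).
  apply: uniq_perm => //; first by rewrite map_inj_uniq // enum_uniq.
  case=> s t; apply/idP/mapP => [/lP[/n0[a ->] st fst]|[[[a b] c]]].
    have [b [c tE]] : exists (b : 'I_n) (c : int), t = (b.+1)%:Z + c * n%:Z.
      have n0' : (0 < n)%N by apply: leq_ltn_trans (leq0n _) (ltn_ord a).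
      have h : ((t - 1) %% n%:Z)%Z = `|((t - 1) %% n%:Z)%Z|%N%:Z by rewrite gez0_abs // modz_ge0 //; lia.
      have lt : (`|((t - 1) %% n%:Z)%Z| < n)%N.
        by have := ltz_pmod (t - 1) (d := n%:Z); rewrite {1}h; lia.
      exists (Ordinal lt), ((t - 1) %/ n%:Z)%Z => /=.
      have := divz_eq (t - 1) n%:Z; rewrite {2}h; lia.
    rewrite tE in st fst *; rewrite fg in fst.
    have := lift_lb b; have := lift_ub a; have := ltn_ord a; have := ltn_ord b.
    move=> bn an ua lb.
    (* An inversion has [t < f t < f s], and [f s] is at most [s + n]; so [t] lies less than [n]
       above [s], and at most one window is crossed. *)
    have [c0|c1] : c = 0 \/ c = 1 by nia.
      exists (a, b, false); last by rewrite /g /= c0.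
      rewrite mem_enum unfold_in /=; move: st fst; rewrite c0; lia.
    exists (a, b, true); last by rewrite /g /= c1.
    rewrite mem_enum unfold_in /=; move: st fst; rewrite c1; lia.
  rewrite mem_enum unfold_in => Pt /= [-> ->]; apply/lP; have := ltn_ord a; have := ltn_ord b.
  rewrite fg; move: Pt; rewrite /P /=; case: c => /= Pt h1 h2; split; lia.
rewrite (perm_size pe) size_map -cardE -sum1_card.
rewrite -[RHS]natz natr_sum big_mkcond /= -(pair_bigA _ (fun ab c => if P (ab, c) then 1%:R else 0)) /=.
rewrite -(pair_bigA _ (fun a b => \sum_c if P (a, b, c) then 1%:R else 0)) /=.
apply: eq_bigr => a _; apply: eq_bigr => b _.
rewrite (bigD1 true) //= (bigD1 false) //= big1 ?addr0; last by case.
by rewrite /P /=; case: (_ + _ < _)%N; case: (_ && _).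
Qed.

Lemma JsetE (r s : 'I_n) :
  (sig s \in Jset f r) = (sig s != r) &&
     (if (s < sig s)%N then (s < r < sig s)%N else (s < r)%N || (r < sig s)%N).
Proof.
have n0 : (0 < n)%N by apply: leq_ltn_trans (leq0n _) (ltn_ord s).
have rn := ltn_ord r; have sn := ltn_ord s; have vn := ltn_ord (sig s).
rewrite inE andbC; have [//|/= xr] := eqVneq (sig s) r.
have xr' : nat_of_ord (sig s) <> r by move/val_inj => E; rewrite E eqxx in xr.
apply/asboolP/idP => [[p [/andP[pr rf] fp]]|].
  have [a [c pE]] : exists (a : 'I_n) (c : int), p = (a.+1)%:Z + c * n%:Z.
    have h : ((p - 1) %% n%:Z)%Z = `|((p - 1) %% n%:Z)%Z|%N%:Z by rewrite gez0_abs // modz_ge0 //; lia.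
    have lt : (`|((p - 1) %% n%:Z)%Z| < n)%N.
      by have := ltz_pmod (p - 1) (d := n%:Z); rewrite {1}h; lia.
    exists (Ordinal lt), ((p - 1) %/ n%:Z)%Z => /=.
    have := divz_eq (p - 1) n%:Z; rewrite {2}h; lia.
  have fpE : f p = (alift sig a)%:Z + 1 + c * n%:Z by rewrite pE f_shift fE; lia.
  have as_ : a = s.
    apply: sig_injective; apply: val_inj => /=.
    have E : ((sig a)%:Z = (sig s)%:Z %[mod n%:Z])%Z.
      move/eqP: fp; rewrite -(eqz_modDr (-1)) fpE /alift.
      have -> : (sig a + n * wexc sig a)%:Z + 1 + c * n%:Z + -1 = ((wexc sig a)%:Z + c) * n%:Z + (sig a)%:Z by lia.
      have -> : (sig s).+1%:Z + -1 = (sig s)%:Z by lia.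
      by rewrite modzMDl => /eqP.
    move: E; rewrite !modz_small; last 2 first.
    - by rewrite /= ltz_nat.
    - by rewrite /= ltz_nat ltn_ord.
    by case.
  subst a; move: pr rf; rewrite fpE pE /alift /wexc.
  (* Since [f p] is at most [p + n], the condition [p < r <= f p] leaves only the translates of [s]
     by [0] and by [-n]. *)
  have [c0|[c1|c1]] : c = 0 \/ (c = -1 \/ (c <= -2 \/ 1 <= c)) by lia.
  - rewrite c0; case: ifP; case: leqP => /=; lia.
  - rewrite c1; case: ifP; case: leqP => /=; lia.
  - case: leqP => /= _; nia.
move=> H; exists (if (s < r)%N then (s.+1)%:Z else (s.+1)%:Z + (-1) * n%:Z).
case: ifP => sr; rewrite ?f_shift fE /alift /wexc.
  move: H; rewrite sr /=; case: ifP; case: leqP => //= h1 h2 H; split; try lia.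
  - by rewrite muln0 addn0.
  - by rewrite muln1 -addSn PoszD modzDr.
move: H; rewrite sr /=; case: ifP; case: leqP => //= h1 h2 H; split; try lia.
by rewrite muln1 -addSn PoszD mulN1r addrK.
Qed.

Lemma eps_wexc (R : realType) (r : 'I_n) :
  eps f r = (-1) ^+ (\sum_(a < n | (a < r)%N) wexc sig a)%N :> R.
Proof.
rewrite /eps -sum1_card big_mkcond [in RHS]big_mkcond /=; congr (_ ^+ _).
apply: eq_bigr => a _; rewrite inE fbar0E /wexc.
by case: (sig a <= a)%N; case: (a < r)%N.
Qed.

End AffinePerm.

(** * Descents in a reduced graph *)

Section Reduced.
Variables (n : nat) (G : pgraph n).
Hypothesis hG : disk_graph G.
Variables (sig : 'I_n -> 'I_n) (p q : gE G -> 'I_n).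
Hypothesis hL : labelling hG sig p q.

Definition desc (e : gE G) : nat := (q e <= p e)%N.
(* The factor two lets an interior edge with two equal labels count for half a descent. *)
Definition ddesc (e : gE G) : nat :=
  if isBndB (eb G e) then (desc e).*2 else ((q e < p e) + (q e <= p e))%N.

Lemma ebB e : eb G (rotB G e) = eb G e. Proof. by case: hG => _ []. Qed.
Lemma ewW e : ew G (rotW G e) = ew G e. Proof. by case: hG => _ [_ [_ []]]. Qed.

Lemma star_black_sum (V : nmodType) (F : 'I_n -> V) b : ~~ isBndB b ->
  \sum_(e | eb G e == b) F (q e) = \sum_(e | eb G e == b) F (p e).
Proof.
move=> nb; rewrite [RHS](reindex_inj (@perm_inj _ (rotB G))) /=.
apply: eq_big => e; first by rewrite ebB.
by move/eqP=> eb_; rewrite (q_black hL) ?eb_.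
Qed.

Lemma star_white_sum (V : nmodType) (F : 'I_n -> V) w :
  \sum_(e | ew G e == w) F (q e) = \sum_(e | ew G e == w) F (p e).
Proof.
rewrite [RHS](reindex_inj (@perm_inj _ (rotW G))) /=.
apply: eq_big => e; first by rewrite ewW.
by move/eqP=> ew_; rewrite (q_white hL).
Qed.

(** When the labels balance, either some edge has [q < p], which is worth two, or [q = p]
    throughout, and then two edges or a single boundary edge suffice. If the total is exactly two,
    an interior edge with equal labels leaves room neither for a strict descent nor for a boundary
    edge, which is the second claim. *)
Lemma star_ddesc (S : {set gE G}) :
  \sum_(e in S) (q e)%:Z = \sum_(e in S) (p e)%:Z ->
  (exists2 e, e \in S & isBndB (eb G e)) \/ (2 <= #|S|)%N ->
  (2 <= \sum_(e in S) ddesc e)%N /\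
  (\sum_(e in S) ddesc e = 2%N ->
     forall e, e \in S -> ~~ isBndB (eb G e) -> q e = p e ->
       forall e', e' \in S -> ~~ isBndB (eb G e') /\ q e' = p e').
Proof.
move=> qp big; case: (pickP [pred e | (e \in S) && (q e < p e)%N]) => [e0 /andP[e0S lt0]|no].
  have c0 : ddesc e0 = 2%N by rewrite /ddesc /desc lt0 (ltnW lt0); case: ifP.
  rewrite (bigD1 e0) //= c0; split=> [|E e eS ne qe]; first by rewrite leq_addr.
  have ne0 : e != e0 by apply: contraTneq lt0 => <-; rewrite qe ltnn.
  move: E; rewrite (bigD1 e) ?eS //= /ddesc (negbTE ne) qe ltnn leqnn; lia.
have ge e : e \in S -> (p e <= q e)%N.
  by move=> eS; have := no e; rewrite /= eS /= ltnNge => /negbFE.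
have eqp e : e \in S -> q e = p e.
  move=> eS; apply: val_inj; apply/eqP; rewrite eqn_leq (ge _ eS) andbT.
  have : \sum_(e in S) ((q e)%:Z - (p e)%:Z) == 0 by rewrite sumrB qp subrr.
  rewrite psumr_eq0; last by move=> e' /ge; lia.
  by move/allP/(_ e (mem_index_enum _)); rewrite eS /=; lia.
have dE e : e \in S -> ddesc e = (isBndB (eb G e)).+1.
  by move=> eS; rewrite /ddesc /desc eqp // ltnn leqnn; case: ifP.
rewrite (eq_bigr _ dE).
have -> : (\sum_(e in S) (isBndB (eb G e)).+1 = #|S| + \sum_(e in S) isBndB (eb G e))%N.
  by rewrite -sum1_card -big_split /=; apply: eq_bigr => e _; rewrite add1n.
split.
  case: big => [[e eS be]|]; last by lia.
  by rewrite (cardD1 e) eS (bigD1 e) //= be; lia.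
move=> E e eS ne qe e' e'S; split; last exact: eqp.
apply/negP=> be'; move: E; rewrite (cardD1 e) eS (cardD1 e') !inE e'S (bigD1 e') //= be'.
have -> : e' != e by apply: contraNneq ne => <-.
by lia.
Qed.

Lemma card_star_gt0_black b : (0 < #|[set e | eb G e == b]|)%N.
Proof.
rewrite card_gt0; apply/set0Pn; have [d] := vx_surj hG (inl b).
case: d => [[e []]|[i c]] //= [bE]; first by exists e; rewrite inE bE.
by exists (bedge hG i); rewrite inE eb_bedge bE.
Qed.

Lemma card_star_gt0_white w : (0 < #|[set e | ew G e == w]|)%N.
Proof.
rewrite card_gt0; apply/set0Pn; have [d] := vx_surj hG (inr w).
by case: d => [[e []]|[i c]] //= [wE]; exists e; rewrite inE wE.
Qed.

Definition star (v : gB G + gW G) : {set gE G} :=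
  match v with inl b => [set e | eb G e == b] | inr w => [set e | ew G e == w] end.
Definition interior (v : gB G + gW G) : bool := if v is inl b then ~~ isBndB b else true.

Lemma star_ddesc_interior v : interior v ->
  (2 <= \sum_(e in star v) ddesc e)%N /\
  (\sum_(e in star v) ddesc e = 2%N ->
     forall e, e \in star v -> ~~ isBndB (eb G e) -> q e = p e ->
       forall e', e' \in star v -> ~~ isBndB (eb G e') /\ q e' = p e').
Proof.
have [_ [_ [_ [_ [_ [_ [degB [degW _]]]]]]]] := hG.
case: v => [b|w] iv; apply: star_ddesc.
- rewrite (eq_bigl (fun e => eb G e == b)); last by move=> e; rewrite inE.
  by rewrite (star_black_sum (fun i => (i : nat)%:Z)) //; apply: eq_bigl => e; rewrite inE.
- by right; have := degB b iv; have := card_star_gt0_black b; case: #|_| => [|[]].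
- rewrite (eq_bigl (fun e => ew G e == w)); last by move=> e; rewrite inE.
  by rewrite (star_white_sum (fun i => (i : nat)%:Z)) //; apply: eq_bigl => e; rewrite inE.
- have := card_star_gt0_white w; rewrite leq_eqVlt => /orP[/eqP c1|]; last by right.
  have /set0Pn[e] : [set e | ew G e == w] != set0 by rewrite -card_gt0 -c1.
  by rewrite inE => /eqP ewe; left; exists e; [rewrite inE ewe | apply: degW ewe].
Qed.

Lemma sum_star (F : gE G -> nat) :
  (\sum_(v | interior v) \sum_(e in star v) F e + \sum_i F (bedge hG i) = (\sum_e F e).*2)%N.
Proof.
rewrite big_sumType /= -addnn.
have -> : (\sum_(i : gW G | interior (inr i)) \sum_(e in [set e | ew G e == i]) F e = \sum_e F e)%N.
  rewrite (partition_big (ew G) predT) //=; apply: eq_bigr => w _.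
  by apply: eq_bigl => e; rewrite inE.
rewrite addnAC; congr (_ + _)%N.
rewrite [RHS](bigID (fun e => isBndB (eb G e))) /= addnC; congr (_ + _)%N.
  have -> : (\sum_i F (bedge hG i) = \sum_(e in [set bedge hG i | i : 'I_n]) F e)%N.
    by rewrite big_imset //= => i j _ _; apply: bedge_inj.
  apply: eq_bigl => e; apply/imsetP/idP => [[i _ ->]|/(bedgeP hG)[i ->]]; last by exists i.
  by rewrite eb_bedge /isBndB codom_f.
rewrite [RHS](partition_big (eb G) (fun b => ~~ isBndB b)) //=; apply: eq_bigr => b nb.
by apply: eq_bigl => e; rewrite inE; apply/idP/andP => [/eqP->|[]].
Qed.

Hypothesis reduced_faces :
  (nfaces G)%:Z = (\sum_a wexc sig a)%N%:Z * (n%:Z - (\sum_a wexc sig a)%N%:Z) + 1 - lift_length sig.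

Lemma sum_ddesc :
  (\sum_e ddesc e)%N%:Z =
  #|{: gE G}|%:Z - \sum_e (((p e < q e)%N : nat)%:Z - ((q e < p e)%N : nat)%:Z)
  + \sum_(i < n) ((sig i == i) : nat)%:Z.
Proof.
rewrite -[LHS]natz natr_sum.
rewrite (eq_bigr (fun e => 1 - (((p e < q e)%N : nat)%:Z - ((q e < p e)%N : nat)%:Z)
   + (if isBndB (eb G e) then ((q e == p e) : nat)%:Z else 0))); last first.
  move=> e _; rewrite natz /ddesc /desc -val_eqE /=.
  by case: ifP => _; case: (ltngtP (p e) (q e)).
rewrite big_split sumrB /= sumr_const natz -big_mkcond /= (sum_bnd hG (fun e => ((q e == p e) : nat)%:Z)).
congr (_ + _); apply: eq_bigr => i _.
by rewrite (p_bedge hL) (q_bedge hL).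
Qed.

Lemma card_black : (#|{: gB G}| = #|[set b : gB G | ~~ isBndB b]| + n)%N.
Proof.
have bn : #|codom (bnd G)| = n by rewrite card_codom ?card_ord //; exact: (proj1 hG).
rewrite -(cardC (fun b : gB G => isBndB b)) addnC; congr (_ + _)%N.
  by apply: eq_card => b; rewrite !inE.
by rewrite -[RHS]bn; apply: eq_card => b.
Qed.

Lemma nfacesAug_gt0 : (0 < nfacesAug G)%N.
Proof.
rewrite -(card_porbits_phi hG) card_gt0; apply/set0Pn.
exists (porbit (phi hG) (inr (Ordinal (n_gt0 hG), true))).
exact: porbit_in_porbits.
Qed.

(** Every interior vertex has at least two half descents. The signed crossing count, the face number
    of a reduced graph and Euler's formula give their total as exactly twice the number of interior
    vertices, so no vertex has more. *)
Lemma sum_ddesc_star v : interior v -> \sum_(e in star v) ddesc e = 2%N.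
Proof.
have i0 : 'I_n := Ordinal (n_gt0 hG).
pose sinv := invF (sig_inj hL).
have sigK : cancel sig sinv := invF_f (sig_inj hL).
have sinvK : cancel sinv sig := f_invF (sig_inj hL).
have [h hP] := fin_all_exists (height_exists hL).
have sc := signed_crossings hL sigK sinvK (fun x => (hP x).1) (fun x => (hP x).2)
  (i0 := Ordinal (n_gt0 hG)) erefl.
have rf := reduced_faces; set k := (\sum_a wexc sig a)%N in sc rf.
have kE : k%:Z = \sum_(a < n) ((sig a < a)%N : nat)%:Z + \sum_(i < n) ((sig i == i) : nat)%:Z.
  rewrite -big_split /= /k -[LHS]natz natr_sum; apply: eq_bigr => a _.
  by rewrite natz /wexc -val_eqE /=; case: (ltngtP (sig a) a).
have bE : (\sum_i ddesc (bedge hG i) = k.*2)%N.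
  rewrite /k -mul2n big_distrr /=; apply: eq_bigr => i _.
  rewrite /ddesc /desc eb_bedge /isBndB codom_f (p_bedge hL) (q_bedge hL).
  by rewrite mul2n.
have pl : planar G by case: (hG) => _ [_ [_ [_ [_ [_ [_ [_ []]]]]]]].
have sE := sum_star ddesc; rewrite bE in sE.
have tot : (\sum_(v | interior v) \sum_(e in star v) ddesc e = \sum_(v : gB G + gW G | interior v) 2)%N.
  rewrite sum_nat_const.
  have -> : #|[pred v : gB G + gW G | interior v]| = (#|[set b : gB G | ~~ isBndB b]| + #|{: gW G}|)%N.
    rewrite -!sum1_card big_sumType /=; congr (_ + _)%N.
    by apply: eq_bigl => b; rewrite inE.
  have := sum_ddesc; rewrite sc; have := card_black; have := nfacesAug_gt0.
  move: pl rf kE sE; rewrite /planar /nfaces; lia.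
move=> iv; apply/eqP; rewrite eqn_leq (star_ddesc_interior iv).1 andbT leqNgt.
apply/negP => gt2; have : (\sum_(v : gB G + gW G | interior v) 2 < \sum_(v | interior v) \sum_(e in star v) ddesc e)%N.
  rewrite (bigD1 v) //= [X in (_ < X)%N](bigD1 v) //= -addSn leq_add //.
  by apply: leq_sum => u /andP[iu _]; apply: (star_ddesc_interior iu).1.
by rewrite tot ltnn.
Qed.

(** With the star sums tight, equal labels on one interior edge spread to all edges at its two ends,
    and by connectivity to every dart; but the arcs of the boundary circle are not edges of this
    kind. *)
Lemma label_neq e : ~~ isBndB (eb G e) -> q e != p e.
Proof.
move=> ne; apply/eqP => qe.
pose bad e := ~~ isBndB (eb G e) && (q e == p e).
have spread v e1 e2 : interior v -> e1 \in star v -> e2 \in star v -> bad e1 -> bad e2.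
  move=> iv e1v e2v /andP[n1 /eqP b1].
  have [n2 b2] := (star_ddesc_interior iv).2 (sum_ddesc_star iv) _ e1v n1 b1 _ e2v.
  by rewrite /bad n2 b2 eqxx.
pose A : {set adart G} := [set d | if d is inl (e, _) then bad e else false].
have AT : A = [set: adart G].
  apply: (map_connected (hG := hG) (d0 := inl (e, true))).
    by rewrite inE /bad ne qe eqxx.
  case=> [[e1 b]|[i b]] b1; rewrite inE // in b1; rewrite alE; split; first by rewrite inE.
  rewrite sgE; case: b; rewrite inE.
    have n1 : ~~ isBndB (eb G e1) by case/andP: b1.
    by rewrite (asigma_int n1); apply: (spread (inl (eb G e1)) e1) b1 => //=; rewrite inE ?ebB.
  by apply: (spread (inr (ew G e1)) e1) b1 => //=; rewrite inE ?ewW.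
have : inr (Ordinal (n_gt0 hG), true) \in A by rewrite AT inE.
by rewrite inE.
Qed.

Lemma sum_desc_star v : interior v -> (\sum_(e in star v) desc e = 1)%N.
Proof.
move=> iv; have : (\sum_(e in star v) desc e * 2 = \sum_(e in star v) ddesc e)%N.
  apply: eq_bigr => e _; rewrite /ddesc; case: ifP => be; first by rewrite muln2.
  have := label_neq (negbT be); rewrite /desc -val_eqE /=.
  by case: (ltngtP (q e) (p e)).
by rewrite -big_distrl /= sum_ddesc_star // => E; apply/eqP; rewrite -(eqn_pmul2r (m := 2)) // E.
Qed.

End Reduced.

(** * Descents around a face *)

Section Faces.
Variables (n : nat) (G : pgraph n).
Hypothesis hG : disk_graph G.
Variables (sig : 'I_n -> 'I_n) (p q : gE G -> 'I_n).
Hypothesis hL : labelling hG sig p q.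
Hypothesis label_neq : forall e, ~~ isBndB (eb G e) -> q e != p e.
Hypothesis sum_desc_star : forall v, interior v -> (\sum_(e in star v) desc p q e = 1)%N.

Local Notation desc := (desc p q).
Local Notation phi := (phi hG).
Local Notation bedge := (bedge hG).

(** The cyclic distance from [p e] to [q e], taken in [1..n]. One descent at an interior vertex
    means that the labels wind around [[n]] once, so the gaps there sum to [n]. *)
Definition gap (e : gE G) : int := (q e)%:Z - (p e)%:Z + n%:Z * (desc e)%:Z.

Lemma gap_gt0 e : 1 <= gap e.
Proof.
rewrite /gap /desc; have := ltn_ord (p e); have := ltn_ord (q e).
by case: leqP => /=; lia.
Qed.

Lemma gap_le e : gap e <= n%:Z.
Proof.
rewrite /gap /desc; have := ltn_ord (p e); have := ltn_ord (q e).
by case: leqP => /=; lia.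
Qed.

Lemma sum_gap_star v : interior v -> \sum_(e in star v) gap e = n%:Z.
Proof.
move=> iv; rewrite /gap big_split sumrB -mulr_sumr /=.
have -> : \sum_(e in star v) (desc e)%:Z = 1.
  rewrite -[RHS](congr1 Posz (sum_desc_star iv)) -[RHS]natz natr_sum.
  by apply: eq_bigr => e _; rewrite natz.
rewrite mulr1; case: v iv => [b|w] iv /=.
  rewrite (eq_bigl (fun e => eb G e == b)); last by move=> e; rewrite inE.
  rewrite (star_black_sum hL (fun i => (i : nat)%:Z) iv) [X in _ - X](eq_bigl (fun e => eb G e == b)) ?subrr ?add0r //.
  by move=> e; rewrite inE.
rewrite (eq_bigl (fun e => ew G e == w)); last by move=> e; rewrite inE.
rewrite (star_white_sum hL (fun i => (i : nat)%:Z)) [X in _ - X](eq_bigl (fun e => ew G e == w)) ?subrr ?add0r //.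
by move=> e; rewrite inE.
Qed.

Lemma gap_pair v e e' : interior v -> e \in star v -> e' \in star v -> e != e' ->
  gap e + gap e' <= n%:Z /\
  (gap e + gap e' = n%:Z -> forall e'', e'' \in star v -> e'' = e \/ e'' = e').
Proof.
move=> iv ev e'v ee'.
have := sum_gap_star iv; rewrite (bigD1 e) //= (bigD1 e') /=; last by rewrite e'v eq_sym.
set S := (X in _ + (_ + X)).
have S0 : 0 <= S by apply: sumr_ge0 => i _; have := gap_gt0 i; lia.
move=> E; split; first by lia.
move=> E' e'' e''v; case: (eqVneq e'' e) => [|n1]; first by left.
case: (eqVneq e'' e') => [|n2]; first by right.
have : S = 0 by lia.
move/eqP; rewrite psumr_eq0; last by move=> i _; have := gap_gt0 i; lia.
move/allP/(_ e'' (mem_index_enum _)); rewrite e''v n1 n2 /= => /eqP.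
by have := gap_gt0 e''; lia.
Qed.

Lemma rotB_neq e : ~~ isBndB (eb G e) -> rotB G e != e.
Proof.
move=> ne; apply/eqP => re; have := label_neq ne.
by rewrite (q_black hL ne) re eqxx.
Qed.

Lemma rotW_neq e : ~~ isBndB (eb G e) -> rotW G e != e.
Proof.
move=> ne; apply/eqP => re; have := label_neq ne.
by rewrite (q_white hL) re eqxx.
Qed.

Definition isouter (d : adart G) : bool := if d is inr (_, true) then true else false.
Definition isinner (d : adart G) : bool := if d is inr (_, false) then true else false.
Definition istrue (d : adart G) : bool := if d is inl (_, true) then true else false.
Definition ddesc_dart (d : adart G) : int := if d is inl (e, _) then (desc e)%:Z else 0.
(** The correction in multiples of [n] at a boundary arc, where the label passes from [sig i] to
    [ord_pred i]: [wexc] cancels the descent of the boundary edge, and the term at [0] is the wrap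
    of [ord_pred]. *)
Definition arc_shift (d : adart G) : int :=
  if d is inr (i, false) then (wexc sig i)%:Z + ((i == 0%N :> nat) : nat)%:Z else 0.

Let Alab (d : adart G) : int :=
  match d with
  | inl (e, _) => gap e
  | inr (i, false) => - (gap (bedge i) + 1)
  | inr (i, true) => 0
  end.
Let Plab (d : adart G) : int :=
  match d with
  | inl (e, _) => (p e)%:Z
  | inr (i, false) => (sig i)%:Z
  | inr (i, true) => 0
  end.

Variant dart_spec : adart G -> adart G -> Type :=
  | DTrue e : dart_spec (inl (e, true)) (inl (rotW G e, false))
  | DFalse e of ~~ isBndB (eb G e) : dart_spec (inl (e, false)) (inl (rotB G e, true))
  | DBnd i : dart_spec (inl (bedge i, false)) (inr (i, false))
  | DInner i : dart_spec (inr (i, false)) (inl (bedge (ord_pred i), true))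
  | DOuter i : dart_spec (inr (i, true)) (inr (ordS i, true)).

Lemma dartP d : dart_spec d (phi d).
Proof.
case: d => [[e []]|[i []]]; rewrite ?phi_true ?phi_outer ?phi_inner; try constructor.
case: (boolP (isBndB (eb G e))) => [be|ne]; last by rewrite phi_false //; constructor.
have : exists i, e == bedge i by have [i ->] := bedgeP hG be; exists i.
by move=> ex; rewrite (eqP (xchooseP ex)) phi_bedge; constructor.
Qed.

Lemma desc_bedge i : desc (bedge i) = wexc sig i.
Proof. by rewrite /desc (p_bedge hL) (q_bedge hL). Qed.

(** At each dart the two sides differ by the change of the label [Plab] from a dart to its
    successor, and this telescopes around the face. *)
Lemma face_gap_sum X : X \in porbits phi ->
  n%:Z * (\sum_(d in X) ddesc_dart d - \sum_(d in X) arc_shift d) = \sum_(d in X) Alab d.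
Proof.
move=> XP; rewrite -sumrB mulr_sumr; apply/eqP; rewrite -subr_eq0 -sumrB.
rewrite (eq_bigr (fun d => Plab d - Plab (phi d))); last first.
  move=> d _; case: (dartP d) => [e|e ne|i|i|i] /=.
  - by rewrite -(q_white hL) /gap; ring.
  - by rewrite -(q_black hL ne) /gap; ring.
  - by rewrite /gap desc_bedge (p_bedge hL) (q_bedge hL); ring.
  - rewrite /gap desc_bedge !(p_bedge hL) (q_bedge hL).
    have := ltn_ord i; have -> : ord_pred i = ((i + n).-1 %% n)%N :> nat by [].
    case: i => -[|i] /= ni _.
      by rewrite add0n modn_small; lia.
    by rewrite /= modnDr modn_small; lia.
  - by ring.
by rewrite sumrB (sum_porbit_perm Plab XP) subrr.
Qed.

Let A1 (d : adart G) : int := if d is inl (e, false) then gap e else 0.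
Let A2 (d : adart G) : int :=
  match d with
  | inl (e, true) => gap e
  | inr (i, false) => - (gap (bedge i) + 1)
  | _ => 0
  end.

Let AlabE d : Alab d = A1 d + A2 d.
Proof. by case: d => [[e []]|[i []]] /=; rewrite ?addr0 ?add0r. Qed.

Lemma black_pair e : ~~ isBndB (eb G e) -> gap e + gap (rotB G e) <= n%:Z /\
  (gap e + gap (rotB G e) = n%:Z -> forall e'', eb G e'' = eb G e -> e'' = e \/ e'' = rotB G e).
Proof.
move=> ne; have [] := @gap_pair (inl (eb G e)) e (rotB G e) ne.
- by rewrite inE.
- by rewrite inE ebB.
- by rewrite eq_sym rotB_neq.
by move=> h1 h2; split=> // E e'' ee; apply: h2 => //; rewrite inE ee.
Qed.

Lemma white_pair e : rotW G e != e -> gap e + gap (rotW G e) <= n%:Z /\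
  (gap e + gap (rotW G e) = n%:Z -> forall e'', ew G e'' = ew G e -> e'' = e \/ e'' = rotW G e).
Proof.
move=> ne; have [] := @gap_pair (inr (ew G e)) e (rotW G e) isT.
- by rewrite inE.
- by rewrite inE ewW.
- by rewrite eq_sym.
by move=> h1 h2; split=> // E e'' ee; apply: h2 => //; rewrite inE ee.
Qed.

(** The gaps are grouped by black corners of the face: the two edges at an interior corner are
    distinct and share the total [n] of their vertex. Every inner boundary arc loses a further
    unit. *)
Lemma face_le X : X \in porbits phi ->
  n%:Z * (\sum_(d in X) ddesc_dart d - \sum_(d in X) arc_shift d) <=
  n%:Z * \sum_(d in X) (istrue d : nat)%:Z - \sum_(d in X) (isinner d : nat)%:Z.
Proof.
move=> XP; rewrite face_gap_sum // (eq_bigr _ (fun d _ => AlabE d)) big_split /=.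
rewrite -(sum_porbit_perm A2 XP) -(sum_porbit_perm (fun d => (istrue d : nat)%:Z) XP).
rewrite -(sum_porbit_perm (fun d => (isinner d : nat)%:Z) XP) mulr_sumr -sumrB -big_split /=.
apply: ler_sum => d _; case: (dartP d) => [e|e ne|i|i|i] /=.
- lia.
- by have := (black_pair ne).1; lia.
- lia.
- by have := gap_le (bedge (ord_pred i)); lia.
- lia.
Qed.

(** In case of equality the gaps at every black corner fill up [n], and, grouped the other way, also
    those at every white corner. All vertices on the face then have degree two, so the face bounds a
    closed component that never reaches the boundary. *)
Lemma inner_face_lt X : X \in porbits phi ->
  (forall d, d \in X -> ~~ isouter d && ~~ isinner d) ->
  \sum_(d in X) ddesc_dart d - \sum_(d in X) arc_shift d < \sum_(d in X) (istrue d : nat)%:Z.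
Proof.
move=> XP noarc; have n0 := n_gt0 hG; have := face_le XP.
have -> : \sum_(d in X) (isinner d : nat)%:Z = 0.
  by rewrite big1 // => d /noarc /andP[_ /negbTE->].
rewrite subr0 ler_pM2l // lt_def => -> ; rewrite andbT; apply/negP => /eqP E.
have phiX d : (phi d \in X) = (d \in X).
  by case/imsetP: XP => x _ ->; rewrite mem_porbit_step.
have nb e b : inl (e, b) \in X -> ~~ isBndB (eb G e).
  move=> eX; apply/negP => /(bedgeP hG)[i ei].
  case: b eX => eX; last by have := noarc (phi (inl (e, false))); rewrite phiX eX ei phi_bedge => /(_ isT).
  have : phi (inr (ordS i, false)) \in X by rewrite phi_inner ordSK -ei.
  by rewrite phiX => /noarc.
have deg2B e : inl (e, false) \in X -> forall e'', eb G e'' = eb G e -> e'' = e \/ e'' = rotB G e.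
  move=> eX; apply: (black_pair (nb _ _ eX)).2.
  have : \sum_(d in X) (n%:Z * (istrue (phi d) : nat)%:Z - (A1 d + A2 (phi d))) == 0.
    rewrite sumrB -mulr_sumr (sum_porbit_perm (fun d => (istrue d : nat)%:Z) XP) E.
    rewrite face_gap_sum // (eq_bigr _ (fun d _ => AlabE d)) !big_split /= (sum_porbit_perm A2 XP).
    by rewrite subrr.
  rewrite psumr_eq0; last first.
    move=> d dX; case: (dartP d) dX => [e' _|e' ne' _|i iX|i iX|i _] /=; try lia.
    - by have := (black_pair ne').1; lia.
    - by have := noarc _ iX.
  by move/allP/(_ (inl (e, false)) (mem_index_enum _)); rewrite eX phi_false ?nb //=; last exact: nb eX; lia.
have rotWne e : inl (e, true) \in X -> rotW G e != e.
  by move=> eX; apply: rotW_neq; apply: nb eX.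
have deg2W e : inl (e, true) \in X -> forall e'', ew G e'' = ew G e -> e'' = e \/ e'' = rotW G e.
  move=> eX; apply: (white_pair (rotWne _ eX)).2.
  have : \sum_(d in X) (n%:Z * (istrue d : nat)%:Z - (A2 d + A1 (phi d))) == 0.
    rewrite sumrB -mulr_sumr E face_gap_sum // (eq_bigr _ (fun d _ => AlabE d)) !big_split /=.
    by rewrite (sum_porbit_perm A1 XP) addrC [X in _ + - X]addrC addrC subrr.
  rewrite psumr_eq0; last first.
    move=> d dX; case: (dartP d) dX => [e' e'X|e' ne' _|i iX|i iX|i iX] /=; try lia.
    - by have := (white_pair (rotWne _ e'X)).1; lia.
    - by have := noarc _ iX.
  by move/allP/(_ (inl (e, true)) (mem_index_enum _)); rewrite eX phi_true //=; lia.
(* The darts of the face with their reversals: degree two makes this set closed under [al] and the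
   rotation, hence equal to everything. *)
pose S : {set adart G} := [set d | (d \in X) || (al G d \in X)].
have SX d : d \in X -> sg hG d \in S.
  move=> dX; rewrite !inE; apply/orP; right; rewrite sgE.
  case: d dX => [[e b]|[i b]] dX; last by have := noarc _ dX; case: b dX.
  have ne := nb _ _ dX; case: b dX => dX.
    have e'X : inl (((rotB G)^-1)%g e, false) \in X.
      by rewrite -phiX phi_false ?permKV // -(ebB hG) permKV.
    rewrite asigma_int // alE /=.
    case: (deg2B _ e'X (rotB G e)) => [|->//|].
      by rewrite -[RHS](ebB hG) permKV (ebB hG).
    by rewrite permKV => E'; have := rotB_neq ne; rewrite E' eqxx.
  have e'X : inl (((rotW G)^-1)%g e, true) \in X by rewrite -phiX phi_true permKV.
  rewrite /= alE /=; case: (deg2W _ e'X (rotW G e)) => [|->//|].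
    by rewrite -[RHS](ewW hG) permKV (ewW hG).
  by rewrite permKV => E'; have := rotW_neq ne; rewrite E' eqxx.
have [x xX] : exists x, x \in X by case/imsetP: XP => x _ ->; exists x; apply: porbit_id.
have ST : S = [set: adart G].
  apply: (map_connected (hG := hG) (d0 := x)); first by rewrite inE xX.
  move=> d dS; move: (dS); rewrite inE => /orP[dX|adX].
    by split; [rewrite inE alK dX orbT | apply: SX].
  split; first by rewrite inE adX.
  have -> : sg hG d = phi (al G d) by rewrite permM alK.
  by rewrite inE phiX adX.
have : inr (Ordinal n0, true) \in S by rewrite ST inE.
by rewrite inE alE /= => /orP[] /noarc.
Qed.

Lemma isouter_phi d : isouter (phi d) = isouter d.
Proof. by case: dartP. Qed.

Lemma porbit_outer X d d' : X \in porbits phi -> d \in X -> d' \in X -> isouter d = isouter d'.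
Proof.
case/imsetP=> x _ ->; suff H y : y \in porbit phi x -> isouter y = isouter x by move=> /H -> /H ->.
case/porbitP=> m ->; elim: m => [|m IH]; first by rewrite expg0 perm1.
by rewrite expgSr permM isouter_phi.
Qed.

(** For a face of [2m] edges without boundary arcs, excess zero means [m - 1] descents, counted with
    multiplicity. Modulo 2 this is the Kasteleyn condition. *)
Definition face_excess (X : {set adart G}) : int :=
  \sum_(d in X) ddesc_dart d - \sum_(d in X) arc_shift d
   - \sum_(d in X) (istrue d : nat)%:Z + 1.

Lemma face_excess_le0 X : X \in porbits phi -> (exists2 d, d \in X & ~~ isouter d) ->
  face_excess X <= 0.
Proof.
move=> XP [d0 d0X nd0]; have n0 := n_gt0 hG; rewrite /face_excess.
have noo d : d \in X -> ~~ isouter d by move=> dX; rewrite (porbit_outer XP dX d0X).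
case: (pickP [pred d | (d \in X) && isinner d]) => [d /andP[dX di]|no]; last first.
  have := @inner_face_lt X XP; rewrite -subr_lt0 => H; have : forall d, d \in X -> ~~ isouter d && ~~ isinner d.
    by move=> d dX; rewrite noo //=; have := no d; rewrite /= dX /= => ->.
  by move/H; lia.
have : 1 <= \sum_(d in X) (isinner d : nat)%:Z.
  rewrite (bigD1 d) //= di lerDl; exact: sumr_ge0.
have := face_le XP; set N := _ - \sum_(d in X) arc_shift d; set T := \sum_(d in X) (istrue d : nat)%:Z.
move=> le1 t1; suff : N < T by lia.
rewrite ltNge; apply/negP => le2; have : n%:Z * T <= n%:Z * N by rewrite ler_pM2l.
by lia.
Qed.

Lemma face_excess_outer X : X \in porbits phi -> (exists2 d, d \in X & isouter d) ->
  face_excess X = 1.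
Proof.
move=> XP [d0 d0X nd0].
have noo d : d \in X -> isouter d by move=> dX; rewrite (porbit_outer XP dX d0X).
by rewrite /face_excess !big1 ?addr0 ?subr0 ?add0r // => d /noo; case: d => [[e b]|[i []]].
Qed.

Lemma sum_adart (F : adart G -> int) : \sum_d F d =
  \sum_e (F (inl (e, true)) + F (inl (e, false))) + \sum_i (F (inr (i, true)) + F (inr (i, false))).
Proof.
rewrite big_sumType; congr (_ + _).
  rewrite (eq_bigr (fun x => F (inl (x.1, x.2)))); last by case.
  rewrite -(pair_bigA _ (fun e b => F (inl (e, b)))).
  by apply: eq_bigr => e _; rewrite big_bool.
rewrite (eq_bigr (fun x => F (inr (x.1, x.2)))); last by case.
rewrite -(pair_bigA _ (fun i b => F (inr (i, b)))).
by apply: eq_bigr => i _; rewrite big_bool.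
Qed.

Lemma sum_face_excess : \sum_(X in porbits phi) face_excess X = 1.
Proof.
rewrite /face_excess big_split !sumrB /= !sum_porbits sumr_const card_porbits_phi natz.
have desc2 := sum_star hG desc.
rewrite (eq_bigr (fun=> 1%N)) // sum_nat_const muln1 in desc2.
have -> : \sum_d ddesc_dart d = ((\sum_e desc e).*2)%N%:Z.
  rewrite sum_adart /= [X in _ + X]big1 // addr0 big_split /= -addnn PoszD.
  by rewrite sum_Posz.
have -> : \sum_d arc_shift d = (\sum_a wexc sig a)%N%:Z + 1.
  rewrite sum_adart /= big1 ?add0r // big_split /= big1 // add0r big_split /=.
  rewrite sum_Posz; congr (_ + _).
  by rewrite (bigD1 (Ordinal (n_gt0 hG))) //= big1 ?addr0 // => i /negbTE; rewrite -val_eqE /= => ->.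
have -> : \sum_d (istrue d : nat)%:Z = #|{: gE G}|%:Z.
  rewrite sum_adart /= [X in _ + X]big1 // addr0.
  by rewrite (eq_bigr (fun=> 1)) ?sumr_const ?natz // => e _; rewrite addr0.
have bE : (\sum_i desc (bedge i) = \sum_a wexc sig a)%N by apply: eq_bigr => i _; rewrite desc_bedge.
have pl : planar G by case: (hG) => _ [_ [_ [_ [_ [_ [_ [_ []]]]]]]].
have iE : #|[pred v : gB G + gW G | interior v]| = (#|[set b : gB G | ~~ isBndB b]| + #|{: gW G}|)%N.
  rewrite -!sum1_card big_sumType /=; congr (_ + _)%N.
  by apply: eq_bigl => b; rewrite inE.
have := card_black hG; move: pl desc2; rewrite bE iE /planar; lia.
Qed.

(** The outer face has excess one, the others have excess at most zero, and Euler's formula gives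
    the total one. *)
Lemma face_excess_eq0 X : X \in porbits phi -> (exists2 d, d \in X & ~~ isouter d) ->
  face_excess X = 0.
Proof.
move=> XP Xn; pose O := porbit phi (inr (Ordinal (n_gt0 hG), true)).
have OP : O \in porbits phi by apply: porbit_in_porbits.
have eO : face_excess O = 1.
  by apply: face_excess_outer => //; exists (inr (Ordinal (n_gt0 hG), true)); rewrite ?porbit_id.
have XO : X != O.
  apply/eqP=> XO; case: Xn => d dX; rewrite (@porbit_outer X d (inr (Ordinal (n_gt0 hG), true))) //.
  by rewrite XO porbit_id.
have nonouter Y : Y \in porbits phi -> Y != O -> exists2 d, d \in Y & ~~ isouter d.
  move=> YP YO; case/imsetP: (YP) => y _ YE; exists y; first by rewrite YE porbit_id.
  apply: contra YO; case: y YE => [[e b]|[i []]] // YE _; rewrite YE eq_porbit_mem.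
  apply: (@ordS_ind n (fun i => inr (i, true) \in O) (Ordinal (n_gt0 hG))); first exact: porbit_id.
  by move=> j jO; rewrite -phi_outer mem_porbit_step.
have := sum_face_excess; rewrite (bigD1 O) //= eO -[RHS]addr0 => /addrI/eqP.
rewrite -oppr_eq0 -sumrN psumr_eq0; last first.
  by move=> Y /andP[YP YO]; rewrite oppr_ge0; apply: face_excess_le0 (nonouter _ YP YO).
move/allP/(_ X (mem_index_enum _)); rewrite XP XO /= oppr_eq0.
by move/eqP.
Qed.

End Faces.

(** * The Kasteleyn sign *)

Lemma porbit_eq_on (T : finType) (s t : {perm T}) (S : {set T}) x :
  (forall y, y \in S -> s y = t y /\ s y \in S) -> x \in S -> porbit s x = porbit t x.
Proof.
move=> H xS; have P m : (s ^+ m)%g x = (t ^+ m)%g x /\ (s ^+ m)%g x \in S.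
  elim: m => [|m [E ES]]; first by rewrite !expg0 !perm1.
  have [h1 h2] := H _ ES.
  by rewrite !expgSr !permM -E -h1.
apply/setP=> y; apply/porbitP/porbitP => -[m ->]; exists m; first by rewrite (P m).1.
by rewrite -(P m).1.
Qed.

Lemma porbit_sub (T : finType) (s : {perm T}) (S : {set T}) x :
  (forall y, y \in S -> s y \in S) -> x \in S -> porbit s x \subset S.
Proof.
move=> H xS; apply/subsetP=> y /porbitP[m ->].
by elim: m => [|m IH]; rewrite ?expg0 ?perm1 // expgSr permM H.
Qed.

Lemma porbit_fix (T : finType) (s : {perm T}) x : s x = x -> porbit s x = [set x].
Proof.
move=> sx; apply/eqP; rewrite eqEsubset sub1set porbit_id andbT.
by apply: porbit_sub; rewrite ?inE // => y; rewrite inE => /eqP->; rewrite sx inE.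
Qed.

Lemma card_porbits_support (T : finType) (s : {perm T}) (S : {set T}) :
  (forall x, x \notin S -> s x = x) ->
  #|porbits s| = (#|~: S| + #|porbit s @: S|)%N.
Proof.
move=> H; have -> : porbits s = porbit s @: (~: S) :|: porbit s @: S.
  rewrite -imsetU setUC setUCr; apply/setP=> X.
  by apply/imsetP/imsetP=> -[x _ ->]; exists x.
rewrite cardsU [X in (_ - X)%N](_ : _ = 0%N) ?subn0.
  rewrite card_in_imset // => x y; rewrite !inE => xS yS.
  by rewrite !porbit_fix ?H // => /set1_inj.
apply/eqP; rewrite cards_eq0; apply/set0Pn => -[X]; rewrite inE => /andP[/imsetP[x xS ->]].
case/imsetP=> y yS E; rewrite inE in xS.
have : y \in porbit s x by rewrite E porbit_id.
by rewrite (porbit_fix (H _ xS)) inE => /eqP yx; rewrite -yx yS in xS.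
Qed.

Lemma card_involution (T : finType) (s : {perm T}) (S : {set T}) :
  involutive s -> (forall x, s x != x) -> (forall x, x \in S -> s x \in S) ->
  #|S| = (#|porbit s @: S| * 2)%N.
Proof.
move=> sK sn sS; apply: card_uniform_partition (porbits_partition_on sS) => _ /imsetP[x _ ->].
by rewrite (porbit_al sK) cards2 eq_sym sn.
Qed.

(** * Euler's formula modulo 2 for a region bounded by a simple cycle *)

Section Parity.
Variables (D : finType) (al s : {perm D}) (R : {set D}).
Hypothesis alK : involutive al.
Hypothesis al_neq : forall x, al x != x.
Hypothesis hR : forall d, (s (al d) \in R) = (d \in R).

Let C : {set D} := [set d | (d \in R) != (al d \in R)].
Let R2 : {set D} := [set d in R | al d \in R].
Let Rint : {set D} := [set d in R | [disjoint porbit s d & C]].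
Let phi := (al * s)%g.

Hypothesis C_two : forall d, d \in C -> #|porbit s d :&: C| = 2%N.
Hypothesis C_conn : forall Z : {set D}, Z \subset C -> Z != set0 ->
  (forall d, d \in Z -> al d \in Z) ->
  (forall d d', d \in Z -> d' \in C -> d' \in porbit s d -> d' \in Z) -> C \subset Z.
Hypothesis C_neq0 : C != set0.

Let in_s d : (s d \in R) = (al d \in R).
Proof. by rewrite -[RHS]hR alK. Qed.

Let phiR_inj : injective (fun d => if d \in R then phi d else d).
Proof.
move=> x y; case: ifP => xR; case: ifP => yR //; first by apply: perm_inj.
  by move=> E; move: yR; rewrite -E /phi permM hR xR.
by move=> E; move: xR; rewrite E /phi permM hR yR.
Qed.
Let alR_inj : injective (fun d => if d \in R2 then al d else d).
Proof.
have st d : d \in R2 -> al d \in R2 by rewrite !inE alK andbC.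
move=> x y; case: ifP => xR; case: ifP => yR //; first by apply: perm_inj.
  by move=> E; move: yR; rewrite -E st.
by move=> E; move: xR; rewrite E st.
Qed.
Let phiR : {perm D} := perm phiR_inj.
Let alR : {perm D} := perm alR_inj.
Let sR : {perm D} := (alR * phiR)%g.

Let sR_in d : d \in R -> d \notin C -> sR d = s d.
Proof.
rewrite !inE negbK => dR /eqP adR; rewrite permM !permE inE dR -adR dR /=.
by rewrite -adR dR alK.
Qed.
Let sR_C d : d \in R -> d \in C -> sR d = s (al d).
Proof.
rewrite !inE => dR; rewrite dR => /negbTE adR; rewrite permM !permE inE dR.
have -> : (al d \in R) = false by move: adR; case: (al d \in R).
by rewrite /= dR.
Qed.
Let sR_out d : d \notin R -> sR d = d.
Proof. by move=> nd; rewrite permM !permE inE (negbTE nd) /= (negbTE nd). Qed.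

Let C_al d : (al d \in C) = (d \in C).
Proof. by rewrite !inE alK eq_sym. Qed.

(** Going around an orbit of [s], membership in [R] changes exactly after the darts of [C]. The
    changes add up to zero, so of the two darts of [C] in the orbit one leaves [R] and the other
    enters it. *)
Let C_unique c d : c \in C -> d \in C -> c \in R -> d \in R -> d \in porbit s c -> c = d.
Proof.
move=> cC dC cR dR dc; apply/eqP; apply: contraT => ncd.
have E : porbit s c :&: C = [set c; d].
  apply/eqP; rewrite eq_sym eqEcard (C_two cC) cards2 ncd andbT.
  by apply/subsetP=> x; rewrite in_set2 in_setI => /orP[]/eqP->; rewrite ?porbit_id ?dc ?cC ?dC.
have := sum_porbit_telescope s (fun x => ((x \in R) : nat)%:Z) c.
rewrite (bigID (mem C)) /= [X in _ + X]big1 ?addr0; last first.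
  by move=> x /andP[_]; rewrite inE negbK in_s => /eqP->; rewrite subrr.
rewrite (eq_bigl (fun x => x \in [set c; d])); last by move=> x; rewrite -E in_setI.
rewrite big_setU1 ?inE // big_set1 /= !in_s.
by move: cC dC; rewrite !inE cR dR; case: (al c \in R); case: (al d \in R).
Qed.

Let C_exists d : d \in C -> exists2 c, c \in porbit s d & (c \in C) && (c \in R).
Proof.
move=> dC; apply/exists_inP; apply: contraT; rewrite negb_exists_in => /forall_inP no.
have := sum_porbit_telescope s (fun x => ((x \in R) : nat)%:Z) d.
have nR x : x \in porbit s d -> x \in C -> (x \in R) = false.
  by move=> xd xC; apply/negbTE; have := no x xd; rewrite xC.
have ge x : x \in porbit s d -> 0 <= ((s x \in R) : nat)%:Z - ((x \in R) : nat)%:Z.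
  move=> xd; case: (boolP (x \in C)) => xC; first by rewrite (nR x xd xC).
  by move: xC; rewrite inE negbK in_s => /eqP->; rewrite subrr.
move/eqP; rewrite psumr_eq0 // => /allP/(_ d (mem_index_enum _)).
have dR := nR d (porbit_id s d) dC.
by rewrite porbit_id /= in_s dR; move: dC; rewrite inE dR; case: (al d \in R).
Qed.

Let sR_reach c j : c \in C -> c \in R -> forall d, d \in R -> d \in porbit s c ->
  (s ^+ j)%g d = c -> c \in porbit sR d.
Proof.
move=> cC cR; elim: j => [|j IH] d dR dc.
  by rewrite expg0 perm1 => ->; apply: porbit_id.
rewrite expgS permM => E; case: (boolP (d \in C)) => dC.
  by rewrite (C_unique cC dC) // porbit_id.
have := IH (s d); rewrite -(sR_in dR dC) porbit_step; apply=> //.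
- by rewrite (sR_in dR dC) in_s; move: dC; rewrite inE negbK dR => /eqP.
- by rewrite (sR_in dR dC) -eq_porbit_mem porbit_step eq_porbit_mem.
- by rewrite (sR_in dR dC).
Qed.

Let sR_reach' c d : c \in C -> c \in R -> d \in R -> d \in porbit s c -> c \in porbit sR d.
Proof.
move=> cC cR dR dc; have : c \in porbit s d by rewrite porbit_sym.
by case/porbitP=> j E; apply: (sR_reach (j := j)).
Qed.

Let sR_cross c c' : c \in C -> c \in R -> c' \in C -> c' \in R -> c' \in porbit s (al c) ->
  c' \in porbit sR c.
Proof.
move=> cC cR c'C c'R c'c.
rewrite -[porbit sR c]porbit_step (sR_C cR cC); apply: sR_reach' => //; first by rewrite hR.
by rewrite porbit_sym porbit_step.
Qed.

(** At a dart of [C] in [R] the restricted rotation [sR] moves on to the other end of the edge. It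
    therefore runs along the boundary curve and, the curve being connected, merges all its vertices
    into one orbit. *)
Lemma single_boundary_orbit x y : x \in R :\: Rint -> y \in R :\: Rint -> porbit sR x = porbit sR y.
Proof.
have toC z : z \in R :\: Rint -> exists2 c, (c \in C) && (c \in R) & c \in porbit sR z.
  rewrite in_setD => /andP[+ zR]; rewrite inE zR /= -setI_eq0 => /set0Pn[d]; rewrite inE => /andP[dz dC].
  have [c cd /andP[cC cR]] := C_exists dC; exists c; first by rewrite cC.
  apply: sR_reach' => //; rewrite porbit_sym; move: cd.
  by rewrite -!eq_porbit_mem => /eqP->; rewrite eq_porbit_mem.
move=> /toC[c0 /andP[c0C c0R] c0x] /toC[c1 /andP[c1C c1R] c1y].
pose Z := [set d in C | [exists c in porbit s d, [&& c \in C, c \in R & c \in porbit sR c0]]].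
have ZC : C \subset Z.
  apply: C_conn.
  - by apply/subsetP=> d; rewrite inE => /andP[].
  - apply/set0Pn; exists c0; rewrite inE c0C; apply/exists_inP; exists c0; first exact: porbit_id.
    by rewrite c0C c0R porbit_id.
  - move=> d; rewrite inE => /andP[dC /exists_inP[c cd /and3P[cC cR cc0]]].
    have adC : al d \in C by rewrite C_al.
    have [c' c'd /andP[c'C c'R]] := C_exists adC.
    rewrite inE adC; apply/exists_inP; exists c' => //; rewrite c'C c'R /=.
    case: (boolP (d \in R)) => dR.
      have E : c = d by apply: C_unique; rewrite // porbit_sym.
      subst c; have := sR_cross dC dR c'C c'R c'd.
      by move: cc0; rewrite -!eq_porbit_mem => /eqP-> /eqP->.
    have adR : al d \in R by move: dC; rewrite inE (negbTE dR); case: (al d \in R).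
    have E : c' = al d by apply: C_unique; rewrite // porbit_sym.
    subst c'; have := sR_cross adC adR cC cR; rewrite alK => /(_ cd).
    by move: cc0; rewrite -!eq_porbit_mem => /eqP-> /eqP->.
  - move=> d d'; rewrite inE => /andP[dC /exists_inP[c cd H]] d'C d'd.
    rewrite inE d'C; apply/exists_inP; exists c => //.
    by move: cd d'd; rewrite -!eq_porbit_mem => /eqP-> /eqP->.
have : c1 \in Z by apply: (subsetP ZC).
rewrite inE c1C => /exists_inP[c cc1 /and3P[cC cR cc0]].
have E : c = c1 by apply: C_unique; rewrite // porbit_sym.
subst c; apply/eqP; move: c0x c1y cc0; rewrite -!eq_porbit_mem => /eqP<- /eqP<- /eqP->.
by [].
Qed.

(* Euler's formula modulo 2 for the region R, read off from the signs of the permutations sR = phiR alR. *)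
Lemma region_parity :
  odd #|porbit phi @: R| (+) odd #|porbit al @: R2| = ~~ odd #|porbit s @: Rint|.
Proof.
have := odd_permM alR phiR; rewrite -/sR.
have st2 d : d \in R2 -> al d \in R2 by rewrite !inE alK andbC.
have cardD (S : {set D}) : #|D| = (#|~: S| + #|S|)%N by rewrite addnC cardsC.
have alRn x : x \notin R2 -> alR x = x by rewrite permE => /negbTE->.
have phiRn x : x \notin R -> phiR x = x by rewrite permE => /negbTE->.
rewrite /odd_perm (card_porbits_support alRn) (card_porbits_support phiRn) (card_porbits_support sR_out).
have -> : porbit alR @: R2 = porbit al @: R2.
  apply: eq_in_imset => x xR; apply: porbit_eq_on xR => y yR.
  by rewrite permE yR; split=> //; apply: st2.
have -> : porbit phiR @: R = porbit phi @: R.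
  apply: eq_in_imset => x xR; apply: porbit_eq_on xR => y yR.
  by rewrite permE yR; split=> //; rewrite /phi permM hR.
have -> : #|porbit sR @: R| = (#|porbit s @: Rint| + 1)%N.
  have RintR : Rint \subset R by apply/subsetP=> x; rewrite inE => /andP[].
  have RintS y : y \in Rint -> sR y = s y /\ s y \in Rint.
    rewrite inE => /andP[yR dj]; have yC : y \notin C by apply/negP => yC; have := disjointFr dj (porbit_id s y); rewrite yC.
    rewrite (sR_in yR yC); split=> //; rewrite inE porbit_step dj andbT in_s.
    by move: yC; rewrite inE negbK yR => /eqP.
  rewrite -{1}(setID R Rint) (setIidPr RintR) imsetU.
  have -> : porbit sR @: Rint = porbit s @: Rint.
    apply: eq_in_imset => x xR; apply: porbit_eq_on xR => y yR.
    by have [-> ?] := RintS y yR.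
  have /set0Pn[d dC] := C_neq0; have [c cd /andP[cC cR]] := C_exists dC.
  have cRi : c \in R :\: Rint.
    by rewrite inE cR andbT inE cR /= -setI_eq0; apply/set0Pn; exists c; rewrite inE porbit_id.
  have -> : porbit sR @: (R :\: Rint) = [set porbit sR c].
    apply/setP=> X; rewrite inE; apply/imsetP/eqP => [[x xR ->]|->]; last by exists c.
    exact: single_boundary_orbit.
  rewrite setUC cardsU1 addnC; congr (_ + _)%N.
  case: imsetP => // -[x xR E]; move: cRi; rewrite !inE => /andP[/negP[]].
  have xc : c \in porbit s x by rewrite -E porbit_id.
  move: xR; rewrite inE => /andP[xR dj]; rewrite cR /=.
  by move: xc; rewrite -eq_porbit_mem => /eqP->.
have := card_involution alK al_neq st2; have := cardD R2.
set a := #|porbit phi @: R|; set b := #|porbit al @: R2|; set c := #|porbit s @: Rint|.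
set x := #|~: R|; set y := #|~: R2| => -> ->.
rewrite !oddD oddM /= andbF addbF.
by case: (odd a); case: (odd b); case: (odd c); case: (odd x); case: (odd y).
Qed.

End Parity.

Lemma odd_sum (T : finType) (P : pred T) (F F' : T -> nat) :
  (forall x, P x -> odd (F x) = odd (F' x)) -> odd (\sum_(x | P x) F x) = odd (\sum_(x | P x) F' x).
Proof.
move=> H; rewrite !(big_morph odd oddD erefl).
exact: eq_bigr.
Qed.

(** * Descents on the boundary of a region *)

Section CycleParity.
Variables (n : nat) (G : pgraph n).
Hypothesis hG : disk_graph G.
Variables (sig : 'I_n -> 'I_n) (p q : gE G -> 'I_n).
Hypothesis hL : labelling hG sig p q.
Hypothesis label_neq : forall e, ~~ isBndB (eb G e) -> q e != p e.
Hypothesis sum_desc_star : forall v, interior v -> (\sum_(e in star v) desc p q e = 1)%N.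

Local Notation desc := (desc p q).
Local Notation phi := (phi hG).
Local Notation sg := (sg hG).

Variable R : {set adart G}.
Hypothesis R_phi : forall d, (phi d \in R) = (d \in R).
Hypothesis R_outer : forall i, inr (i, true) \notin R.

Definition region_cut : {set adart G} := [set d | (d \in R) != (al G d \in R)].
Definition cut_edges : {set gE G} := [set e | inl (e, true) \in region_cut].
Definition region_core : {set adart G} := [set d in R | [disjoint porbit sg d & region_cut]].

Hypothesis C_two : forall d, d \in region_cut -> #|porbit sg d :&: region_cut| = 2%N.
Hypothesis C_conn : forall Z : {set adart G}, Z \subset region_cut -> Z != set0 ->
  (forall d, d \in Z -> al G d \in Z) ->
  (forall d d', d \in Z -> d' \in region_cut -> vx d' = vx d -> d' \in Z) -> region_cut \subset Z.
Hypothesis C_neq0 : region_cut != set0.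

Lemma region_excess :
  \sum_(d in R) ddesc_dart p q d - \sum_(d in R) arc_shift sig d
   - \sum_(d in R) (istrue d : nat)%:Z + #|porbit phi @: R|%:Z = 0.
Proof.
have Rs d : d \in R -> phi d \in R by rewrite R_phi.
have pP := porbits_partition_on Rs.
have cov (F : adart G -> int) : \sum_(d in R) F d = \sum_(X in porbit phi @: R) \sum_(d in X) F d.
  exact: set_partition_big.
have -> : #|porbit phi @: R|%:Z = \sum_(X in porbit phi @: R) 1 by rewrite sumr_const natz.
rewrite !cov -!sumrB -big_split /= big1 // => X /imsetP[d dR ->].
apply: (face_excess_eq0 hL label_neq sum_desc_star); first exact: porbit_in_porbits.
exists d; first exact: porbit_id.
by case: d dR => [[e b]|[i []]] //; rewrite (negbTE (R_outer i)).
Qed.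

Lemma inl_sum (F : adart G -> nat) : (forall i b, F (inr (i, b)) = 0%N) ->
  (\sum_(d in R) F d = \sum_e ((inl (e, true) \in R) * F (inl (e, true)) + (inl (e, false) \in R) * F (inl (e, false))))%N.
Proof.
move=> F0; rewrite big_mkcond big_sumType /= [X in (_ + X)%N]big1 ?addn0; last first.
  by move=> [i b] _; rewrite F0 if_same.
rewrite (eq_bigr (fun x => if inl (x.1, x.2) \in R then F (inl (x.1, x.2)) else 0%N)); last by case.
rewrite -(pair_bigA _ (fun e b => if inl (e, b) \in R then F (inl (e, b)) else 0%N)) /=.
by apply: eq_bigr => e _; rewrite big_bool; do 2!case: (_ \in R); rewrite ?mul1n ?mul0n.
Qed.

(** The face excesses inside [R] add up to zero. Modulo 2 the descents of edges with both sides in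
    [R] drop out and those of the boundary curve stay, while Euler's formula modulo 2 trades the
    faces and inner edges for the enclosed vertices. *)
Lemma cycle_parity :
  odd (\sum_(e in cut_edges) desc e) =
    odd (\sum_(i < n | inr (i, false) \in R) (wexc sig i + (i == 0%N :> nat)))
    (+) odd (#|cut_edges|./2) (+) ~~ odd #|porbit sg @: region_core|.
Proof.
have hR d : (sg (al G d) \in R) = (d \in R) by rewrite -(R_phi d) permM.
have par := region_parity (@alK n G) (@al_neq n G) hR C_two.
have {par} := par _ C_neq0; rewrite -/region_core => par.
have {par} : odd #|porbit phi @: R| (+) odd #|porbit (al G) @: [set d in R | al G d \in R]| =
   ~~ odd #|porbit sg @: region_core|.
  apply: par => Z ZC Z0 Zal Zs; apply: C_conn => // d d' dZ d'C dd; apply: Zs dZ d'C _.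
  by rewrite porbit_sg inE dd.
set R2 := [set d in R | _]; move=> par.
have R2s d : d \in R2 -> al G d \in R2 by rewrite !inE alK andbC.
have cR2 := card_involution (@alK n G) (@al_neq n G) R2s.
pose t e : nat := (inl (e, true) : adart G) \in R; pose f e : nat := (inl (e, false) : adart G) \in R.
have cutE e : (e \in cut_edges : nat) = (t e != f e).
  by rewrite !inE alE /= /t /f; do 2!case: (_ \in R).
(* [phi] carries [(e, true)] to [(rotW e, false)], so [R] holds equally many darts of both
   directions; hence the number of black-to-white darts is that of the inner edges plus half the
   length of the curve. *)
have TF : (\sum_e t e = \sum_e f e)%N.
  rewrite [RHS](reindex_inj (@perm_inj _ (rotW G))) /=; apply: eq_bigr => e _.
  by rewrite /t /f -phi_true R_phi.
have cR2E : #|R2| = (\sum_e (t e * f e)).*2%N.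
  rewrite -sum1_card big_mkcond big_sumType /= [X in (_ + X)%N]big1 ?addn0; last first.
    move=> [i b] _; rewrite !inE alE; case: b => /=; first by rewrite (negbTE (R_outer _)).
    by rewrite (negbTE (R_outer _)) andbF.
  rewrite (eq_bigr (fun x => if inl (x.1, x.2) \in R2 then 1%N else 0%N)); last by case.
  rewrite -(pair_bigA _ (fun e b => if inl (e, b) \in R2 then 1%N else 0%N)) /=.
  rewrite -addnn -big_split; apply: eq_bigr => e _; rewrite big_bool !inE !alE /= /t /f.
  by do 2!case: (_ \in R).
have Lc : #|cut_edges| = (\sum_e (t e != f e))%N.
  by rewrite -sum1_card big_mkcond; apply: eq_bigr => e _; rewrite -cutE; case: (_ \in _).
have twoT : (\sum_e t e).*2 = (\sum_e (t e * f e)).*2 + #|cut_edges|.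
  rewrite -addnn {2}TF -addnn Lc -!big_split /=; apply: eq_bigr => e _.
  by rewrite /t /f; do 2!case: (_ \in R).
have ex := region_excess.
have dE : \sum_(d in R) ddesc_dart p q d = (\sum_e (t e * desc e + f e * desc e))%N%:Z.
  pose F (d : adart G) : nat := if d is inl (e, _) then desc e else 0%N.
  rewrite (eq_bigr (fun d => (F d)%:Z)); last by case=> [[e b]|[i b]].
  by rewrite sum_Posz inl_sum.
have tE : \sum_(d in R) (istrue d : nat)%:Z = (\sum_e t e)%N%:Z.
  rewrite sum_Posz inl_sum; last by move=> i [].
  by congr (Posz _); apply: eq_bigr => e _; rewrite /= muln1 muln0 addn0.
have aE : \sum_(d in R) arc_shift sig d =
    (\sum_(i < n | inr (i, false) \in R) (wexc sig i + (i == 0%N :> nat)))%N%:Z.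
  rewrite big_mkcond big_sumType /= big1 ?add0r; last by case=> e b _; rewrite if_same.
  rewrite (eq_bigr (fun x => if inr (x.1, x.2) \in R then arc_shift sig (inr (x.1, x.2) : adart G) else 0)); last by case.
  rewrite -(pair_bigA _ (fun i b => if inr (i, b) \in R then arc_shift sig (inr (i, b) : adart G) else 0)) /=.
  rewrite -sum_Posz [RHS]big_mkcond; apply: eq_bigr => i _; rewrite big_bool /= if_same add0r.
  by case: ifP.
have E : (\sum_e (t e * desc e + f e * desc e) + #|porbit phi @: R| =
   \sum_(i < n | inr (i, false) \in R) (wexc sig i + (i == 0%N :> nat)) + \sum_e t e)%N.
  by move: ex; rewrite dE tE aE; lia.
have {E} := congr1 odd E; rewrite !oddD.
have -> : odd (\sum_e (t e * desc e + f e * desc e)) = odd (\sum_(e in cut_edges) desc e).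
  rewrite [in RHS]big_mkcond /=; apply: odd_sum => e _.
  by have := cutE e; rewrite /t /f; do 2!case: (_ \in R) => /=; case: (e \in _) => //=; rewrite ?mul1n ?mul0n ?addn0 // oddD addbb.
have -> : (\sum_e t e = \sum_e (t e * f e) + #|cut_edges|./2)%N.
  by rewrite -[LHS](doubleK) twoT halfD odd_double /= doubleK.
have eR2 : #|porbit (al G) @: R2| = (\sum_e t e * f e)%N.
  by move: cR2; rewrite cR2E -muln2 => /eqP; rewrite eqn_pmul2r // => /eqP.
rewrite eR2 in par; rewrite oddD; move: par.
by do 6!case: (odd _).
Qed.
End CycleParity.

Definition bmap (n : nat) (G : pgraph n) (r : option 'I_n) (m : gW G -> gE G) (x : option (gW G)) : option (gB G) :=
  if x is Some w then Some (eb G (m w)) else omap (bnd G) r.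

(* A matching of the white vertices, extended by a virtual white vertex [None] attached to the boundary vertex [r], if any. *)
Record config (n : nat) (G : pgraph n) (J : {set 'I_n}) (r : option 'I_n) (m : gW G -> gE G) : Prop := Config {
  cf_ew : forall w, ew G (m w) = w;
  cf_inj : injective (bmap r m);
  cf_im : forall b, (Some b \in codom (bmap r m)) = ~~ isBndB b || [exists j in J, b == bnd G j] }.

(** * The closed curve formed by two matchings along one orbit *)

Section OrbitCycle.
Variables (n : nat) (G : pgraph n).
Hypothesis hG : disk_graph G.
Variables (J : {set 'I_n}) (r r' : option 'I_n) (m m' : gW G -> gE G).
Hypotheses (cf : config J r m) (cf' : config J r' m').
Variable pi : {perm option (gW G)}.
Hypothesis piE : forall x, bmap r m (pi x) = bmap r' m' x.
Variable X : {set option (gW G)}.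
Hypothesis X_orbit : X \in porbits pi.
Hypothesis X_act : forall w, Some w \in X -> m w != m' w.
Hypothesis X_arc : None \in X -> exists a b : 'I_n, [/\ r = Some a, r' = Some b & (a < b)%N].

Definition lo : nat := if r is Some a then a else 0%N.
Definition hi : nat := if r' is Some b then b else 0%N.

Definition cyc_edge (e : gE G) : bool :=
  [exists w, (Some w \in X) && ((e == m w) || (e == m' w))].
Definition cyc_dart : {set adart G} := [set d : adart G |
  match d with
  | inl (e, _) => cyc_edge e
  | inr (i, true) => (None \in X) && (lo <= i < hi)%N
  | inr (i, false) => (None \in X) && (lo < i <= hi)%N
  end].

Lemma cyc_edge_m w : Some w \in X -> cyc_edge (m w).
Proof. by move=> wX; apply/existsP; exists w; rewrite wX eqxx. Qed.
Lemma cyc_edge_m' w : Some w \in X -> cyc_edge (m' w).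
Proof. by move=> wX; apply/existsP; exists w; rewrite wX eqxx orbT. Qed.

Lemma cyc_edgeP e : cyc_edge e -> Some (ew G e) \in X /\ (e = m (ew G e) \/ e = m' (ew G e)).
Proof.
case/existsP=> w /andP[wX /orP[]/eqP eE].
  by rewrite eE (cf_ew cf); split=> //; left.
by rewrite eE (cf_ew cf'); split=> //; right.
Qed.

Lemma X_pi x : (pi x \in X) = (x \in X).
Proof. by case/imsetP: X_orbit => y _ ->; rewrite mem_porbit_step. Qed.

Lemma lo_r i : None \in X -> r = Some i -> lo = i.
Proof. by rewrite /lo => _ ->. Qed.
Lemma hi_r i : None \in X -> r' = Some i -> hi = i.
Proof. by rewrite /hi => _ ->. Qed.

Lemma cyc_dart_al d : (al G d \in cyc_dart) = (d \in cyc_dart).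
Proof.
have key i : ((inr (ordS i, false) : adart G) \in cyc_dart) = ((inr (i, true) : adart G) \in cyc_dart).
  rewrite !inE; case NX : (None \in X) => //=.
  have [a [b [ra rb ab]]] := X_arc NX; rewrite (lo_r NX ra) (hi_r NX rb).
  have [[iS lt]|[iS iE]] := ordS_cases i; rewrite /= in iS; rewrite iS //.
  by rewrite ltn0 /=; have := ltn_ord b; lia.
rewrite alE; case: d => [[e b]|[i []]] /=; first by rewrite !inE.
  exact: key.
by rewrite -key ord_predK.
Qed.

Lemma edge_at_bnd e i : eb G e = bnd G i -> e = bedge hG i.
Proof. exact: bedge_uniq. Qed.

Lemma cyc_vertex_black b :
  (forall d, vx d = inl b -> d \notin cyc_dart) \/
  (exists d1 d2, [/\ d1 != d2, d1 \in cyc_dart, d2 \in cyc_dart, vx d1 = inl b & vx d2 = inl b] /\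
     forall d, d \in cyc_dart -> vx d = inl b -> d = d1 \/ d = d2).
Proof.
have bnd_inj : injective (bnd G) := proj1 hG.
have arcs_only : (forall e, eb G e = b -> ~~ cyc_edge e) ->
   (forall i, b = bnd G i -> None \in X -> lo <> i /\ hi <> i) ->
   (forall d, vx d = inl b -> d \notin cyc_dart) \/
  (exists d1 d2, [/\ d1 != d2, d1 \in cyc_dart, d2 \in cyc_dart, vx d1 = inl b & vx d2 = inl b] /\
     forall d, d \in cyc_dart -> vx d = inl b -> d = d1 \/ d = d2).
  move=> noe noi; case: (isBndBP b) => [[i bi]|nb]; last first.
    left=> -[[e []]|[i c]] //= [E]; last by case: nb; exists i.
    by rewrite inE; apply: noe.
  case: (boolP ((None \in X) && (lo < i < hi)%N)) => [/andP[NX li]|nli].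
    right; exists (inr (i, true)), (inr (i, false)); split.
      case/andP: li => h1 h2.
      by rewrite !inE NX /= bi (ltnW h1) (ltnW h2) h1 h2; split=> //; apply/eqP => -[].
    move=> [[e []]|[j []]] //= + [E]; first by rewrite inE (negbTE (noe _ E)).
      by rewrite bi in E; move/bnd_inj: E => -> _; left.
    by rewrite bi in E; move/bnd_inj: E => -> _; right.
  left=> -[[e []]|[j c]] //= [E]; first by rewrite inE; apply: noe.
  rewrite bi in E; move/bnd_inj: E => ->; rewrite inE.
  case NX : (None \in X) nli => //=; last by case: c.
  move=> nli; have [h1 h2] := noi _ bi NX; case: c; move: nli h1 h2; move: (nat_of_ord i) => ii; lia.
case: (boolP (Some b \in codom (bmap r' m'))) => [/codomP[y yb]|nb]; last first.
  have nb' : Some b \notin codom (bmap r m) by rewrite (cf_im cf) -(cf_im cf').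
  apply: arcs_only => [e eE|i bi NX].
    apply/negP => /cyc_edgeP[_ [E|E]].
      by case/negP: nb'; apply/codomP; exists (Some (ew G e)); rewrite /= -E eE.
    by case/negP: nb; apply/codomP; exists (Some (ew G e)); rewrite /= -E eE.
  have [a [b' [ra rb ab]]] := X_arc NX; rewrite (lo_r NX ra) (hi_r NX rb); split=> /val_inj E.
    by case/negP: nb'; apply/codomP; exists None; rewrite /= ra E bi.
  by case/negP: nb; apply/codomP; exists None; rewrite /= rb E bi.
(* The black vertex [b] is matched to [x = pi y] by [m] and to [y] by [m']. As [x] and [y] are in
   the same orbit, [b] has either both or neither of its matching edges on the curve. *)
have xb := piE y; rewrite -yb in xb; have Xxy := X_pi y.
move: xb Xxy; move: (pi y) => x xb Xxy.
have uniq_m w : eb G (m w) = b -> Some w = x by move=> E; apply: (cf_inj cf); rewrite /= E xb.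
have uniq_m' w : eb G (m' w) = b -> Some w = y by move=> E; apply: (cf_inj cf'); rewrite /= E yb.
have edge_cases e : eb G e = b -> cyc_edge e ->
    (exists2 w, x = Some w & e = m w) \/ (exists2 w, y = Some w & e = m' w).
  move=> eE /cyc_edgeP[_ [E|E]]; [left|right]; exists (ew G e) => //.
    by apply/esym/uniq_m; rewrite -E.
  by apply/esym/uniq_m'; rewrite -E.
case: (boolP (y \in X)) => yX; last first.
  apply: arcs_only => [e eE|i bi NX].
    apply/negP => ce; have [eX _] := cyc_edgeP ce.
    have [[w xw eE']|[w yw eE']] := edge_cases e eE ce; move: eX; rewrite eE' ?(cf_ew cf) ?(cf_ew cf').
      by rewrite -xw Xxy (negbTE yX).
    by rewrite -yw (negbTE yX).
  have [a [b' [ra rb ab]]] := X_arc NX; rewrite (lo_r NX ra) (hi_r NX rb); split=> /val_inj E.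
    have : x = None by apply: (cf_inj cf); rewrite xb /= ra E bi.
    by move=> x0; move: Xxy; rewrite x0 NX (negbTE yX).
  have : y = None by apply: (cf_inj cf'); rewrite -yb /= rb E bi.
  by move=> y0; move: yX; rewrite y0 NX.
rewrite yX in Xxy; case: x xb Xxy uniq_m edge_cases => [w|] xb xX uniq_m edge_cases;
  case: y yb yX uniq_m' edge_cases => [w'|] yb yX uniq_m' edge_cases.
- have [bw] : Some (eb G (m w)) = Some b by [].
  have [bw'] : Some b = Some (eb G (m' w')) by [].
  have ne : m w != m' w'.
    apply/eqP=> E; have ww : w = w' by rewrite -(cf_ew cf w) E (cf_ew cf').
    by move: (X_act xX); rewrite {2}ww E eqxx.
  right; exists (inl (m w, true)), (inl (m' w', true)); split.
    rewrite !inE cyc_edge_m ?cyc_edge_m' //= -bw' bw; split=> //.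
    by apply: contra ne => /eqP[->].
  move=> [[e []]|[i c]] //= ce [E].
    move: ce; rewrite inE => ce.
    by have [[v [<-] ->]|[v [<-] ->]] := edge_cases e E ce; [left|right].
  have e1 : m w = bedge hG i by apply: edge_at_bnd; rewrite bw E.
  have e2 : m' w' = bedge hG i by apply: edge_at_bnd; rewrite -bw' E.
  by move: ne; rewrite e1 e2 eqxx.
- have [a [b' [ra rb ab]]] := X_arc yX; have [bw] : Some (eb G (m w)) = Some b by [].
  have [bb] : Some b = Some (bnd G b') by rewrite yb /= rb.
  right; exists (inl (m w, true)), (inr (b', false)); split.
    by rewrite !inE cyc_edge_m //= yX bw bb (lo_r yX ra) (hi_r yX rb) ab leqnn.
  move=> [[e []]|[i c]] //= + [E]; rewrite inE.
    by move=> ce; have [[v [<-] ->]|[v]] := edge_cases e E ce; [left|].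
  rewrite bb in E; move/bnd_inj: E => ->; case: c => /andP[_]; last by right.
  by rewrite (hi_r yX rb) ltnn andbF.
- have [a [b' [ra rb ab]]] := X_arc xX; have [bw] : Some b = Some (eb G (m' w')) by [].
  have [bb] : Some (bnd G a) = Some b by rewrite -xb /= ra.
  right; exists (inl (m' w', true)), (inr (a, true)); split.
    by rewrite !inE cyc_edge_m' //= xX -bw bb (lo_r xX ra) (hi_r xX rb) ab leqnn.
  move=> [[e []]|[i c]] //= + [E]; rewrite inE.
    by move=> ce; have [[v]|[v [<-] ->]] := edge_cases e E ce; [|left].
  rewrite -bb in E; move/bnd_inj: E => ->; case: c => /andP[_]; first by right.
  by rewrite (lo_r xX ra) ltnn.
- have [a [b' [ra rb ab]]] := X_arc xX; move: xb yb; rewrite /= ra rb /= => <- [/bnd_inj E].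
  by move: ab; rewrite E ltnn.
Qed.

Lemma cyc_vertex v :
  (forall d, vx d = v -> d \notin cyc_dart) \/
  (exists d1 d2, [/\ d1 != d2, d1 \in cyc_dart, d2 \in cyc_dart, vx d1 = v & vx d2 = v] /\
     forall d, d \in cyc_dart -> vx d = v -> d = d1 \/ d = d2).
Proof.
case: v => [b|w]; first exact: cyc_vertex_black.
case: (boolP (Some w \in X)) => wX; [right|left].
  exists (inl (m w, false)), (inl (m' w, false)); split.
    rewrite !inE cyc_edge_m ?cyc_edge_m' //= (cf_ew cf) (cf_ew cf'); split=> //.
    by apply: contra (X_act wX) => /eqP[->].
  move=> [[e []]|[i c]] //= + [E]; rewrite inE => /cyc_edgeP[_]; rewrite E.
  by case=> ->; [left|right].
move=> [[e []]|[i c]] //= [E]; rewrite inE; apply/negP => /cyc_edgeP[]; rewrite E.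
by rewrite (negbTE wX).
Qed.

Lemma cyc_degree v : #|[set d in cyc_dart | vx d == v]| = 0%N \/ #|[set d in cyc_dart | vx d == v]| = 2%N.
Proof.
case: (cyc_vertex v) => [no|[d1 [d2 [[ne c1 c2 v1 v2] all]]]]; [left|right].
  by apply: eq_card0 => d; rewrite !inE; apply/negP => /andP[dC /eqP/no]; rewrite inE dC.
have -> : [set d in cyc_dart | vx d == v] = [set d1; d2]; last by rewrite cards2 ne.
apply/setP=> d; rewrite in_set2 inE; apply/andP/orP => [[dC /eqP dv]|[]/eqP->].
- by case: (all d dC dv) => ->; rewrite eqxx; [left|right].
- by rewrite v1 eqxx.
- by rewrite v2 eqxx.
Qed.

Lemma F2_neq (a b c : 'F_2) : ((a != c) != (b != c)) = (a != b).
Proof.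
by case: a => [[|[|[]]]] //= ?; case: b => [[|[|[]]]] //= ?; case: c => [[|[|[]]]].
Qed.

(** The discrete Jordan curve theorem. All degrees on the curve are even, so its indicator in ['F_2]
    is the difference of a two-colouring of the faces; [R] consists of the faces coloured unlike the
    outer one. *)
Lemma cyc_region : exists R : {set adart G}, [/\ forall d, (phi hG d \in R) = (d \in R),
  forall i, inr (i, true) \notin R & region_cut R = cyc_dart].
Proof.
have [||rho [rphi rw]] := planar_coexact hG (w := fun d => (d \in cyc_dart)%:R : 'F_2).
- by move=> d; rewrite cyc_dart_al; case: (_ \in _); apply/eqP.
- move=> d; rewrite -natr_sum; have -> : (\sum_(y | vx y == vx d) (y \in cyc_dart) = #|[set y in cyc_dart | vx y == vx d]|)%N.
    rewrite -sum1_card big_mkcond [RHS]big_mkcond /=; apply: eq_bigr => y _.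
    by rewrite !inE andbC; case: (vx y == _) => //=; case: ifP.
  by case: (cyc_degree (vx d)) => ->; apply/eqP.
pose o : adart G := inr (Ordinal (n_gt0 hG), true).
exists [set d | rho d != rho o]; split=> [d|i|].
- by rewrite !inE rphi.
- rewrite inE negbK; apply/eqP; move: i.
  apply: (ordS_ind (i0 := Ordinal (n_gt0 hG))) => // i IH.
  by rewrite -(phi_outer hG) rphi.
- apply/setP=> d; rewrite inE !in_set F2_neq.
  have := rw d; rewrite /cyc_dart in_set; case: (X in (nat_of_bool X)%:R) => /=.
    by move=> E; apply/eqP => rr; move: E; rewrite rr subrr => /eqP.
  by move/esym/eqP; rewrite subr_eq0 eq_sym => ->.
Qed.

Lemma cyc_forward (Z : {set adart G}) (a b : 'I_n) :
  None \in X -> r = Some a -> r' = Some b -> (a < b)%N ->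
  (forall d, d \in Z -> al G d \in Z) ->
  (forall d d', d \in Z -> d' \in cyc_dart -> vx d' = vx d -> d' \in Z) ->
  forall i j : 'I_n, (a <= i)%N -> inr (i, true) \in Z -> (i <= j)%N -> (j < b)%N ->
     inr (j, true) \in Z /\ inr (ordS j, false) \in Z.
Proof.
move=> NX ra rb ab Zal Zv i j ai iZ ij jb.
suff H : inr (j, true) \in Z by split=> //; have := Zal _ H; rewrite alE.
elim: {j}(nat_of_ord j) {-2}j (erefl (nat_of_ord j)) ij jb => [|k IH] j jk ij jb.
  have -> : j = i by apply: val_inj => /=; lia.
  by [].
have [ji|ji] := eqVneq j i; first by rewrite ji.
have ji' : nat_of_ord j <> i by move/val_inj => E; rewrite E eqxx in ji.
have kn : (k < n)%N by have := ltn_ord j; lia.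
have kZ := IH (Ordinal kn) erefl; rewrite /= in kZ.
have {kZ}/Zal : (inr (Ordinal kn, true) : adart G) \in Z by apply: kZ; lia.
rewrite alE /=; have -> : ordS (Ordinal kn) = j.
  by apply: val_inj; rewrite /= modn_small ?jk //; have := ltn_ord j; lia.
move=> jZ; apply: (Zv _ _ jZ) => //.
by rewrite inE NX /= (lo_r NX ra) (hi_r NX rb); lia.
Qed.

(** A step of [pi] on [X] walks along the curve, through two edges or through the boundary arc, and
    [pi] is transitive on [X]. *)
Lemma cyc_connected (Z : {set adart G}) :
  Z \subset cyc_dart -> Z != set0 ->
  (forall d, d \in Z -> al G d \in Z) ->
  (forall d d', d \in Z -> d' \in cyc_dart -> vx d' = vx d -> d' \in Z) -> cyc_dart \subset Z.
Proof.
move=> ZC /set0Pn[z0 z0Z] Zal Zv.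
(* [good x] records that [Z] contains the piece of the curve by which the walk leaves the white
   vertex [x], real or virtual. *)
pose good (x : option (gW G)) : Prop :=
  match x with
  | Some w => inl (m w, false) \in Z
  | None => forall a, r = Some a -> inr (a, true) \in Z
  end.
have good_m' w : Some w \in X -> good (Some w) -> inl (m' w, true) \in Z.
  move=> wX gw; have : (inl (m' w, false) : adart G) \in Z.
    by apply: (Zv _ _ gw); rewrite ?inE ?cyc_edge_m' //= (cf_ew cf) (cf_ew cf').
  by move/Zal; rewrite alE.
have end_good (a b : 'I_n) : None \in X -> r = Some a -> r' = Some b -> (a < b)%N ->
    forall i : 'I_n, (a <= i)%N -> (i < b)%N -> inr (i, true) \in Z -> good (pi None).
  move=> NX ra rb ab i ai ib iZ.
  have b1n : (b.-1 < n)%N by have := ltn_ord b; lia.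
  have [] := @cyc_forward Z a b NX ra rb ab Zal Zv i (Ordinal b1n) ai iZ; rewrite /=; try lia.
  have -> : ordS (Ordinal b1n) = b.
    by apply: val_inj => /=; rewrite prednK ?modn_small //; lia.
  move=> _ bZ; have := piE None; have := X_pi None; rewrite NX /= rb /=.
  case: (pi None) => [w|] wX /=; last by rewrite ra => -[/(proj1 hG) E]; move: ab; rewrite E ltnn.
  move=> [eE]; have : (inl (m w, true) : adart G) \in Z.
    by apply: (Zv _ _ bZ); rewrite ?inE ?cyc_edge_m //= eE.
  by move/Zal; rewrite alE.
have step y : y \in X -> good y -> good (pi y).
  case: y => [w'|] yX gy; last first.
    have [a [b [ra rb ab]]] := X_arc yX.
    by apply: (end_good a b) (gy a ra).
  have mZ := good_m' _ yX gy; have := piE (Some w'); have := X_pi (Some w'); rewrite yX.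
  case: (pi (Some w')) => [w|] xX /= => [[eE]|].
    have : (inl (m w, true) : adart G) \in Z.
      by apply: (Zv _ _ mZ); rewrite ?inE ?cyc_edge_m //= eE.
    by move/Zal; rewrite alE.
  move=> E a ra; move: E; rewrite ra /= => -[E]; apply: (Zv _ _ mZ); last by rewrite /= E.
  have [a' [b [ra' rb ab]]] := X_arc xX.
  rewrite inE xX (lo_r xX ra) (hi_r xX rb) leqnn /=.
  by move: ra'; rewrite ra => -[->].
have all_good x y : x \in X -> y \in X -> good x -> good y.
  case/imsetP: X_orbit => z _ XE; rewrite XE => xz yz gx.
  have : y \in porbit pi x by move: xz yz; rewrite -!eq_porbit_mem => /eqP-> /eqP->.
  case/porbitP=> k ->; elim: k => [|k IH]; first by rewrite expg0 perm1.
  rewrite expgSr permM; apply: step IH.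
  rewrite XE -eq_porbit_mem porbit_perm eq_porbit_mem.
  exact: xz.
have [x0 x0X gx0] : exists2 x, x \in X & good x.
  have := subsetP ZC _ z0Z; case: z0 z0Z => [[e c]|[i c]] z0Z; rewrite inE.
    move=> ce; have [wX _] := cyc_edgeP ce; exists (Some (ew G e)) => //=.
    have : (inl (e, false) : adart G) \in Z.
      by case: c z0Z => // /Zal; rewrite alE.
    by move=> eZ; apply: (Zv _ _ eZ); rewrite ?inE ?cyc_edge_m //= (cf_ew cf).
  move=> iC; have NX : None \in X by case: c z0Z iC => _ /andP[].
  have [a [b [ra rb ab]]] := X_arc NX.
  exists (pi None); first by rewrite X_pi.
  case: c z0Z iC => z0Z; rewrite NX (lo_r NX ra) (hi_r NX rb) /= => /andP[h1 h2].
    exact: (end_good a b _ _ _ _ i).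
  have := Zal _ z0Z; rewrite alE /=; apply: (end_good a b) => //=.
    have -> : ((i + n).-1 = i.-1 + n)%N by lia.
    by rewrite modnDr modn_small; have := ltn_ord i; lia.
  have -> : ((i + n).-1 = i.-1 + n)%N by lia.
  by rewrite modnDr modn_small; have := ltn_ord i; lia.
have G_ x : x \in X -> good x by move=> xX; apply: all_good gx0.
apply/subsetP=> -[[e c]|[i c]]; rewrite inE => dC.
  have [wX eE] := cyc_edgeP dC; have gw := G_ _ wX; have mZ := good_m' _ wX gw.
  case: eE => ->.
    by case: c; [have := Zal _ gw; rewrite alE | exact: gw].
  by case: c; [exact: mZ | have := Zal _ mZ; rewrite alE].
have NX : None \in X by case: c dC => /andP[].
have [a [b [ra rb ab]]] := X_arc NX; have aZ := G_ _ NX a ra.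
have fwd j := @cyc_forward Z a b NX ra rb ab Zal Zv a j (leqnn a) aZ.
case: c dC; rewrite NX (lo_r NX ra) (hi_r NX rb) /= => /andP[h1 h2].
  exact: (fwd i h1 h2).1.
have i1n : (i.-1 < n)%N by have := ltn_ord i; lia.
have [] := fwd (Ordinal i1n); rewrite /=; try lia.
move=> _; suff -> : ordS (Ordinal i1n) = i by [].
by apply: val_inj => /=; rewrite prednK ?modn_small //; lia.
Qed.

Variable R : {set adart G}.
Hypothesis R_phi : forall d, (phi hG d \in R) = (d \in R).
Hypothesis R_outer : forall i, inr (i, true) \notin R.
Hypothesis R_cut : region_cut R = cyc_dart.

Let Rcore := region_core hG R.

Lemma cutE d : (d \in cyc_dart) = ((d \in R) != (al G d \in R)).
Proof. by rewrite -R_cut in_set. Qed.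

Lemma core_in d : d \in Rcore -> d \in R /\ d \notin cyc_dart.
Proof.
rewrite /Rcore /region_core R_cut in_set => /andP[dR dj]; split=> //.
by apply/negP => dC; have := disjointFr dj (porbit_id _ d); rewrite dC.
Qed.

Lemma coreP d : reflect (d \in R /\ forall d', vx d' = vx d -> d' \notin cyc_dart) (d \in Rcore).
Proof.
rewrite /Rcore /region_core R_cut in_set; apply: (iffP andP) => -[dR H]; split=> //.
  move=> d' vd; apply/negP => dC; have := disjointFr H (x := d'); rewrite porbit_sg inE vd eqxx => /(_ isT).
  by rewrite dC.
rewrite -setI_eq0; apply/eqP/setP=> d'; rewrite in_setI porbit_sg inE in_set0.
by apply/negP => /andP[/eqP vd]; apply/negP; apply: H.
Qed.

Lemma core_vx d d' : d \in Rcore -> vx d' = vx d -> d' \in Rcore.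
Proof.
move=> dR vd; have : d' \in porbit (sg hG) d by rewrite porbit_sg inE vd.
case/porbitP=> k -> {d' vd}; elim: k => [|k IH]; first by rewrite expg0 perm1.
have /coreP[kR kC] := IH; rewrite expgSr permM; apply/coreP; split.
  have : (((sg hG) ^+ k)%g d) \notin cyc_dart by apply: kC.
  have := R_phi (al G (((sg hG) ^+ k)%g d)); rewrite /phi permM alK cutE => ->.
  by rewrite negbK kR => /eqP <-.
by move=> d'; rewrite vx_sg => /kC.
Qed.

Lemma bmap_codom_bnd x i : bmap r m x = Some (bnd G i) -> i \in J.
Proof.
move=> E; have : Some (bnd G i) \in codom (bmap r m) by apply/codomP; exists x.
rewrite (cf_im cf) /isBndB codom_f /= => /exists_inP[j jJ /eqP/(proj1 hG) ->].
exact: jJ.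
Qed.

Lemma cyc_at_black w e : eb G e = eb G (m w) -> cyc_edge e -> Some w \in X.
Proof.
move=> eE ce; have [eX [E|E]] := cyc_edgeP ce.
  suff -> : Some w = Some (ew G e) by [].
  by apply: (cf_inj cf); rewrite /= -eE -E.
rewrite -X_pi in eX; suff -> : Some w = pi (Some (ew G e)) by [].
by apply: (cf_inj cf); rewrite piE /= -eE -E.
Qed.

Lemma cyc_at_white w : inl (m w, false) \in cyc_dart = (Some w \in X).
Proof.
rewrite inE; apply/idP/idP => [/cyc_edgeP[]|]; first by rewrite (cf_ew cf).
exact: cyc_edge_m.
Qed.

Lemma white_core w : (inl (m w, false) \in Rcore) = (inl (m w, false) \in R) && (Some w \notin X).
Proof.
apply/coreP/andP => [[dR H]|[dR wX]]; split=> //.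
  by rewrite -cyc_at_white; apply: H.
move=> d /= vd; apply: contra wX; case: d vd => [[e []]|[i c]] //= [E].
by rewrite inE => /cyc_edgeP[]; rewrite E (cf_ew cf).
Qed.

Definition core_white : {set gW G} := [set w | inl (m w, false) \in Rcore].
Definition core_black : {set gB G} := [set b | [exists d in Rcore, vx d == inl b]].
Definition arc_index : {set 'I_n} := [set j in J | (None \in X) && (lo < j < hi)%N].

Lemma core_black_interior b : b \in core_black -> ~~ isBndB b.
Proof.
rewrite inE => /exists_inP[d dR /eqP vd]; apply/negP => /isBndBP[i bi].
have : (inr (i, true) : adart G) \in Rcore by apply: core_vx dR _; rewrite vd /= bi.
by case/core_in => h; rewrite (negbTE (R_outer i)) in h.
Qed.

(** An edge of [m] at a white vertex strictly inside cannot end on the alternating part of the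
    curve, whose black vertices are matched along it. It ends strictly inside, or at a boundary
    vertex of [J] in the open closing arc. *)
Lemma core_white_image :
  (fun w => eb G (m w)) @: core_white = core_black :|: bnd G @: arc_index.
Proof.
apply/setP=> b; rewrite in_setU; apply/imsetP/orP => [[w]|[]].
- rewrite inE => wc ->; have := wc; rewrite white_core => /andP[wR wX].
  have tR : (inl (m w, true) : adart G) \in R.
    have : (inl (m w, false) : adart G) \notin cyc_dart by rewrite cyc_at_white.
    by rewrite cutE alE /= negbK wR => /eqP <-.
  case: (cyc_vertex (inl (eb G (m w)))) => [no|[d1 [d2 [[_ c1 _ v1 _] _]]]].
    left; rewrite inE; apply/exists_inP; exists (inl (m w, true)) => //.
    by apply/coreP; split=> // d /= /no.
  right; case: d1 c1 v1 => [[e []]|[i c]] //= c1 [v1].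
    by move: c1; rewrite inE => /(cyc_at_black v1); rewrite (negbTE wX).
  apply/imsetP; exists i => //; rewrite inE (bmap_codom_bnd (x := Some w)) /= ?v1 //.
  have NX : None \in X by move: c1; rewrite inE; case: c => /andP[].
  have [a [b' [ra rb ab]]] := X_arc NX; rewrite NX (lo_r NX ra) (hi_r NX rb) /=.
  have ia : nat_of_ord i <> a.
    move/val_inj => E; suff : None = Some w by [].
    by apply: (cf_inj cf); rewrite /= ra /= -v1 E.
  have ib : nat_of_ord i <> b'.
    move/val_inj => E; have : pi None = Some w by apply: (cf_inj cf); rewrite piE /= rb /= -v1 E.
    by move=> pN; move: wX; rewrite -pN X_pi NX.
  move: c1; rewrite inE NX (lo_r NX ra) (hi_r NX rb) /=; case: c; lia.
- move=> bc; have nb := core_black_interior bc; move: bc; rewrite inE => /exists_inP[d dR /eqP vd].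
  have : Some b \in codom (bmap r m) by rewrite (cf_im cf) nb.
  case/codomP=> -[w|] /=; last by case: (r) => //= a [E]; rewrite E /isBndB codom_f in nb.
  case=> bE; exists w => //; rewrite inE.
  have tR : (inl (m w, true) : adart G) \in Rcore by apply: core_vx dR _; rewrite vd /= bE.
  have [tR' tC] := core_in tR; rewrite white_core -cyc_at_white.
  have -> : (inl (m w, false) \in cyc_dart) = (inl (m w, true) \in cyc_dart) by rewrite !inE.
  by rewrite tC andbT; move: tC; rewrite cutE alE /= negbK tR' => /eqP <-.
- case/imsetP=> j; rewrite inE => /and3P[jJ NX lj] ->.
  have [a [b' [ra rb ab]]] := X_arc NX; rewrite (lo_r NX ra) (hi_r NX rb) in lj.
  have : Some (bnd G j) \in codom (bmap r m).
    by rewrite (cf_im cf); apply/orP; right; apply/exists_inP; exists j.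
  case/codomP=> -[w|] /=; last by rewrite ra => -[/(proj1 hG) E]; move: lj; rewrite E ltnn.
  case=> bE; exists w => //; rewrite inE white_core.
  have mE : m w = bedge hG j by apply: edge_at_bnd.
  have wX : Some w \notin X.
    apply/negP => wX; have : Some (bnd G j) \in codom (bmap r' m').
      by rewrite (cf_im cf'); apply/orP; right; apply/exists_inP; exists j.
    case/codomP=> -[w'|] /=; last by rewrite rb => -[/(proj1 hG) E]; move: lj; rewrite E ltnn andbF.
    case=> bE'; have mE' : m' w' = bedge hG j by apply: edge_at_bnd.
    have ww : w = w' by rewrite -(cf_ew cf w) -(cf_ew cf' w') mE mE'.
    by have := X_act wX; rewrite mE ww mE' eqxx.
  rewrite wX andbT.
  have iR : (inr (j, false) : adart G) \in R.
    have : (inr (j, false) : adart G) \in cyc_dart.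
      by rewrite inE NX (lo_r NX ra) (hi_r NX rb) /=; move: lj; lia.
    by rewrite cutE alE /= (negbTE (R_outer _)) ; case: (_ \in R).
  by rewrite mE -R_phi phi_bedge.
Qed.

(** [m] pairs the vertices strictly inside the curve, except for the white ones matched to the
    closing arc. *)
Lemma odd_core : odd #|porbit (sg hG) @: Rcore| = odd #|arc_index|.
Proof.
have -> : #|porbit (sg hG) @: Rcore| = #|@vx n G @: Rcore|.
  have -> : porbit (sg hG) @: Rcore = (fun v => [set y | vx y == v]) @: (@vx n G @: Rcore).
    by rewrite -imset_comp; apply: eq_imset => d; rewrite porbit_sg.
  apply: card_in_imset => _ _ /imsetP[d _ ->] /imsetP[d' _ ->] /setP/(_ d).
  by rewrite !inE eqxx => /esym/eqP.
have -> : @vx n G @: Rcore = inl @: core_black :|: inr @: core_white.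
  apply/setP=> v; rewrite in_setU; apply/imsetP/orP => [[d dR ->]|[]/imsetP[]].
  - case vd : (vx d) => [b|w]; [left|right]; apply: imset_f; rewrite inE.
      by apply/exists_inP; exists d; rewrite ?vd.
    by apply: core_vx dR _; rewrite vd /= (cf_ew cf).
  - by move=> b; rewrite inE => /exists_inP[d dR /eqP vd] ->; exists d.
  - by move=> w; rewrite inE => wR ->; exists (inl (m w, false)); rewrite //= (cf_ew cf).
rewrite cardsU [X in (_ - X)%N](_ : _ = 0%N) ?subn0; last first.
  apply/eqP; rewrite cards_eq0; apply/set0Pn => -[v]; rewrite in_setI.
  by case/andP=> /imsetP[b _ ->] /imsetP[].
rewrite !card_imset; [|by move=> ? ? []|by move=> ? ? []].
have -> : #|core_white| = #|(fun w => eb G (m w)) @: core_white|.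
  by rewrite card_imset // => w w' E; have := @cf_inj _ _ _ _ _ cf (Some w) (Some w'); rewrite /= E => /(_ erefl)[].
rewrite core_white_image cardsU [X in (_ - X)%N](_ : _ = 0%N) ?subn0; last first.
  apply/eqP; rewrite cards_eq0; apply/set0Pn => -[b]; rewrite in_setI => /andP[/core_black_interior nb].
  by case/imsetP=> j _ E; move: nb; rewrite E /isBndB codom_f.
by rewrite (card_imset _ (proj1 hG)) addnA oddD addnn odd_double.
Qed.

Variables (sig : 'I_n -> 'I_n) (p q : gE G -> 'I_n).
Hypothesis hL : labelling hG sig p q.
Hypothesis label_neq : forall e, ~~ isBndB (eb G e) -> q e != p e.
Hypothesis sum_desc_star : forall v, interior v -> (\sum_(e in star v) desc p q e = 1)%N.

Lemma sum_cyc_edge (F : gE G -> nat) :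
  (\sum_(e | cyc_edge e) F e = \sum_(w | Some w \in X) (F (m w) + F (m' w)))%N.
Proof.
rewrite (partition_big (ew G) (fun w => Some w \in X)); last by move=> e /cyc_edgeP[].
apply: eq_bigr => w wX; rewrite (bigD1 (m w)) /=; last by rewrite cyc_edge_m //= (cf_ew cf).
rewrite (bigD1 (m' w)) /=; last by rewrite cyc_edge_m' //= (cf_ew cf') eqxx eq_sym X_act.
rewrite big1 ?addn0 // => e /andP[/andP[/andP[ce /eqP eE] n1] n2].
by have [_ []] := cyc_edgeP ce; rewrite eE => E; [case/eqP: n1|case/eqP: n2].
Qed.

(** The curve has two edges for each real white vertex of [X], so half its length is [#|X|] up to
    the virtual vertex, which accounts for the last successor. *)
Lemma orbit_parity_region :
  odd #|X|.+1 = odd (\sum_(w | Some w \in X) (desc p q (m w) + desc p q (m' w))) (+)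
    ((None \in X) && odd (#|[set j in J | (lo < j < hi)%N]| + \sum_(i < n | (lo < i <= hi)%N) wexc sig i).+1).
Proof.
have C0 : region_cut R != set0.
  rewrite R_cut; have [w wX] : exists w, Some w \in X.
    case/imsetP: (X_orbit) => -[w|] _ XE; first by exists w; rewrite XE porbit_id.
    have NX : None \in X by rewrite XE porbit_id.
    case pN : (pi None) => [w|]; first by exists w; rewrite -pN X_pi NX.
    have [a [b [ra rb ab]]] := X_arc NX.
    by have := piE None; rewrite pN /= ra rb /= => -[/(proj1 hG) E]; rewrite E ltnn in ab.
  by apply/set0Pn; exists (inl (m w, false)); rewrite cyc_at_white.
have C2 d : d \in region_cut R -> #|porbit (sg hG) d :&: region_cut R| = 2%N.
  rewrite R_cut => dC; have -> : porbit (sg hG) d :&: cyc_dart = [set d' in cyc_dart | vx d' == vx d].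
    by apply/setP=> d'; rewrite in_setI porbit_sg !in_set andbC.
  case: (cyc_degree (vx d)) => // /eqP; rewrite cards_eq0 => /eqP/setP/(_ d).
  by rewrite in_set dC eqxx in_set0.
have Cc (Z : {set adart G}) : Z \subset region_cut R -> Z != finset.set0 -> (forall d, d \in Z -> al G d \in Z) ->
    (forall d d', d \in Z -> d' \in region_cut R -> vx d' = vx d -> d' \in Z) -> region_cut R \subset Z.
  by rewrite R_cut; apply: cyc_connected.
have := cycle_parity hL label_neq sum_desc_star R_phi R_outer C2 Cc C0.
rewrite odd_core.
have -> : cut_edges R = [set e | cyc_edge e] by apply/setP=> e; rewrite [LHS]in_set R_cut !inE.
have sE (F : gE G -> nat) : (\sum_(e in [set e | cyc_edge e]) F e = \sum_(w | Some w \in X) (F (m w) + F (m' w)))%N.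
  by rewrite -sum_cyc_edge; apply: eq_bigl => e; rewrite inE.
rewrite -sum1_card !sE sum_nat_const.
have XE : #|X| = (#|[pred w | Some w \in X]| + (None \in X))%N.
  rewrite -sum1_card big_mkcond /= (bigD1 None) //= addnC; congr (_ + _)%N.
  rewrite -sum1_card [RHS]big_mkcond /=.
  rewrite (reindex_omap Some id) /=; last by case.
  by apply: eq_bigl => w; rewrite eqxx.
rewrite XE muln2 doubleK.
have -> : odd (\sum_(i < n | inr (i, false) \in R) (wexc sig i + (i == 0%N :> nat)))
  = (None \in X) && odd (\sum_(i < n | (lo < i <= hi)%N) wexc sig i).
  have RE i : ((inr (i, false) : adart G) \in R) = (None \in X) && (lo < i <= hi)%N.
    by have := cutE (inr (i, false)); rewrite alE /= (negbTE (R_outer _)) inE => ->; case: (_ \in R).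
  case NX : (None \in X) => /=; last by rewrite big1 // => i; rewrite RE NX.
  congr odd; apply: eq_big => i; rewrite RE NX //= => /andP[li _].
  (* The arc contains only indices above [lo], so the wrap term of [arc_shift] never enters. *)
  have -> : (i == 0%N :> nat) = false by apply/negbTE; rewrite -lt0n (leq_ltn_trans _ li).
  by rewrite addn0.
have -> : #|arc_index| = if None \in X then #|[set j in J | (lo < j < hi)%N]| else 0%N.
  case NX : (None \in X); first by apply: eq_card => j; rewrite !inE NX.
  by apply: eq_card0 => j; rewrite !inE NX andbF.
case: (None \in X) => /= ->; rewrite ?addn0 ?addn1 /= ?oddD.
  by do 3!case: (odd _).
by case: (odd _).
Qed.

End OrbitCycle.

(** * The sign of an exchange of matchings, and the descent matching *)

Section Kasteleyn.
Variables (n : nat) (G : pgraph n).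
Hypothesis hG : disk_graph G.
Variables (sig : 'I_n -> 'I_n) (p q : gE G -> 'I_n).
Hypothesis hL : labelling hG sig p q.
Hypothesis label_neq : forall e, ~~ isBndB (eb G e) -> q e != p e.
Hypothesis sum_desc_star : forall v, interior v -> (\sum_(e in star v) desc p q e = 1)%N.
Local Notation desc := (desc p q).

Section Pair.
Variables (J : {set 'I_n}) (r r' : option 'I_n) (m m' : gW G -> gE G).
Hypotheses (cf : config J r m) (cf' : config J r' m').
Variable pi : {perm option (gW G)}.
Hypothesis piE : forall x, bmap r m (pi x) = bmap r' m' x.

Lemma orbit_parity (X : {set option (gW G)}) : X \in porbits pi ->
  (forall w, Some w \in X -> m w != m' w) ->
  (None \in X -> exists a b : 'I_n, [/\ r = Some a, r' = Some b & (a < b)%N]) ->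
  odd #|X|.+1 = odd (\sum_(w | Some w \in X) (desc (m w) + desc (m' w))) (+)
    ((None \in X) && odd (#|[set j in J | (lo r < j < hi r')%N]| + \sum_(i < n | (lo r < i <= hi r')%N) wexc sig i).+1).
Proof.
move=> XP Xa XN; have [R [R1 R2 R3]] := cyc_region hG cf cf' piE XP Xa XN.
exact: (orbit_parity_region cf cf' piE XP Xa XN R1 R2 R3 hL label_neq sum_desc_star).
Qed.

Lemma pi_fix w : m w = m' w -> pi (Some w) = Some w.
Proof. by move=> E; apply: (cf_inj cf); rewrite piE /= E. Qed.

(** The extra parity of the orbit of the virtual vertex: the vertices of [J] inside the closing arc,
    the boundary corrections along it, and one for the virtual vertex itself. A fixed virtual vertex
    contributes nothing. *)
Definition exchange_sign : bool :=
  if r is Some a then if r' is Some b then (a != b) &&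
    odd (#|[set j in J | (a < j < b)%N]| + \sum_(i < n | (a < i <= b)%N) wexc sig i).+1
  else false else false.

Hypothesis rr : (r = None /\ r' = None) \/ (exists a b : 'I_n, [/\ r = Some a, r' = Some b & (a <= b)%N]).

(** The sign of [pi] is the product over its orbits of the signs of cycles of length [#|X|]. Orbits
    where the matchings agree give nothing, the others are alternating cycles, and exactly one orbit
    contains the virtual vertex. *)
Lemma kasteleyn_sign :
  odd_perm pi = odd (\sum_w (desc (m w) + desc (m' w))) (+) exchange_sign.
Proof.
have spN (F : option (gW G) -> nat) : (\sum_(X in porbits pi) \sum_(x in X) F x = \sum_x F x)%N.
  exact: sum_porbits.
pose g (x : option (gW G)) : nat := if x is Some w then (desc (m w) + desc (m' w))%N else 0%N.
have gX (X : {set option (gW G)}) : (\sum_(w | Some w \in X) (desc (m w) + desc (m' w)) = \sum_(x in X) g x)%N.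
  rewrite [RHS]big_mkcond (bigD1 None) //= if_same add0n -big_mkcondr /=.
  rewrite [RHS](reindex_omap Some id) /=; last by case.
  by apply: eq_bigl => w; rewrite eqxx andbT.
have key X : X \in porbits pi ->
    odd (#|X|.+1) = odd (\sum_(x in X) g x + (None \in X) * exchange_sign)%N.
  move=> XP; rewrite oddD oddM oddb -(gX X).
  case: (boolP [exists w, (Some w \in X) && (m w == m' w)]) => [/existsP[w /andP[wX /eqP E]]|].
    have XE : X = [set Some w].
      case/imsetP: (XP) wX => x _ XE; rewrite XE -eq_porbit_mem => /eqP <-.
      by rewrite porbit_fix // pi_fix.
    rewrite gX XE cards1 big_set1 /= E addnn odd_double inE.
    by [].
  rewrite negb_exists => /forallP act.
  have Xa w : Some w \in X -> m w != m' w by move=> wX; have := act w; rewrite wX.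
  case: (boolP (None \in X)) => NX; last first.
    by rewrite (orbit_parity XP Xa) (negbTE NX) //=.
  case: rr => [[r0 r0']|[a [b [ra rb]]]].
    have pN : pi None = None by apply: (cf_inj cf); rewrite piE r0 r0'.
    have XE : X = [set None].
      case/imsetP: (XP) NX => x _ XE; rewrite XE -eq_porbit_mem => /eqP <-.
      by rewrite porbit_fix.
    by rewrite gX XE cards1 big_set1 /exchange_sign r0.
  rewrite leq_eqVlt => /orP[/eqP/val_inj ab|ab].
    have pN : pi None = None by apply: (cf_inj cf); rewrite piE ra rb ab.
    have XE : X = [set None].
      case/imsetP: (XP) NX => x _ XE; rewrite XE -eq_porbit_mem => /eqP <-.
      by rewrite porbit_fix.
    by rewrite gX XE cards1 big_set1 /= /exchange_sign ra rb ab eqxx.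
  rewrite (orbit_parity XP Xa) ?NX; last by exists a, b.
  rewrite /exchange_sign ra rb /lo /hi.
  have -> : a != b by apply: contraTneq ab => ->; rewrite ltnn.
  by rewrite !andTb oddb.
have -> : odd_perm pi = odd (\sum_(X in porbits pi) #|X|.+1).
  have -> : (\sum_(X in porbits pi) #|X|.+1 = #|{: option (gW G)}| + #|porbits pi|)%N.
    rewrite -[X in (X + _)%N]sum1_card -(spN (fun=> 1%N)) /= -sum1_card -big_split /=.
    by apply: eq_bigr => X _; rewrite -addn1 sum1_card.
  by rewrite oddD.
rewrite (odd_sum key) big_split /= oddD; congr (odd _ (+) _).
  rewrite spN (bigD1 None) //= add0n.
  rewrite (reindex_omap Some id) /=; last by case.
  by apply: eq_bigl => w; rewrite eqxx.
rewrite -big_distrl /= oddM oddb.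
have -> : (\sum_(X in porbits pi) (None \in X) = 1)%N.
  rewrite (bigD1 (porbit pi None)) /=; last exact: porbit_in_porbits.
  rewrite porbit_id big1 // => X /andP[/imsetP[x _ ->]].
  by rewrite eq_sym eq_porbit_mem => /negbTE->.
by [].
Qed.

End Pair.

Lemma desc_unique_white e e' : desc e = 1%N -> desc e' = 1%N -> ew G e = ew G e' -> e = e'.
Proof.
move=> d1 d2 E; apply/eqP; apply: contraT => ne.
have := sum_desc_star (v := inr (ew G e)) isT.
rewrite (bigD1 e) /= ?inE // (bigD1 e') /=; last by rewrite inE -E eqxx eq_sym.
by rewrite d1 d2.
Qed.

Lemma desc_unique_black e e' : desc e = 1%N -> desc e' = 1%N -> eb G e = eb G e' -> e = e'.
Proof.
move=> d1 d2 E; case: (boolP (isBndB (eb G e))) => [/isBndBP[i ei]|nb].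
  by rewrite (bedge_uniq hG ei) (bedge_uniq hG (etrans (esym E) ei)).
apply/eqP; apply: contraT => ne.
have := sum_desc_star (v := inl (eb G e)) nb.
rewrite (bigD1 e) /= ?inE // (bigD1 e') /=; last by rewrite inE -E eqxx eq_sym.
by rewrite d1 d2.
Qed.

Lemma desc_exists v : interior v -> exists2 e, e \in star v & desc e == 1%N.
Proof.
move=> iv; have := sum_desc_star iv.
case: (pickP [pred e in star v | desc e == 1%N]) => [e /andP[h1 h2]|no]; first by exists e.
rewrite big1 // => e ev; have := no e; rewrite /= ev /= /desc.
by case: (_ <= _)%N.
Qed.

Lemma dmatch_ex w : exists e, (ew G e == w) && (desc e == 1%N).
Proof.
have [e] := desc_exists (v := inr w) isT; rewrite inE => ee de; exists e.
by rewrite ee.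
Qed.

Definition dmatch (w : gW G) : gE G := xchoose (dmatch_ex w).

Lemma dmatchP w : ew G (dmatch w) = w /\ desc (dmatch w) = 1%N.
Proof. by have /andP[/eqP h1 /eqP h2] := xchooseP (dmatch_ex w). Qed.

Definition dset : {set 'I_n} := [set i | (sig i <= i)%N].

Lemma dmatch_config : config dset None dmatch.
Proof.
split.
- by move=> w; case: (dmatchP w).
- move=> [w|] [w'|] //= [E]; have [h1 h2] := dmatchP w; have [h1' h2'] := dmatchP w'.
  by congr Some; rewrite -h1 -h1' (desc_unique_black h2 h2' E).
- move=> b; apply/codomP/orP => [[[w|] //= [->]]|].
    case: (boolP (isBndB (eb G (dmatch w)))) => [/isBndBP[i ei]|]; [right|by left].
    apply/exists_inP; exists i; last by rewrite ei.
    have [_] := dmatchP w; rewrite (bedge_uniq hG ei) (desc_bedge hL) inE /wexc.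
    by case: (_ <= _)%N.
  case=> [nb|/exists_inP[i]].
    have [e] := desc_exists (v := inl b) nb; rewrite inE => /eqP ee /eqP de.
    exists (Some (ew G e)); have [h1 h2] := dmatchP (ew G e).
    by rewrite /= (desc_unique_white h2 de h1) ee.
  rewrite inE => di /eqP ->; exists (Some (ew G (bedge hG i))).
  have [h1 h2] := dmatchP (ew G (bedge hG i)).
  have de : desc (bedge hG i) = 1%N by rewrite (desc_bedge hL) /wexc di.
  by rewrite /= (desc_unique_white h2 de h1) eb_bedge.
Qed.

Lemma bmap_perm J r r' m m' : config J r m -> config J r' m' ->
  (r = None <-> r' = None) ->
  exists pi : {perm option (gW G)}, forall x, bmap r m (pi x) = bmap r' m' x.
Proof.
move=> cf cf' rr.
have ex x : exists y, bmap r m y == bmap r' m' x.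
  case E : (bmap r' m' x) => [b|].
    have : Some b \in codom (bmap r m) by rewrite (cf_im cf) -(cf_im cf') -E codom_f.
    by case/codomP=> y ->; exists y.
  case: x E => [w|] //= E; exists None; rewrite /= (_ : r = None) //; apply/rr.
  by case: (r') E.
pose f x := xchoose (ex x).
have fE x : bmap r m (f x) = bmap r' m' x by apply/eqP/(xchooseP (ex x)).
have f_inj : injective f by move=> x y E; apply: (cf_inj cf'); rewrite -!fE E.
by exists (perm f_inj) => x; rewrite permE.
Qed.

(* An alternating cycle through the descent matching would contradict [orbit_parity]. *)
Lemma dmatch_unique m' : config dset None m' -> m' =1 dmatch.
Proof.
move=> cf' w; have cf := dmatch_config.
have [pi piE] := bmap_perm cf cf' (conj id id).
apply/eqP; apply: contraT => ne.
have pN : pi None = None by apply: (cf_inj cf); rewrite piE.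
pose X := porbit pi (Some w).
have XP : X \in porbits pi by apply: porbit_in_porbits.
have Xa v : Some v \in X -> dmatch v != m' v.
  move=> vX; apply/eqP => E; have pv := pi_fix cf piE E.
  move: vX; rewrite -eq_porbit_mem porbit_fix // => /eqP/setP/(_ (Some w)).
  rewrite inE porbit_id => /eqP[wv].
  by move: ne; rewrite wv E eqxx.
have NX : None \notin X.
  apply/negP; rewrite -eq_porbit_mem porbit_fix // => /eqP/setP/(_ (Some w)).
  by rewrite inE porbit_id.
have := orbit_parity cf cf' piE XP Xa; rewrite (negbTE NX) => /(_ (fun x => False_ind _ (Bool.diff_false_true x))).
rewrite /= addbF.
(* Each white vertex has one descent, taken by [dmatch] and so missed by [m'] on the orbit. The
   descents number [#|X|], whereas the parity asks for [#|X| + 1]. *)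
have -> : (\sum_(v | Some v \in X) (desc (dmatch v) + desc (m' v)) = #|X|)%N.
  rewrite -sum1_card [RHS]big_mkcond (bigD1 None) //= (negbTE NX) add0n -big_mkcondr /=.
  rewrite [RHS](reindex_omap Some id) /=; last by case.
  apply: eq_big => v; first by rewrite eqxx andbT.
  move=> vX; have [h1 h2] := dmatchP v; rewrite h2.
  have : desc (m' v) <> 1%N.
    move=> d1; move: (Xa v vX); rewrite (desc_unique_white h2 d1) ?eqxx // h1.
    by rewrite (cf_ew cf').
  by rewrite /desc; case: (_ <= _)%N.
by case: (odd _).
Qed.

End Kasteleyn.

(** * Linear relations between the boundary measurements *)

Lemma odd_perm_conj (T T' : finType) (f : T -> T') (s : {perm T}) (t : {perm T'}) :
  bijective f -> (forall x, f (s x) = t (f x)) -> odd_perm s = odd_perm t.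
Proof.
move=> bf H; have f_inj := bij_inj bf; rewrite /odd_perm (bij_eq_card bf).
have orb x : f @: porbit s x = porbit t (f x).
  have E m : f ((s ^+ m)%g x) = (t ^+ m)%g (f x).
    by elim: m => [|m IH]; rewrite ?expg0 ?perm1 // !expgSr !permM H IH.
  apply/setP=> y; apply/imsetP/porbitP => [[z /porbitP[m ->] ->]|[m ->]].
    by exists m; rewrite E.
  by exists ((s ^+ m)%g x); rewrite ?mem_porbit ?E.
have -> : porbits t = (fun A : {set T} => f @: A) @: porbits s.
  apply/setP=> Y; apply/imsetP/imsetP => [[y _ ->]|[_ /imsetP[x _ ->] ->]].
    have [g _ gK] := bf; exists (porbit s (g y)); first exact: porbit_in_porbits.
    by rewrite orb gK.
  by exists (f x); rewrite ?orb.
by rewrite card_imset //; apply: imset_inj.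
Qed.

Section Determinant.
Variables (n : nat) (G : pgraph n).
Hypothesis hG : disk_graph G.
Variable F : fieldType.
Variable wt : gE G -> F.

Definition DeltaW (I : {set 'I_n}) : F :=
  \sum_(A : {set gE G} | isAPM A && (usedB A == I)) \prod_(e in A) wt e.

Definition used_set (J : {set 'I_n}) (r : option 'I_n) := if r is Some j then J :\ j else J.

Lemma config_apm J r (m : {ffun gW G -> gE G}) : config J r m ->
  isAPM (m @: [set: gW G]) && (usedB (m @: [set: gW G]) == used_set J r).
Proof.
move=> cf; have bnd_inj : injective (bnd G) := proj1 hG.
have m_inj : injective m by move=> w w' E; rewrite -(cf_ew cf w) E (cf_ew cf).
have eb_inj w w' : eb G (m w) = eb G (m w') -> w = w'.
  by move=> E; have := @cf_inj _ _ _ _ _ cf (Some w) (Some w'); rewrite /= E => /(_ erefl)[].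
apply/andP; split.
  apply/andP; split; apply/forallP => x.
    have le1 : (#|[set e in m @: [set: gW G] | eb G e == x]| <= 1)%N.
      apply/card_le1_eqP => e e'; rewrite !inE => /andP[/imsetP[w _ ->] /eqP E] /andP[/imsetP[w' _ ->] /eqP E'].
      by rewrite (eb_inj w w') // E.
    case: ifP => // /negbT nx; rewrite eqn_leq le1 card_gt0; apply/set0Pn.
    have : Some x \in codom (bmap r m) by rewrite (cf_im cf) nx.
    case/codomP=> -[w|] /=; last by case: (r) => //= i [E]; move: nx; rewrite E /isBndB codom_f.
    by case=> ->; exists (m w); rewrite inE imset_f ?inE ?eqxx.
  apply/eqP; rewrite (_ : [set e in _ | _] = [set m x]) ?cards1 //; apply/setP=> e.
  rewrite !inE; apply/andP/eqP => [[/imsetP[w _ ->]]|->].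
    by rewrite (cf_ew cf) => /eqP->.
  by rewrite imset_f ?inE // (cf_ew cf) eqxx.
apply/eqP/setP=> i; rewrite inE; apply/exists_inP/idP => [[_ /imsetP[w _ ->] /eqP E]|].
  have : Some (bnd G i) \in codom (bmap r m) by apply/codomP; exists (Some w); rewrite /= E.
  rewrite (cf_im cf) /isBndB codom_f /= => /exists_inP[j jJ /eqP/bnd_inj ij].
  rewrite /used_set; case rE : r => [a|]; last by rewrite ij.
  rewrite in_setD1 ij jJ andbT; apply/eqP => ja; subst a.
  suff : Some w = None by [].
  by apply: (cf_inj cf); rewrite rE /= E ij.
move=> iU; have iJ : i \in J by move: iU; rewrite /used_set; case: (r) => // a; rewrite in_setD1 => /andP[].
have : Some (bnd G i) \in codom (bmap r m).
  by rewrite (cf_im cf); apply/orP; right; apply/exists_inP; exists i.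
case/codomP=> -[w|] /=; first by case=> ->; exists (m w); rewrite ?imset_f ?inE.
move: iU; rewrite /used_set; case: (r) => //= a; rewrite in_setD1 => /andP[ia _] [/bnd_inj E].
by rewrite E eqxx in ia.
Qed.

Lemma apm_config (J : {set 'I_n}) (r : option 'I_n) (A : {set gE G}) : (if r is Some j then j \in J else true) ->
  isAPM A -> usedB A = used_set J r ->
  exists2 m : {ffun gW G -> gE G}, config J r m & A = m @: [set: gW G].
Proof.
move=> rJ /andP[/forallP apB /forallP apW] uA; have bnd_inj : injective (bnd G) := proj1 hG.
have exm w : exists e, (e \in A) && (ew G e == w).
  have /cards1P[e eE] := apW w; exists e.
  by have := set11 e; rewrite -eE inE.
pose m := [ffun w => xchoose (exm w)].
have mP w : m w \in A /\ ew G (m w) = w.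
  by rewrite ffunE; have /andP[h1 /eqP h2] := xchooseP (exm w).
have mU e : e \in A -> e = m (ew G e).
  move=> eA; have [h1 h2] := mP (ew G e); have /cards1P[e0 eE] := apW (ew G e).
  have : e \in [set e1 in A | ew G e1 == ew G e] by rewrite inE eA eqxx.
  have : m (ew G e) \in [set e1 in A | ew G e1 == ew G e] by rewrite inE h1 h2 eqxx.
  by rewrite eE !inE => /eqP-> /eqP->.
have apB1 b : (#|[set e in A | eb G e == b]| <= 1)%N.
  by have := apB b; case: ifP => // _ /eqP->.
have usedE i w : eb G (m w) = bnd G i -> i \in used_set J r.
  move=> E; rewrite -uA inE; apply/exists_inP; exists (m w); first by case: (mP w).
  by rewrite E.
exists m; last first.
  apply/setP=> e; apply/idP/imsetP => [eA|[w _ ->]]; last by case: (mP w).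
  by exists (ew G e); rewrite ?inE // -mU.
split.
- by move=> w; case: (mP w).
- move=> [w|] [w'|] //=.
  + case=> E; congr Some; have [h1 h2] := mP w; have [h1' h2'] := mP w'.
    rewrite -h2 -h2'; congr (ew G _); have /card_le1_eqP := apB1 (eb G (m w')).
    by move=> /(_ (m w') (m w)); apply; rewrite in_set ?h1 ?h1' ?E eqxx.
  + move=> E; exfalso; move: E; case rE : r => [a|] //= [/usedE].
    by rewrite rE /used_set in_setD1 eqxx.
  + move=> E; exfalso; move: E; case rE : r => [a|] //= [/esym/usedE].
    by rewrite rE /used_set in_setD1 eqxx.
- move=> b; apply/codomP/orP => [[[w|] /=]|].
  + case=> ->; case: (boolP (isBndB (eb G (m w)))) => [/isBndBP[i ei]|]; [right|by left].
    apply/exists_inP; exists i; last by rewrite ei.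
    by have := usedE i w ei; rewrite /used_set; case: (r) => // a; rewrite in_setD1 => /andP[].
  + move: rJ; case: (r) => //= a aJ [->]; right; apply/exists_inP; exists a => //.
  + case=> [nb|/exists_inP[i iJ /eqP ->]].
      have := apB b; rewrite (negbTE nb) => /cards1P[e eE].
      have : e \in [set e in A | eb G e == b] by rewrite eE inE.
      rewrite inE => /andP[eA /eqP be]; exists (Some (ew G e)).
      by rewrite /= -(mU e eA) be.
    case: (boolP (i \in used_set J r)) => [|niU].
      rewrite -uA inE => /exists_inP[e eA /eqP be]; exists (Some (ew G e)).
      by rewrite /= -(mU e eA) be.
    exists None; move: niU; rewrite /used_set; case: (r) => [a|] /=; last by rewrite iJ.
    by rewrite in_setD1 iJ andbT negbK => /eqP->.
Qed.

Lemma DeltaW_config (J : {set 'I_n}) (r : option 'I_n) : (if r is Some j then j \in J else true) ->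
  DeltaW (used_set J r) = \sum_(m : {ffun gW G -> gE G} | `[< config J r m >]) \prod_w wt (m w).
Proof.
move=> rJ; rewrite /DeltaW.
pose S := [set m : {ffun gW G -> gE G} | `[< config J r m >]].
have imE (m : {ffun gW G -> gE G}) : m \in S -> injective m.
  by rewrite inE => /asboolP cf w w' E; rewrite -(cf_ew cf w) E (cf_ew cf).
transitivity (\sum_(A in [set m @: [set: gW G] | m : {ffun gW G -> gE G} in S]) \prod_(e in A) wt e).
  apply: eq_bigl => A; apply/andP/imsetP => [[apA /eqP uA]|[m]].
    have [m cf AE] := apm_config rJ apA uA; exists m => //.
    by rewrite inE; apply/asboolP.
  by rewrite inE => /asboolP cf ->; apply/andP; apply: config_apm.
rewrite big_imset /=; last first.
  move=> m m' mS m'S E; apply/ffunP=> w.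
  have : m w \in m' @: [set: gW G] by rewrite -E imset_f ?inE.
  case/imsetP=> w' _ mm; move: mS m'S; rewrite !inE => /asboolP cf /asboolP cf'.
  by rewrite mm; congr (m' _); rewrite -(cf_ew cf w) mm (cf_ew cf').
apply: eq_big => [m|m mS]; first by rewrite inE.
rewrite big_imset /=; last by move=> w w' _ _; apply: imE.
by apply: eq_bigl => w; rewrite inE.
Qed.

End Determinant.

Lemma big_option (R : Type) (idx : R) (op : Monoid.com_law idx) (T : finType) (F : option T -> R) :
  \big[op/idx]_x F x = op (F None) (\big[op/idx]_t F (Some t)).
Proof.
rewrite (bigD1 None) //=; congr (op _ _).
rewrite (reindex_omap Some id) /=; last by case.
by apply: eq_bigl => t; rewrite eqxx.
Qed.

(** * A vanishing Kasteleyn determinant *)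

Section Relation.
Variables (n : nat) (G : pgraph n).
Hypothesis hG : disk_graph G.
Variables (sig : 'I_n -> 'I_n) (p q : gE G -> 'I_n).
Hypothesis hL : labelling hG sig p q.
Hypothesis label_neq : forall e, ~~ isBndB (eb G e) -> q e != p e.
Hypothesis sum_desc_star : forall v, interior v -> (\sum_(e in star v) desc p q e = 1)%N.
Local Notation desc := (desc p q).
Variable F : fieldType.
Variables (wt : gE G -> F) (J : {set 'I_n}) (v : 'I_n -> F) (g : gW G -> F).
Hypothesis g_interior : forall b, ~~ isBndB b ->
  \sum_(e | eb G e == b) (-1) ^+ desc e * wt e * g (ew G e) = 0.
Hypothesis g_bnd : forall j,
  (-1) ^+ desc (bedge hG j) * wt (bedge hG j) * g (ew G (bedge hG j)) = v j.

Let N := #|{: option (gW G)}|.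
Definition cols : {set gB G} := [set b | ~~ isBndB b || [exists j in J, b == bnd G j]].
Hypothesis card_cols : N = #|cols|.

Let cv (i : 'I_N) : gB G := enum_val (cast_ord card_cols i).
Let rk (x : option (gW G)) : 'I_N := enum_rank x.

Let cv_inj : injective cv.
Proof. by move=> i j /enum_val_inj/cast_ord_inj. Qed.
Let cv_cols i : cv i \in cols.
Proof. exact: enum_valP. Qed.
Let cv_surj b : b \in cols -> exists i, cv i = b.
Proof.
move=> bX; exists (cast_ord (esym card_cols) (enum_rank_in bX b)).
by rewrite /cv cast_ordKV enum_rankK_in.
Qed.

Let entry (x : option (gW G)) (b : gB G) : F :=
  match x with
  | Some w => \sum_(e | (ew G e == w) && (eb G e == b)) (-1) ^+ desc e * wt e
  | None => \sum_(j in J | bnd G j == b) v j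
  end.
Let M : 'M[F]_N := \matrix_(i, j) entry (enum_val i) (cv j).

Let det_M : \det M = 0.
Proof.
(* The left kernel vector: [g] on the white vertices and [-1] on the virtual one, whose row [v]
   equals the combination of the other rows at the boundary columns. *)
apply/eqP/det0P; pose u (x : option (gW G)) : F := if x is Some w then g w else -1.
exists (\row_i u (enum_val i)).
  apply/eqP => /rowP/(_ (rk None)); rewrite !mxE enum_rankK /= => /eqP.
  by rewrite oppr_eq0 oner_eq0.
apply/rowP=> j; rewrite !mxE.
rewrite (reindex (@enum_rank _)) /=; last exact: onW_bij (enum_rank_bij _).
rewrite (eq_bigr (fun x => u x * entry x (cv j))); last by move=> x _; rewrite !mxE enum_rankK.
rewrite big_option /= mulN1r addrC; apply/eqP; rewrite subr_eq0; apply/eqP.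
transitivity (\sum_(e | eb G e == cv j) (-1) ^+ desc e * wt e * g (ew G e)).
  rewrite [RHS](partition_big (ew G) predT) //=; apply: eq_bigr => w _.
  rewrite mulr_sumr; apply: eq_big => e; first by rewrite andbC.
  by case/andP=> /eqP-> _; rewrite mulrC.
have := cv_cols j; rewrite inE => /orP[nb|/exists_inP[i iJ /eqP ->]].
  rewrite g_interior // big1 // => i /andP[_ /eqP E].
  by move: nb; rewrite -E /isBndB codom_f.
rewrite (bigD1 i) /=; last by rewrite iJ eqxx.
rewrite [X in _ + X]big1 ?addr0; last by move=> i' /andP[/andP[_ /eqP E] ni]; rewrite (proj1 hG _ _ E) eqxx in ni.
rewrite (big_pred1 (bedge hG i)) ?g_bnd // => e /=.
by apply/eqP/eqP => [/(bedge_uniq hG)|->]; rewrite ?eb_bedge.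
Qed.

Definition placed (s : {perm 'I_N}) (j : 'I_n) (m : {ffun gW G -> gE G}) : bool :=
  [forall w, ew G (m w) == w] && [forall x, Some (cv (s (rk x))) == bmap (Some j) m x].

Let placed_config s j m : placed s j m -> config J (Some j) m.
Proof.
case/andP=> /forallP mw /forallP sx; split.
- by move=> w; apply/eqP.
- by move=> x y; rewrite -(eqP (sx x)) -(eqP (sx y)) => -[/cv_inj/perm_inj/enum_rank_inj].
- move=> b; have -> : ~~ isBndB b || [exists j0 in J, b == bnd G j0] = (b \in cols) by rewrite inE.
  apply/codomP/idP => [[x]|/cv_surj[i <-]]; first by rewrite -(eqP (sx x)) => -[->].
  by exists (enum_val ((s^-1)%g i)); rewrite -(eqP (sx _)) /rk enum_valK permKV.
Qed.

Let config_placed j (m : {ffun gW G -> gE G}) : config J (Some j) m -> exists2 s, placed s j m & forall s', placed s' j m -> s' = s.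
Proof.
move=> cf; have ex (i : 'I_N) : exists k, Some (cv k) == bmap (Some j) m (enum_val i).
  case E : (bmap (Some j) m (enum_val i)) => [b|]; last by case: (enum_val i) E.
  have bX : b \in cols by rewrite inE -(cf_im cf) -E codom_f.
  by have [k kb] := cv_surj bX; exists k; rewrite kb.
pose f (i : 'I_N) := xchoose (ex i).
have fE (i : 'I_N) : Some (cv (f i)) = bmap (Some j) m (enum_val i) by apply/eqP/(xchooseP (ex i)).
have f_inj : injective f.
  by move=> i i' E; apply: enum_val_inj; apply: (cf_inj cf); rewrite -!fE E.
exists (perm f_inj).
  apply/andP; split; apply/forallP => x; first by rewrite (cf_ew cf).
  by rewrite permE fE /rk enum_rankK.
move=> s' /andP[_ /forallP H]; apply/permP=> i; rewrite permE.
have := eqP (H (enum_val i)); rewrite -fE /rk enum_valK => -[].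
by move/cv_inj.
Qed.

(** A primitive of [exchange_sign]: its difference between two indices of [J] is, modulo 2, the sign
    of moving the virtual edge from one to the other. *)
Definition col_sign (j : 'I_n) : nat :=
  (#|[set i in J | (i < j)%N]| + \sum_(i < n | (i <= j)%N) wexc sig i)%N.

Let placed_sign s s' j j' m m' : placed s j m -> placed s' j' m' -> (j <= j')%N -> j \in J -> 
  odd (s + \sum_w desc (m w) + col_sign j) = odd (s' + \sum_w desc (m' w) + col_sign j').
Proof.
move=> P P' jj jJ; have cf := placed_config P; have cf' := placed_config P'.
have [pi piE] : exists pi : {perm option (gW G)}, forall x, bmap (Some j) m (pi x) = bmap (Some j') m' x.
  by apply: bmap_perm cf cf' _.
have := kasteleyn_sign hL label_neq sum_desc_star cf cf' piE.
move/(_ (or_intror (ex_intro _ j (ex_intro _ j' (And3 erefl erefl jj))))).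
have -> : odd_perm pi = odd_perm (s' * s^-1)%g.
  apply: (odd_perm_conj (f := rk)); first exact: enum_rank_bij.
  move=> x; rewrite permM; apply: (@perm_inj _ s); rewrite permKV; apply: cv_inj.
  case/andP: P => _ /forallP/(_ (pi x))/eqP; case/andP: P' => _ /forallP/(_ x)/eqP.
  by rewrite piE => <- [].
rewrite odd_permM odd_permV big_split /= oddD /exchange_sign => E.
have eE : odd (col_sign j') = odd (col_sign j) (+) ((j != j') &&
   odd (#|[set i in J | (j < i < j')%N]| + \sum_(i < n | (j < i <= j')%N) wexc sig i).+1).
  have [<-|ne] := eqVneq j j'; first by rewrite addbF.
  have lt : (j < j')%N by rewrite ltn_neqAle jj andbT; apply: contra ne => /eqP/val_inj->.
  rewrite -oddD /col_sign.
  have -> : #|[set i in J | (i < j')%N]| = (#|[set i in J | (i < j)%N]| + 1 + #|[set i in J | (j < i < j')%N]|)%N.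
    rewrite -(cards1 j) -!sum1_card [LHS]big_mkcond [X in (X + _ + _)%N]big_mkcond [X in (_ + X + _)%N]big_mkcond [X in (_ + _ + X)%N]big_mkcond -!big_split /=.
    apply: eq_bigr => i _; rewrite !inE; case: (eqVneq i j) => [->|ij].
      by rewrite jJ lt ltnn.
    have ij' : nat_of_ord i <> j by move/val_inj => h; rewrite h eqxx in ij.
    case: (i \in J) => //=; move: ij' lt.
    move: (nat_of_ord i) (nat_of_ord j) (nat_of_ord j') => a b c ab bc.
    by case: (ltngtP a b) => // h; rewrite (ltn_trans h bc).
  have -> : (\sum_(i < n | (i <= j')%N) wexc sig i = \sum_(i < n | (i <= j)%N) wexc sig i +
      \sum_(i < n | (j < i <= j')%N) wexc sig i)%N.
    rewrite [LHS]big_mkcond [X in (X + _)%N]big_mkcond [X in (_ + X)%N]big_mkcond -big_split; apply: eq_bigr => i _.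
    case: (leqP i j) => h /=; last by rewrite add0n.
    by rewrite (leq_trans h jj) addn0.
  by congr odd; rewrite addn1 addnS !addSn addnACA.
move: E eE; set x := (j != j') && _; move: x (col_sign j) (col_sign j') => x cj cj' E eE.
rewrite !oddD eE; move: E; rewrite !oddb.
by case: (odd_perm s); case: (odd_perm s'); case: x {eE}; do 3!case: (odd _).
Qed.

Let exists_sign : exists2 C : F, C != 0 & forall s j m, j \in J -> placed s j m ->
  (-1) ^+ (s + \sum_w desc (m w)) = C * (-1) ^+ col_sign j.
Proof.
case: (pickP [pred t : {perm 'I_N} * 'I_n * {ffun gW G -> gE G} | (t.1.2 \in J) && placed t.1.1 t.1.2 t.2]).
  move=> [[s0 j0] m0] /= /andP[j0J P0].
  exists ((-1) ^+ (s0 + \sum_w desc (m0 w) + col_sign j0)); first by rewrite signr_eq0.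
  move=> s j m jJ P; rewrite -exprD -[LHS]signr_odd -[RHS]signr_odd; congr (_ ^+ nat_of_bool _).
  have : odd (s + \sum_w desc (m w) + col_sign j) = odd (s0 + \sum_w desc (m0 w) + col_sign j0).
    by case: (leqP j j0) => h; [apply: placed_sign | apply/esym/placed_sign => //; apply: ltnW].
  by move=> H; rewrite [RHS]oddD -H [X in X (+) _]oddD addbK.
move=> no; exists 1; first exact: oner_neq0.
by move=> s j m jJ P; have := no (s, j, m); rewrite /= jJ P.
Qed.

(** The determinant of the signed adjacency matrix, enlarged by the virtual row [v], is zero. In its
    expansion a nonzero term is a matching with a choice of [j], and the Kasteleyn sign makes all
    signs agree up to [col_sign j] and a common constant. *)
Lemma delta_relation : \sum_(j in J) (-1) ^+ col_sign j * v j * DeltaW wt (J :\ j) = 0.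
Proof.
have [C C0 CE] := exists_sign; apply: (mulfI C0); rewrite mulr0 -[RHS]det_M.
pose W (m : {ffun gW G -> gE G}) := \prod_w ((-1) ^+ desc (m w) * wt (m w)).
have WE m : W m = (-1) ^+ (\sum_w desc (m w)) * \prod_w wt (m w).
  by rewrite /W big_split /= expr_sum.
have -> : \det M = \sum_(s : 'S_N) \sum_(j in J) \sum_(m : {ffun gW G -> gE G} | placed s j m) (-1) ^+ s * v j * W m.
  apply: eq_bigr => s _.
  rewrite (reindex (@enum_rank _)) /=; last exact: onW_bij (enum_rank_bij _).
  rewrite (eq_bigr (fun x => entry x (cv (s (rk x))))); last by move=> x _; rewrite !mxE enum_rankK.
  rewrite big_option /=.
  rewrite (bigA_distr_big_dep (fun w e => (ew G e == w) && (eb G e == cv (s (rk (Some w))))) (fun w e => (-1) ^+ desc e * wt e)) /=.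
  rewrite big_mkcondr /= mulr_suml mulr_sumr; apply: eq_bigr => j jJ.
  case: ifP => [bj|nbj]; last first.
    rewrite mul0r mulr0 big1 // => m /andP[_ /forallP/(_ None)] /= /eqP[] E.
    by rewrite E eqxx in nbj.
  rewrite mulrA mulr_sumr; apply: eq_bigl => m; apply/familyP/andP => [H|[/forallP h1 /forallP h2] w].
    split; apply/forallP; first by move=> w; have := H w; rewrite unfold_in => /andP[].
    move=> [w|] /=; last by rewrite (eqP bj).
    by have := H w; rewrite unfold_in => /andP[_ /eqP->].
  rewrite unfold_in h1 /=; have := eqP (h2 (Some w)) => -[->].
  by rewrite eqxx.
rewrite exchange_big /= mulr_sumr; apply: eq_bigr => j jJ.
have := DeltaW_config hG wt (J := J) (r := Some j) jJ; rewrite /= => ->.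
rewrite (exchange_big_dep (fun m : {ffun gW G -> gE G} => `[< config J (Some j) m >])) /=; last first.
  by move=> s m _ P; apply/asboolP; apply: placed_config P.
rewrite !mulr_sumr; apply: eq_bigr => m /asboolP cf.
have [s P U] := config_placed cf; rewrite (big_pred1 s); last first.
  by move=> s'; apply/idP/eqP => [/U|->].
have := CE s j m jJ P; rewrite exprD WE => E.
transitivity ((C * (-1) ^+ col_sign j) * (v j * \prod_w wt (m w))); first by ring.
by rewrite -E mulrACA.
Qed.

End Relation.

(** * Linear algebra *)

Section IncreasingEnum.
Variables (n : nat) (i0 : 'I_n).

Definition increasing (k : nat) (s : 'I_k -> 'I_n) := forall a b : 'I_k, (a < b)%N -> (s a < s b)%N.

Definition inc_enum (k : nat) (I : {set 'I_n}) (a : 'I_k) : 'I_n := nth i0 (enum I) a.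

Let ltord : rel 'I_n := fun x y => (x < y)%N.

Lemma enum_set_sorted (I : {set 'I_n}) : sorted ltord (enum I).
Proof.
rewrite {1}/enum_mem -enumT; apply: sorted_filter; first by move=> x y z; apply: ltn_trans.
by have := iota_ltn_sorted 0 n; rewrite -val_enum_ord sorted_map.
Qed.

Lemma inc_enum_incr k (I : {set 'I_n}) : #|I| = k -> increasing (inc_enum (k := k) I).
Proof.
move=> cI a b ab; have tr : transitive ltord by move=> x y z; apply: ltn_trans.
have := sorted_ltn_nth tr i0 (enum_set_sorted I).
by apply; rewrite // inE -cardE cI.
Qed.

Lemma increasing_inj k (s : 'I_k -> 'I_n) : increasing s -> injective s.
Proof.
move=> H a b E; apply: val_inj => /=; case: (ltngtP a b) => // /H; rewrite E ltnn //.
Qed.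

Lemma inc_enum_image k (s : 'I_k -> 'I_n) : increasing s ->
  inc_enum (k := k) [set s a | a : 'I_k] =1 s.
Proof.
move=> H a; rewrite /inc_enum.
have -> : enum [set s a | a : 'I_k] = map s (enum 'I_k).
  apply: (@irr_sorted_eq _ ltord).
  - by move=> x y z; apply: ltn_trans.
  - by move=> x; apply: ltnn.
  - exact: enum_set_sorted.
  - rewrite sorted_map; have := iota_ltn_sorted 0 k; rewrite -val_enum_ord sorted_map.
    by apply: sub_sorted => x y; apply: H.
  - move=> x; rewrite mem_enum; apply/imsetP/mapP => -[b _ ->]; exists b => //.
    by rewrite mem_enum.
by rewrite (nth_map a) ?size_enum_ord // nth_ord_enum.
Qed.

Lemma inc_enum_set k (I : {set 'I_n}) : #|I| = k -> [set inc_enum (k := k) I a | a : 'I_k] = I.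
Proof.
move=> cI; apply/eqP; rewrite eqEcard card_imset ?card_ord ?cI ?leqnn; last first.
  exact: increasing_inj (inc_enum_incr cI).
rewrite andbT; apply/subsetP=> _ /imsetP[a _ ->].
by rewrite /inc_enum -mem_enum mem_nth // -cardE cI.
Qed.

Lemma card_below k (s : 'I_k -> 'I_n) (a : 'I_k) : increasing s ->
  #|[set i in [set s b | b : 'I_k] | (i < s a)%N]| = a.
Proof.
move=> H; have -> : [set i in [set s b | b : 'I_k] | (i < s a)%N] = s @: [set b : 'I_k | (b < a)%N].
  apply/setP=> i; rewrite inE; apply/andP/imsetP => [[/imsetP[b _ ->] lt]|[b + ->]].
    exists b => //; rewrite inE ltnNge; apply/negP => ab.
    move: ab; rewrite leq_eqVlt => /orP[/eqP/val_inj ab|/H]; first by rewrite ab ltnn in lt.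
    by move=> /(ltn_trans lt); rewrite ltnn.
  by rewrite inE => /H; rewrite imset_f.
rewrite card_imset; last exact: increasing_inj.
have := sum_ltn_ord (ltnW (ltn_ord a)); rewrite sum_Posz => -[E]; rewrite -[RHS]E.
by rewrite -sum1_card big_mkcond /=; apply: eq_bigr => b _; rewrite inE; case: (b < a)%N.
Qed.

End IncreasingEnum.

(** * Minors characterised by wedge equations *)

Section Plucker.
Variables (F : fieldType) (n : nat) (i0 : 'I_n) (k : nat).
Implicit Types (M : 'M[F]_(k, n)) (D : {set 'I_n} -> F).

Definition minor M (I : {set 'I_n}) : F := \det (colsub (inc_enum i0 (k := k) I) M).

(* The coordinates of the exterior product of [v] with the [k]-vector [D] vanish. *)
Definition wedge_zero (v : 'rV[F]_n) D : Prop := forall J : {set 'I_n}, #|J| = k.+1 ->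
  \sum_(j in J) (-1) ^+ #|[set i in J | (i < j)%N]| * v 0 j * D (J :\ j) = 0.

Lemma wedge_zero_mul M D (u : 'rV[F]_k) : (forall i, wedge_zero (row i M) D) -> wedge_zero (u *m M) D.
Proof.
move=> H J cJ; have {}H i := H i J cJ.
transitivity (\sum_i u 0 i * \sum_(j in J) (-1) ^+ #|[set i in J | (i < j)%N]| * row i M 0 j * D (J :\ j)).
  rewrite (eq_bigr _ (fun i _ => mulr_sumr _ _ _ _)) exchange_big /=; apply: eq_bigr => j _.
  rewrite mxE mulr_sumr mulr_suml; apply: eq_bigr => i _; rewrite mxE; ring.
by rewrite big1 // => i _; rewrite H mulr0.
Qed.

Lemma wedge_zero_minor M i : wedge_zero (row i M) (minor M).
Proof.
move=> J cJ; pose s := inc_enum i0 (k := k.+1) J.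
have s_inc : increasing s := inc_enum_incr i0 cJ.
have sJ : [set s a | a : 'I_k.+1] = J := inc_enum_set i0 cJ.
rewrite -{1}sJ big_imset /=; last by move=> a b _ _; apply: increasing_inj.
pose A : 'M[F]_k.+1 := colsub s (col_mx (row i M : 'M_(1, n)) M : 'M_(k.+1, n)).
have detA : \det A = 0.
  apply: (@determinant_alternate _ _ _ (lshift k ord0) (rshift 1 i)) => [|b].
    by rewrite -val_eqE.
  by rewrite !mxE (unsplitK (inl ord0)) (unsplitK (inr i)) mxE.
rewrite -[RHS]detA (expand_det_row _ ord0); apply: eq_big => [//|a _].

rewrite -{1}sJ card_below // /cofactor.
have -> : A ord0 a = row i M 0 (s a).
  by rewrite -(col_mxEu (row i M) M ord0 (s a)) mxE; congr (col_mx _ _ _ _); apply: val_inj.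
rewrite /minor [in RHS]mulrCA -mulrA; congr (_ * (_ * \det _)).
have lift_inc : increasing (s \o lift a).
  move=> b c bc; apply: s_inc; rewrite /= /bump; move: bc.
  by case: (leqP a b); case: (leqP a c) => /=; lia.
have -> : J :\ s a = [set (s \o lift a) b | b : 'I_k].
  apply/setP=> x; rewrite in_setD1 -sJ; apply/andP/imsetP => [[xa /imsetP[c _ xc]]|[b _ ->]].
    have ca : a != c by apply: contra xa => /eqP->; rewrite xc.
    by have [b cb] := unlift_some ca; exists b; rewrite //= xc cb.
  split; last by apply: imset_f.
  by apply/eqP => /(increasing_inj s_inc) E; have := neq_lift a b; rewrite E eqxx.
apply/matrixP=> b c; rewrite [LHS]mxE 3![RHS]mxE (inc_enum_image i0 lift_inc) /=.
by rewrite -(col_mxEd (row i M) M b); congr (col_mx _ _ _ _); apply: val_inj.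
Qed.

Variables (M : 'M[F]_(k, n)) (I0 : {set 'I_n}).
Hypotheses (cI0 : #|I0| = k) (M0 : minor M I0 != 0).
Let e := inc_enum i0 (k := k) I0.
Let e_set : [set e a | a : 'I_k] = I0. Proof. exact: inc_enum_set. Qed.
Let unitM0 : colsub e M \in unitmx. Proof. by rewrite unitmxE unitfE. Qed.

Lemma interpolate_row (w : 'rV[F]_n) : exists u : 'rV[F]_k, forall i, i \in I0 -> (u *m M) 0 i = w 0 i.
Proof.
pose u := colsub e w *m invmx (colsub e M).
exists u => i; rewrite -e_set => /imsetP[a _ ->].
have : u *m colsub e M = colsub e w by rewrite /u mulmxKV.
move/rowP/(_ a); rewrite !mxE => <-; apply: eq_bigr => b _.
by rewrite !mxE.
Qed.

(** Induction on the distance of [I] from [I0]. For [j] in [I0] but not in [I], a row combination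
    equal to the unit vector [j] on [I0] yields an equation that expresses [D I] through sets in
    which [j] replaces an element of [I] outside [I0]. *)
Lemma wedge_zero_unique D : (forall i, wedge_zero (row i M) D) -> D I0 = 0 ->
  forall I : {set 'I_n}, #|I| = k -> D I = 0.
Proof.
move=> H D0 I; move: {2}#|I :\: I0| (leqnn #|I :\: I0|) => m.
elim: m I => [|m IH] I lem cI.
  have : I \subset I0 by rewrite -setD_eq0 -cards_eq0 -leqn0.
  by move=> sI; have -> : I = I0 by apply/eqP; rewrite eqEcard sI cI cI0 /=.
have [E|nE] := eqVneq I I0; first by rewrite E.
have [j jI0 jI] : exists2 j, j \in I0 & j \notin I.
  apply/subsetPn; apply: contra nE => sI; rewrite eq_sym eqEcard sI cI cI0 /=.
  by [].
have [u uE] := interpolate_row (delta_mx 0 j).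
have := wedge_zero_mul u H (J := j |: I); rewrite cardsU1 jI cI => /(_ erefl).
rewrite (bigD1 j) /=; last by rewrite setU11.
rewrite big1 ?addr0 => [|l /andP[lJ lj]].
  rewrite uE // mxE !eqxx mulr1 setU1K //; move/eqP; rewrite mulf_eq0 signr_eq0 /=.
  by move/eqP.
have lI : l \in I by move: lJ; rewrite in_setU1 (negbTE lj).
have [lI0|lI0] := boolP (l \in I0).
  by rewrite uE // mxE (negbTE lj) andbF mulr0 mul0r.
rewrite IH ?mulr0 //.
  rewrite -ltnS; apply: leq_trans lem; apply: proper_card; apply/properP; split.
    apply/subsetP=> x; rewrite !inE => /andP[xI0 /andP[_ /orP[/eqP xj|xI]]]; last by rewrite xI0.
    by rewrite xj jI0 in xI0.
  by exists l; rewrite !inE ?lI0 ?lI // eqxx andbF.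
have := cardsD1 l (j |: I); rewrite in_setU1 lI orbT cardsU1 jI cI /=.
by rewrite !add1n => -[].
Qed.

(** Subtract the row combination that agrees with [v] on [I0]. In the wedge equation for [I0] and
    one further index [j], only the term of [j] survives, with the nonzero coefficient
    [minor M I0]. *)
Lemma wedge_zero_span v : wedge_zero v (minor M) -> (v <= M)%MS.
Proof.
move=> H; have [u uE] := interpolate_row v.
apply/submxP; exists u; apply/rowP=> j; apply/esym.
have [jI0|jI0] := boolP (j \in I0); first exact: uE.
have HM := wedge_zero_mul u (wedge_zero_minor M) (J := j |: I0).
have := H (j |: I0); rewrite cardsU1 jI0 cI0 in HM *.
move=> /(_ erefl) E1; have E2 := HM erefl.
have : \sum_(l < n | l \in j |: I0) (-1) ^+ #|[set i in j |: I0 | (i < l)%N]| * ((u *m M) 0 l - v 0 l) * minor M ((j |: I0) :\ l) = 0.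
  rewrite (eq_bigr (fun l : 'I_n => (-1) ^+ #|[set i in j |: I0 | (i < l)%N]| * (u *m M) 0 l * minor M ((j |: I0) :\ l)
    - (-1) ^+ #|[set i in j |: I0 | (i < l)%N]| * v 0 l * minor M ((j |: I0) :\ l))); last by move=> l _; ring.
  by rewrite sumrB E1 E2 subrr.
rewrite (bigD1 j) /=; last by rewrite setU11.
rewrite big1 ?addr0 => [|l /andP[lJ lj]].
  move/eqP; rewrite setU1K // !mulf_eq0 signr_eq0 (negbTE M0) orbF /= subr_eq0.
  by move/eqP.
by rewrite uE ?subrr ?mulr0 ?mul0r //; move: lJ; rewrite in_setU1 (negbTE lj).
Qed.

Lemma rank_minor : \rank M = k.
Proof.
apply/eqP; rewrite -[_ == _]/(row_free M) -kermx_eq0; apply/rowV0P => u /sub_kermxP uM.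
have : u *m colsub e M = 0.
  apply/rowP=> a; move/rowP/(_ (e a)): uM; rewrite !mxE => E.
  by rewrite -[RHS]E; apply: eq_bigr => b _; rewrite !mxE.
by move/(congr1 (mulmx^~ (invmx (colsub e M)))); rewrite mulmxK // mul0mx.
Qed.

End Plucker.

(** * Critical weights *)

Section StrandLabels.
Variables (k n : nat) (f : int -> int) (G : pgraph n).
Hypothesis hf : bounded_affine_perm k n f.
Hypothesis hG : disk_graph G.
Hypothesis sp : strand_perm_is G f.

Definition strand_target (i : 'I_n) : 'I_n := odflt i (strandEnd (bedge hG i, true)).
Local Notation sig := strand_target.

Lemma strandEnd_target i : strandEnd (bedge hG i, true) = Some (sig i).
Proof. by have [j [E _]] := sp (eb_bedge hG i); rewrite /sig E. Qed.

Lemma f_alift (i : 'I_n) : f (i.+1)%:Z = (alift sig i).+1%:Z.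
Proof.
have [j [E ->]] := sp (eb_bedge hG i).
have -> : alift sig i = (j + n * (j <= i))%N by rewrite /alift /wexc /sig E.
have ji := ltn_ord j; have ii := ltn_ord i.
case: leqP => ji'.
  have -> : (j%:Z - i%:Z - 1 = (-1) * n%:Z + (j%:Z - i%:Z - 1 + n%:Z)) by lia.
  by rewrite modzMDl modz_small; lia.
by rewrite modz_small; lia.
Qed.

Lemma lab_labelling (x0 : 'I_n) : labelling hG sig
  (fun e => lab x0 (e, false)) (fun e => lab x0 (e, true)).
Proof.
split.
- exact: sig_injective hf f_alift.
- by move=> e; rewrite /lab strandEnd_white.
- by move=> e ne; rewrite /lab -strandEnd_black.
- by move=> i; rewrite /lab strandEnd_bedge.
- by move=> i; rewrite /lab strandEnd_target.
Qed.

Variable m : nat.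
Hypotheses (fm : length_is n f m) (nf : (nfaces G)%:Z = k%:Z * (n%:Z - k%:Z) + 1 - m%:Z).

Lemma faces_lift_length :
  (nfaces G)%:Z = (\sum_a wexc sig a)%N%:Z * (n%:Z - (\sum_a wexc sig a)%N%:Z) + 1 - lift_length sig.
Proof.
by rewrite (sum_wexc hf f_alift (n_gt0 hG)) (length_lift hf f_alift fm).
Qed.

(* Giving a closed strand the label of the strand crossing it would produce an interior edge with two equal labels. *)
Lemma strandEnd_some (h : Defs.half G) : strandEnd h != None.
Proof.
have nB e : ~~ isBndB (eb G e) -> strandEnd (e, false) != None /\ strandEnd (e, true) != None.
  move=> ne; have neq x0 := label_neq (lab_labelling x0) faces_lift_length ne.
  move: neq; rewrite /lab.
  case: (strandEnd (e, false)) => [a|]; case: (strandEnd (e, true)) => [b|] //= neq.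
  - by have := neq a; rewrite eqxx.
  - by have := neq b; rewrite eqxx.
  - by have := neq (Ordinal (n_gt0 hG)); rewrite eqxx.
case: h => e b; case: (boolP (isBndB (eb G e))) => [/(bedgeP hG)[i ->]|/nB[]]; last by case: b.
by case: b; rewrite ?strandEnd_bedge ?strandEnd_target.
Qed.

End StrandLabels.

Lemma reduced_labelling (k n : nat) (f : int -> int) (G : pgraph n) :
  bounded_affine_perm k n f -> reduced_for G k f ->
  exists (hG : disk_graph G) (sig : 'I_n -> 'I_n) (p q : gE G -> 'I_n),
   [/\ labelling hG sig p q,
       (forall i : 'I_n, f (i.+1)%:Z = (alift sig i).+1%:Z),
       (nfaces G)%:Z = (\sum_a wexc sig a)%N%:Z * (n%:Z - (\sum_a wexc sig a)%N%:Z) + 1 - lift_length sig,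
       (forall e, strandEnd (e, false) = Some (p e)) & (forall e, strandEnd (e, true) = Some (q e))].
Proof.
move=> hf [hG _ sp [m [fm nf]]]; pose x0 := Ordinal (n_gt0 hG).
exists hG, (strand_target hG), (fun e => lab x0 (e, false)), (fun e => lab x0 (e, true)).
have some := strandEnd_some hf hG sp fm nf.
split; first exact: lab_labelling hf hG sp x0.
- exact: f_alift.
- exact (faces_lift_length hf hG sp fm nf).
- by move=> e; rewrite /lab; case: (strandEnd (e, false)) (some (e, false)).
- by move=> e; rewrite /lab; case: (strandEnd (e, true)) (some (e, true)).
Qed.

Section Trig.
Variable R : realType.

Lemma sin_eq0 (x : R) : sin x = 0 -> exists z : int, x = z%:~R * trigo.pi.
Proof.
move=> s0; pose z := Num.floor (x / trigo.pi); exists z.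
have pi0 : 0 < trigo.pi :> R := pi_gt0 R.
pose y := x - z%:~R * trigo.pi.
have [y0 y1] : 0 <= y /\ y < trigo.pi.
  have /andP[] := floor_itv (x / trigo.pi); rewrite -/z ler_pdivlMr // ltr_pdivrMr //.
  rewrite /y intrD mulrDl mul1r; split; lra.
have siny : sin y = 0.
  have sz (m : nat) (u : R) : sin (u + m%:R * trigo.pi) = (-1) ^+ m * sin u.
    elim: m u => [|m IH] u; first by rewrite mul0r addr0 expr0 mul1r.
    by rewrite -natr1 mulrDl mul1r addrA sinDpi IH exprS; ring.
  have sn (m : nat) (u : R) : sin u = 0 -> sin (u + m%:R * trigo.pi) = 0.
    by rewrite sz => ->; rewrite mulr0.
  have sm (m : nat) (u : R) : sin u = 0 -> sin (u - m%:R * trigo.pi) = 0.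
    move=> u0; have := sz m (u - m%:R * trigo.pi); rewrite subrK u0 => /esym/eqP.
    by rewrite mulf_eq0 signr_eq0 /= => /eqP.
  rewrite /y; case: (intP z) => [|m|m]; first by rewrite mul0r subr0.
    exact: sm.
  rewrite rmorphN mulNr opprK; exact: sn.
have : ~~ (0 < y < trigo.pi) by apply/negP => /sin_gt0_pi; rewrite siny ltxx.
rewrite y1 andbT -leNgt => yle; have : y = 0 by lra.
by rewrite /y => /eqP; rewrite subr_eq0 => /eqP.
Qed.

Lemma sin_sub_neq0 n (theta : 'I_n -> R) i j : generic theta -> i != j -> sin (theta i - theta j) != 0.
Proof. by move=> gen ij; apply/eqP => /sin_eq0; apply: gen. Qed.

End Trig.

Lemma poly_fun_eq0 (F : numDomainType) (P : {poly F}) : (forall x, P.[x] = 0) -> P = 0.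
Proof.
move=> P0; apply/eqP; apply: contraT => nz.
pose s : seq F := [seq i%:R | i <- iota 0 (size P)].
have us : uniq s.
  rewrite map_inj_uniq ?iota_uniq // => i j /eqP; rewrite eqr_nat => /eqP //.
have := max_poly_roots nz (rs := s); rewrite us size_map size_iota ltnn.
by move=> -> //; apply/allP => x _; rewrite /root P0.
Qed.

(** * Critical weights and the wedge equations for the curve *)

Section Final.
Variables (R : realType) (k n : nat) (f : int -> int) (theta : 'I_n -> R) (G : pgraph n).
Hypotheses (hf : bounded_affine_perm k n f) (hG : disk_graph G).
Hypothesis gen : generic theta.
Variables (sig : 'I_n -> 'I_n) (p q : gE G -> 'I_n).
Hypothesis hL : labelling hG sig p q.
Hypothesis fE : forall i : 'I_n, f (i.+1)%:Z = (alift sig i).+1%:Z.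
Hypothesis faces : (nfaces G)%:Z = (\sum_a wexc sig a)%N%:Z * (n%:Z - (\sum_a wexc sig a)%N%:Z) + 1 - lift_length sig.
Hypotheses (pE : forall e, strandEnd (e, false) = Some (p e)) (qE : forall e, strandEnd (e, true) = Some (q e)).
Local Notation desc := (desc p q).
Local Notation wt := (@wt_theta n G R theta).
Local Notation J_ := (Jset f).

Let neq e : ~~ isBndB (eb G e) -> q e != p e := label_neq hL faces (e := e).
Let one v : interior v -> (\sum_(e in star v) desc e = 1)%N := sum_desc_star hL faces (v := v).

(** The rule that the larger label comes first inside the sine is the descent sign; the Kasteleyn
    sign cancels it, so the signed weight is the sine of [theta (q e) - theta (p e)]. *)
Lemma wt_theta_interior e : ~~ isBndB (eb G e) ->
  wt e = (-1) ^+ desc e * sin (theta (q e) - theta (p e)).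
Proof.
move=> ne; rewrite /wt_theta (negbTE ne) pE qE (_ : desc e = (q e <= p e)%N) //.
have := neq ne; rewrite -val_eqE /=; case: (ltngtP (q e) (p e)) => //= _ _.
  by rewrite expr1 mulN1r -sinN opprB.
by rewrite expr0 mul1r.
Qed.

Lemma wt_theta_bedge i : wt (bedge hG i) = 1.
Proof. by rewrite /wt_theta eb_bedge /isBndB codom_f. Qed.

Lemma wt_theta_neq0 e : wt e != 0.
Proof.
case: (boolP (isBndB (eb G e))) => [/(bedgeP hG)[i ->]|ne]; first by rewrite wt_theta_bedge oner_neq0.
by rewrite wt_theta_interior // mulf_neq0 ?signr_eq0 ?sin_sub_neq0 ?neq.
Qed.

Lemma card_dset : #|dset sig| = k.
Proof.
rewrite -(sum_wexc hf fE (n_gt0 hG)) -sum1_card big_mkcond /=.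
by apply: eq_bigr => i _; rewrite inE /wexc; case: leqP.
Qed.

Lemma card_cols J : #|cols G J| = (#|[set b : gB G | ~~ isBndB b]| + #|J|)%N.
Proof.
have -> : cols G J = [set b : gB G | ~~ isBndB b] :|: bnd G @: J.
  apply/setP=> b; rewrite !inE; congr (_ || _); apply/exists_inP/imsetP => [[j jJ /eqP->]|[j jJ ->]]; by exists j.
rewrite cardsU card_imset; last exact: (proj1 hG).
rewrite (_ : _ :&: _ = finset.set0) ?cards0 ?subn0 //.
apply/setP=> b; rewrite !inE; apply/negbTE/negP => /andP[nb /imsetP[j _ bE]].
by rewrite bE /isBndB codom_f in nb.
Qed.

Lemma card_white : #|gW G| = (#|[set b : gB G | ~~ isBndB b]| + k)%N.
Proof.
have cf := dmatch_config hL one.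
rewrite -[in RHS]card_dset -card_cols.
pose g w := eb G (dmatch one w).
have g_inj : injective g.
  move=> w w' E; have := @cf_inj _ _ _ _ _ cf (Some w) (Some w'); rewrite /= -/(g w) E.
  by move/(_ erefl) => [].
rewrite -(card_codom g_inj) -[RHS]cardsE; apply: eq_card => b; rewrite !inE -(cf_im cf).
apply/codomP/codomP => [[w ->]|[[w|] //= [->]]]; first by exists (Some w).
by exists w.
Qed.

Lemma card_cols_rows (J : {set 'I_n}) : #|J| = k.+1 -> #|{: option (gW G)}| = #|cols G J|.
Proof. by move=> cJ; rewrite card_option card_cols cJ card_white addnS. Qed.

Lemma heights_Jset : exists h : 'I_n -> gB G + gW G -> int,
  (forall x e, h x (inl (eb G e)) - h x (inr (ew G e)) = (p e == x)%:R + (q e == x)%:R) /\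
  (forall x r, h x (inr (ew G (bedge hG r))) = (x \in J_ r)%:R).
Proof.
have [h hP] := fin_all_exists (height_exists hL).
pose sinv := invF (sig_inj hL).
have sigK : cancel sig sinv := invF_f (sig_inj hL).
have sinvK : cancel sinv sig := f_invF (sig_inj hL).
pose i0 := Ordinal (n_gt0 hG).
(* The normalisation of the heights: the value of the boundary formula at its base point, and one
   more unit when the strand ending at [x] wraps, so that the heights next to the boundary become
   indicators. *)
pose c x : int := h x (inl (bnd G i0)) - (sig i0 == x)%:R - (x <= sinv x)%N%:R.
exists (fun x v => h x v - c x); split=> [x e|x r].
  by rewrite -(hP x).1; ring.
have := (hP x).1 (bedge hG r); rewrite eb_bedge (p_bedge hL) (q_bedge hL).
rewrite (height_bnd sigK sinvK (fun x => (hP x).2) x (i0 := i0) erefl r).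
have -> : (x \in J_ r) = (x != r) && (if (sinv x < x)%N then (sinv x < r < x)%N else (sinv x < r)%N || (r < x)%N).
  by rewrite -{1}(sinvK x) (JsetE hf fE) sinvK.
have -> : (sig r == x) = (r == sinv x) by rewrite -{1}(sinvK x) (inj_eq (sig_inj hL)).
rewrite /c; move: (h x (inl (bnd G i0))) (h x (inr _)) => A B.
rewrite -!val_eqE /=; move: (val (sinv x)) (val x) (val r) => s y t; move: ((sig i0 == x)%:R : int) => Z.
case: (ltngtP s t) => h1; case: (ltngtP t y) => h2; case: (ltngtP s y) => h3; rewrite /= => H; lia.
Qed.

Section Fixed.
Variable t : R.
Let C x := cos (t - theta x).
Let S x := sin (t - theta x).

Lemma relation_at (X : R) : (forall x, C x * X + S x != 0) -> forall J : {set 'I_n}, #|J| = k.+1 ->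
  \sum_(j in J) (-1) ^+ #|[set i in J | (i < j)%N]| * (eps f j * \prod_(x in J_ j) (C x * X + S x))
      * Delta G theta (J :\ j) = 0.
Proof.
move=> l0 J cJ; have [h [hE hJ]] := heights_Jset.
pose l x := C x * X + S x; have {}l0 x : l x != 0 := l0 x.
pose g (w : gB G + gW G) := \prod_x l x ^ (h x w).
pose v j := (-1) ^+ wexc sig j * \prod_(x in J_ j) l x.
rewrite -[RHS](@delta_relation _ _ _ _ _ _ hL neq one R wt J v (fun w => g (inr w)) _ _ (card_cols_rows cJ)).
- apply: eq_bigr => j jJ; congr (_ * _); rewrite mulrA /v mulrA; congr (_ * _).
  rewrite (eps_wexc fE) -!exprD /col_sign [in RHS](bigD1 j) //= -addnA.
  have -> : (\sum_(i < n | (i <= j)%N && (i != j)) wexc sig i = \sum_(i < n | (i < j)%N) wexc sig i)%N.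
    by apply: eq_bigl => i; rewrite ltn_neqAle andbC -val_eqE.
  rewrite addnAC -addnA addnA -[RHS]signr_odd -[LHS]signr_odd !oddD.
  by case: (odd (wexc _ _)); case: (odd #|_|); case: (odd _).
- move=> b nb.
  (* By the addition formula, the sine divided by [l (p e) * l (q e)] is [F (q e) - F (p e)]. The
     sum over the star vanishes because [q] permutes the labels [p] there. *)
  pose F x := C x / l x.
  rewrite (eq_bigr (fun e => g (inl b) * F (q e) - g (inl b) * F (p e))); last first.
    move=> e /eqP be; have ne : ~~ isBndB (eb G e) by rewrite be.
    have -> : g (inr (ew G e)) = g (inl b) / (l (p e) * l (q e)).
      rewrite /g; have hw x : h x (inr (ew G e)) = h x (inl b) - ((p e == x)%:R + (q e == x)%:R).
        by rewrite -be -hE; ring.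
      have pick1 y : \prod_x l x ^ ((y == x)%:R : int) = l y.
        rewrite (bigD1 y) //= eqxx big1 ?mulr1 ?expr1z // => x xy.
        by rewrite eq_sym (negbTE xy).
      rewrite (eq_bigr (fun x => l x ^ h x (inl b) / (l x ^ ((p e == x)%:R : int) * l x ^ ((q e == x)%:R : int)))).
        by rewrite big_split /= prodfV big_split /= !pick1.
      by move=> x _; rewrite hw !expfzDr ?l0 // -invr_expz expfzDr ?l0.
    rewrite wt_theta_interior // (mulrA ((-1) ^+ _)) -exprD -signr_odd oddD addbb expr0 mul1r.
    have -> : sin (theta (q e) - theta (p e)) = C (q e) * l (p e) - C (p e) * l (q e).
      have -> : theta (q e) - theta (p e) = (t - theta (p e)) - (t - theta (q e)) by ring.
      by rewrite sinB /l /C /S; ring.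
    by rewrite /F; field; rewrite !l0.
  by rewrite sumrB (star_black_sum hL (fun i => g (inl b) * F i) nb) subrr.
- move=> j; rewrite (desc_bedge hL) wt_theta_bedge mulr1 /v; congr (_ * _).
  rewrite /g [RHS]big_mkcond; apply: eq_bigr => x _; rewrite hJ.
  by case: (x \in J_ j); rewrite ?expr1z ?expr0z.
Qed.

Lemma gamma_wedge_zero : wedge_zero k (gamma f theta t) (Delta G theta).
Proof.
move=> J cJ.
pose L x : {poly R} := C x *: 'X + (S x)%:P.
have LE x X : (L x).[X] = C x * X + S x by rewrite /L !hornerE.
have L0 x : L x != 0.
  apply/eqP => E; have h1 := congr1 (horner^~ 0) E; have h2 := congr1 (horner^~ 1) E.
  move: h1 h2; rewrite /= !LE !horner0 mulr0 add0r mulr1 => Sx; rewrite Sx addr0 => Cx.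
  by have := cos2Dsin2 (t - theta x); rewrite -/(C x) -/(S x) Sx Cx !expr0n /= addr0 => /esym/eqP; rewrite oner_eq0.
pose P : {poly R} := \sum_(j in J) ((-1) ^+ #|[set i in J | (i < j)%N]| * eps f j * Delta G theta (J :\ j)) *: \prod_(x in J_ j) L x.
have PE X : P.[X] = \sum_(j in J) (-1) ^+ #|[set i in J | (i < j)%N]| * (eps f j * \prod_(x in J_ j) (C x * X + S x))
      * Delta G theta (J :\ j).
  rewrite /P horner_sum; apply: eq_bigr => j _; rewrite hornerZ horner_prod.
  by rewrite (eq_bigr _ (fun x _ => LE x X)); ring.
(* At each point either some [L x] vanishes or the relation for nonzero values applies. Each [L x]
   is a nonzero polynomial, because sine and cosine have no common zero, so the product can be
   cancelled and [X = 0] is allowed. *)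
have Q0 : P * \prod_x L x = 0.
  apply: poly_fun_eq0 => X; rewrite hornerM horner_prod.
  case: (pickP (fun x => (L x).[X] == 0)) => [x /eqP x0|nz].
    by rewrite (bigD1 x) //= x0 mul0r mulr0.
  by rewrite PE relation_at ?mul0r // => x; rewrite -LE nz.
have P0 : P = 0.
  by apply/eqP; move/eqP: Q0; rewrite mulf_eq0 => /orP[//|/prodf_eq0[x _]]; rewrite (negbTE (L0 x)).
have := PE 0; rewrite P0 horner0 => E; rewrite [RHS]E; apply: eq_bigr => j _.
congr (_ * _ * _); rewrite mxE; congr (_ * _); apply: eq_bigr => x _.
by rewrite mulr0 add0r.
Qed.

End Fixed.

Lemma Delta_dset_neq0 : Delta G theta (dset sig) != 0.
Proof.
have := @DeltaW_config _ _ hG _ wt (dset sig) None isT; rewrite /used_set => E.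
have -> : Delta G theta (dset sig) = DeltaW wt (dset sig) by [].
rewrite E; pose m0 : {ffun gW G -> gE G} := [ffun w => dmatch one w].
have mE : m0 =1 dmatch one by move=> w; rewrite ffunE.
have cf m : config (dset sig) None m <-> m =1 dmatch one.
  split; first exact: dmatch_unique.
  by move=> mm; rewrite (funext mm); apply: dmatch_config.
rewrite (big_pred1 m0).
  by apply/prodf_neq0 => w _; apply: wt_theta_neq0.
move=> m; apply/asboolP/eqP => [/cf mm|->]; last exact/cf.
by apply/ffunP => w; rewrite mm mE.
Qed.

End Final.

(** * A basis of the span from special points of the curve *)

Section Span.
Variables (R : realType) (k n : nat) (f : int -> int) (theta : 'I_n -> R).
Hypotheses (hf : bounded_affine_perm k n f) (gen : generic theta).
Variables (i0 : 'I_n) (sig : 'I_n -> 'I_n).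
Hypothesis fE : forall i : 'I_n, f (i.+1)%:Z = (alift sig i).+1%:Z.

Lemma gamma_eq0 x r : (gamma f theta (theta x) 0 r == 0) = (x \in Jset f r).
Proof.
rewrite mxE mulf_eq0 signr_eq0 /=; apply/idP/idP => [/prodf_eq0[y yJ]|xJ].
  by have [->//|xy] := eqVneq x y; rewrite (negbTE (sin_sub_neq0 gen xy)).
by rewrite (bigD1 x) //= subrr sin0 mul0r.
Qed.

Definition exc_image : {set 'I_n} := [set sig a | a in dset sig].
Local Notation I0 := exc_image.
Let e := inc_enum i0 (k := k) I0.

Definition gamma_basis : 'M[R]_(k, n) := \matrix_(i, j) gamma f theta (theta (e i)) 0 j.
Local Notation M := gamma_basis.

Lemma row_gamma_basis i : row i M = gamma f theta (theta (e i)).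
Proof. by apply/rowP=> j; rewrite !mxE. Qed.

Hypothesis cI0 : #|I0| = k.

Lemma minor_gamma_basis_neq0 : minor i0 M I0 != 0.
Proof.
have eI0 (a : 'I_k) : exists2 s : 'I_n, (sig s <= s)%N & e a = sig s.
  have : e a \in I0 by rewrite -(inc_enum_set i0 cI0) imset_f.
  by case/imsetP=> s; rewrite inE => ss ->; exists s.
(* [gamma (theta x)] vanishes at [r] exactly when [x] is in [J_r]. For a value [x = sig s] with
   [sig s <= s] this holds at all [r < x] and fails at [r = x]: the minor is triangular with nonzero
   diagonal. *)
rewrite /minor -det_tr det_trig; last first.
  apply/is_trig_mxP=> j i ji; rewrite !mxE.
  have := gamma_eq0 (e i) (e j); rewrite mxE => H; apply/eqP; rewrite {}H -/(e i).
  have lt := inc_enum_incr i0 cI0 ji; rewrite -/(e i) -/(e j) in lt.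
  have [s ss Es] := eI0 i; rewrite Es in lt *.
  rewrite (JsetE hf fE) ltnNge ss /= lt orbT andbT.
  by apply/eqP => E; rewrite E ltnn in lt.
apply/prodf_neq0 => i _; rewrite !mxE.
have := gamma_eq0 (e i) (e i); rewrite mxE => ->.
by rewrite inE eqxx andbF.
Qed.

Variable D : {set 'I_n} -> R.
Hypothesis D_wedge : forall t, wedge_zero k (gamma f theta t) D.
Hypothesis D_neq0 : exists2 I : {set 'I_n}, #|I| = k & D I != 0.

(** [D] and the minors satisfy the same wedge equations, whose solutions are determined by their
    value at [I0]. The factor is nonzero, as otherwise [D] would vanish on all sets of size [k]. *)
Lemma coordinates_gamma_basis : exists2 c : R, c != 0 &
  forall I : {set 'I_n}, #|I| = k -> D I = c * minor i0 M I.
Proof.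
pose c := D I0 / minor i0 M I0; exists c.
  have [I cI] := D_neq0; apply: contraNneq; rewrite /c => /eqP.
  rewrite mulf_eq0 invr_eq0 (negbTE minor_gamma_basis_neq0) orbF => /eqP DI0.
  apply/eqP; apply: (wedge_zero_unique cI0 minor_gamma_basis_neq0) cI => // i.
  by rewrite row_gamma_basis.
move=> I cI; apply/eqP; rewrite -subr_eq0; apply/eqP.
pose E I := D I - c * minor i0 M I.
apply: (wedge_zero_unique cI0 minor_gamma_basis_neq0 (D := E)) cI; last first.
  by rewrite /E /c divfK ?subrr ?minor_gamma_basis_neq0.
move=> i J cJ.
have h1 := wedge_zero_minor i0 M i cJ; have h2 := D_wedge (theta (e i)) cJ.
rewrite -row_gamma_basis in h2.
rewrite (eq_bigr (fun j : 'I_n => (-1) ^+ #|[set i in J | (i < j)%N]| * row i M 0 j * D (J :\ j)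
   - c * ((-1) ^+ #|[set i in J | (i < j)%N]| * row i M 0 j * minor i0 M (J :\ j)))).
  by rewrite sumrB -mulr_sumr h1 h2 mulr0 subr0.
by move=> j _; rewrite /E; ring.
Qed.

Lemma in_span_gamma_basis v : in_span_gamma f theta v <-> (v <= M)%MS.
Proof.
have [c c0 Dc] := coordinates_gamma_basis.
split=> [[m [ts [cs ->]]]|/submxP[u ->]].
  apply: summx_sub => j _; apply: scalemx_sub.
  apply: (wedge_zero_span cI0 minor_gamma_basis_neq0) => J cJ.
  apply: (mulfI c0); rewrite mulr0 -[RHS](D_wedge (ts j) cJ) mulr_sumr.
  apply: eq_bigr => i iJ; rewrite Dc; first by ring.
  by have := cardsD1 i J; rewrite iJ cJ => -[].
exists k, (fun i => theta (e i)), (fun i => u 0 i).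
rewrite mulmx_sum_row; apply: eq_bigr => i _.
by rewrite row_gamma_basis.
Qed.

End Span.

Theorem mainTheorem2 (R : realType) (k n : nat) (f : int -> int)
  (theta : 'I_n -> R)
  (hf : bounded_affine_perm k n f) (hloop : loopless f)
  (hgen : generic theta) (hadm : admissible f theta)
  (G : pgraph n) (hG : reduced_for G k f) :
  exists M : 'M[R]_(k, n),
    [/\ \rank M = k,
        (forall v : 'rV[R]_n, in_span_gamma f theta v <-> (v <= M)%MS) &
        exists2 c : R, c != 0 &
          forall s : 'I_k -> 'I_n, (forall a b : 'I_k, (a < b)%N -> (s a < s b)%N) ->
            Delta G theta [set s a | a : 'I_k] = c * \det (colsub s M)].
Proof.
have [dG [sig [p [q [hL fE faces pE qE]]]]] := reduced_labelling hf hG.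
pose i0 := Ordinal (n_gt0 dG).
have cd : #|dset sig| = k := card_dset hf dG fE.
have cI0 : #|exc_image sig| = k by rewrite card_imset //; apply: sig_inj hL.
have D_wedge t : wedge_zero k (gamma f theta t) (Delta G theta).
  exact: (gamma_wedge_zero theta hf hL fE faces pE qE).
have D_neq0 : exists2 I : {set 'I_n}, #|I| = k & Delta G theta I != 0.
  by exists (dset sig) => //; apply: (Delta_dset_neq0 hgen hL faces pE qE).
exists (gamma_basis k f theta i0 sig); split.
- exact: rank_minor (minor_gamma_basis_neq0 hf hgen i0 fE cI0).
- exact: (in_span_gamma_basis hf hgen i0 fE cI0 D_wedge D_neq0).
have [c c0 Dc] := coordinates_gamma_basis hf hgen i0 fE cI0 D_wedge D_neq0.
exists c => // s inc; rewrite Dc; last by rewrite card_imset ?card_ord //; apply: increasing_inj.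
congr (c * \det _); apply/matrixP=> a b; rewrite !mxE.
by rewrite (inc_enum_image i0 inc).
Qed.
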